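(* Let $T>0$ and $Q_T=(0,T)\times(0,1)$. Let $R:[0,T]\to(0,\infty)$, $K_1,K_2,K_3\in\mathbb R$ and $t\mapsto\rho_G(t,R(t))$ be given, and put $$a(t)=\frac1{R^2(t)},\qquad k(t)=\frac{R(t)R'(t)(K_1-1)}{K_2\,\rho_G(t,R(t))-K_3}.$$ Assume that: (1) $u_0\in L^\infty(0,1)$, with $|u_0(x)|\le M$ for a.e. $x\in(0,1)$; (2) $a,k\in W^{1,\infty}(0,T)$ and there are constants $a_0,k_0$ with $a(t)\ge a_0>0$ and $k(t)\ge k_0>0$ on $(0,T)$; (3) $f:\mathbb R\to\mathbb R$ is continuous; (4) there exist positive constants $C_1,C_1',C_2$ and $p$ with $1<p<3$ such that $uf(u)\ge C_1|u|^p-C_1'$ and $|f(u)|\le C_2(1+|u|^{p-1})$ for all $u\in\mathbb R$; (5) there is $\delta\in\mathbb R$ such that $(f(u)-f(v))(u-v)\ge-\delta|u-v|^2$ for all $u,v\in\mathbb R$; (6) $uf(u)\ge0$ for all $u\in\mathbb R$ with $|u|\ge\|u_0\|_{L^\infty(0,1)}$. Let $u$ be the unique solution of the variational problem $$\frac{d}{dt}\langle u(t),v\rangle+\tilde a(t;u(t),v)+\langle f(u(t)),v\rangle=0\quad\text{for all }v\in V,\qquad u(0)=u_0,$$ in the class $u\in L^2(0,T;V)\cap L^\infty(0,T;H)$, $x^{2/p}u\in L^p(Q_T)$, $tu\in L^\infty(0,T;V)$, $tu_t\in L^2(0,T;H)$. Then $u\in L^\infty(Q_T)$.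
   Context: $H$ is the real Hilbert space of (classes of) measurable functions $v:(0,1)\to\mathbb R$ with $\int_0^1x^2v^2(x)\,dx<\infty$, with inner product $\langle u,v\rangle=\int_0^1x^2u(x)v(x)\,dx$ and norm $\|\cdot\|_0$. $V=\{v\in H: v'\in H\}$ ($v'$ the weak derivative on $(0,1)$), a Hilbert space with inner product $\langle u,v\rangle+\langle u',v'\rangle$ and norm $\|\cdot\|_1$. Elements of $V$ are continuous on $(0,1]$, so $v(1)$ makes sense. For $u,v\in V$, $$\tilde a(t;u,v)=a(t)\int_0^1x^2u_xv_x\,dx+a(t)k(t)u(1)v(1)-\frac{R'(t)}{R(t)}\int_0^1x^3u_xv\,dx.$$ The notation $\langle f(u),v\rangle$ means $\int_0^1x^2f(u(x))v(x)\,dx$. The equation is understood in the sense of distributions on $(0,T)$ for each fixed $v\in V$, and $u(0)=u_0$ means that the continuous representative of $t\mapsto\langle u(t),v\rangle$ takes the value $\langle u_0,v\rangle$ at $t=0$ for every $v\in V$. $u_t$ is the distributional time derivative; $L^q(0,T;X)$ are the usual Bochner spaces. Under hypotheses (1)–(5) the variational problem is known to have exactly one solution in the stated class. This is the weak formulation of $$\partial_tu-a(t)\Big(u_{xx}+\frac2xu_x\Big)-x\frac{R'(t)}{R(t)}u_x+f(u)=0\ (0<x<1),\quad \Big|\lim_{x\to0+}xu_x(t,x)\Big|<\infty,\quad u_x(t,1)+k(t)u(t,1)=0,\quad u(0,x)=u_0(x),$$ where $R$ is the radius of a droplet and $\rho_G$ the density of the surrounding gas; both are regarded here as given. *)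

(* Defs.v *)
From HB Require Import structures.
From mathcomp Require Import all_boot all_order all_algebra.
From mathcomp Require Import all_classical all_reals all_analysis.

Set Implicit Arguments.
Unset Strict Implicit.
Unset Printing Implicit Defensive.

Import Order.TTheory GRing.Theory Num.Theory.
Import numFieldNormedType.Exports.

Local Open Scope classical_set_scope.
Local Open Scope ring_scope.

(* Elements of L^q, H, V, ... are handled through representatives (functions
   on the whole of R or R * R, whose values outside the domain are irrelevant);
   [measurable] is Borel measurability. *)

Section lebesgue_spaces.
Context d (S : measurableType d) (R : realType).
Variable nu : {measure set S -> \bar R}.

(* The norm of L^q(D) for an extended real q, by extension by 0 outside D *)
Definition Lnorm_on (q : \bar R) (D : set S) (g : S -> R) : \bar R :=
  Lnorm nu q ((EFin \o g) \_ D).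

Definition in_Lebesgue (q : \bar R) (D : set S) (g : S -> R) : Prop :=
  measurable_fun D g /\ (Lnorm_on q D g < +oo)%E.

End lebesgue_spaces.

Section weak_derivatives.
Context {R : realType}.
Local Notation mu := (@lebesgue_measure R).
Implicit Types (a b T : R) (g h phi : R -> R).

(* C_c^oo(a, b) *)
Definition test_function a b phi : Prop :=
  (forall n x, derivable (derive1n n phi) x 1) /\
  (exists c d, [/\ a < c, d < b & forall x, phi x != 0 -> c <= x <= d]).

Definition weak_derivative a b g h : Prop :=
  [/\ locally_integrable `]a, b[ g, locally_integrable `]a, b[ h &
      forall phi, test_function a b phi ->
        \int[mu]_(x in `]a, b[) (g x * derive1 phi x) =
        - \int[mu]_(x in `]a, b[) (h x * phi x)].

(* The same relation between the a.e.-classes of g and h: it is used for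
   functions of time, which are given by formulas that may be meaningless on a
   null set of times. *)
Definition weak_derivative_ae a b g h : Prop :=
  exists g' h', [/\ {ae mu, forall t, a < t < b -> g t = g' t},
                    {ae mu, forall t, a < t < b -> h t = h' t} &
                    weak_derivative a b g' h'].

Definition in_W1oo a b g : Prop :=
  exists h, [/\ weak_derivative_ae a b g h,
                (Lnorm_on mu +oo `]a, b[ g < +oo)%E &
                (Lnorm_on mu +oo `]a, b[ h < +oo)%E].

End weak_derivatives.

Section spaces_H_V.
Context {R : realType}.
Local Notation mu := (@lebesgue_measure R).
Implicit Types u v : R -> R.

Definition ip u v : R := \int[mu]_(x in `]0, 1[) (x ^+ 2 * u x * v x).

Definition norm0 v : R := Num.sqrt (ip v v).

Definition inH : set (R -> R) := [set v : R -> R |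
  measurable_fun (`]0, 1[ : set R) v /\
  (\int[mu]_(x in `]0%R, 1%R[) (x ^+ 2 * v x ^+ 2)%:E < +oo)%E].

Definition inV : set (R -> R) := [set v : R -> R |
  inH v /\ exists2 g, weak_derivative 0 1 v g & inH g].

(* A chosen version of the weak derivative on (0, 1), if there is one *)
Definition wderiv v : R -> R := xget (cst 0) [set g | weak_derivative 0 1 v g].

Definition norm1 v : R := Num.sqrt (ip v v + ip (wderiv v) (wderiv v)).

(* The value at 1 of the continuous representative of v on (0, 1] *)
Definition trace1 v : R := xget 0 [set c | exists w : R -> R,
  [/\ {within `]0, 1], continuous w},
      {ae mu, forall x, 0 < x < 1 -> v x = w x} & w 1 = c]].

End spaces_H_V.

Section bochner_spaces.
Context {R : realType}.
Local Notation mu := (@lebesgue_measure R).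
Variables (T : R) (X : set (R -> R)) (N : (R -> R) -> R).

(* Strong measurability on (0, T) of w with values in the space X normed by N:
   w is a.e. the limit of X-valued simple functions. *)
Definition X_simple (s : R -> R -> R) : Prop :=
  exists n (A : 'I_n -> set R) (c : 'I_n -> R -> R),
    [/\ forall i, measurable (A i), forall i, X (c i) &
        s = fun t x => \sum_(i < n) \1_(A i) t * c i x].

Definition strongly_measurable (w : R -> R -> R) : Prop :=
  exists s : nat -> R -> R -> R, (forall n, X_simple (s n)) /\
    {ae mu, forall t, 0 < t < T -> N (s n t \- w t) @[n --> \oo] --> 0}.

(* w \in L^q(0, T; X) *)
Definition in_Bochner (q : \bar R) (w : R -> R -> R) : Prop :=
  [/\ {ae mu, forall t, 0 < t < T -> X (w t)}, strongly_measurable w &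
      (Lnorm_on mu q `]0%R, T[ (N \o w) < +oo)%E].

End bochner_spaces.

Section variational_problem.
Context {R : realType}.
Local Notation mu := (@lebesgue_measure R).
Local Notation mu2 := (mu \x mu)%E.
Implicit Types (T t : R) (f : R -> R) (u : R -> R -> R).

Definition QT T : set (R * R) := `]0, T[ `*` `]0, 1[.

(* ut is the derivative of u in D'(0, T; H), tested against h \in H = H' *)
Definition time_derivative T u (ut : R -> R -> R) : Prop :=
  forall h, inH h ->
    weak_derivative_ae 0 T (fun t => ip (u t) h) (fun t => ip (ut t) h).

(* Measurability of u on Q_T is part of the condition x^(2/p) u \in L^p(Q_T). *)
Definition solution_class T (p : R) u : Prop :=
  [/\ in_Bochner T inV norm1 2%:E u /\ in_Bochner T inH norm0 +oo%E u,
      in_Lebesgue mu2 p%:E (QT T) (fun z => z.2 `^ (2 / p) * u z.1 z.2),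
      in_Bochner T inV norm1 +oo%E (fun t x => t * u t x) &
      exists2 ut, time_derivative T u ut &
        in_Bochner T inH norm0 2%:E (fun t x => t * ut t x)].

Definition coef_a (rad : R -> R) t : R := (rad t ^+ 2)^-1.

Definition coef_k (rad rad' : R -> R) (K1 K2 K3 : R) (rhoG : R -> R -> R) t : R :=
  rad t * rad' t * (K1 - 1) / (K2 * rhoG t (rad t) - K3).

Definition atilde (a k rad rad' : R -> R) t (u v : R -> R) : R :=
  a t * \int[mu]_(x in `]0, 1[) (x ^+ 2 * wderiv u x * wderiv v x)
  + a t * k t * trace1 u * trace1 v
  - rad' t / rad t * \int[mu]_(x in `]0, 1[) (x ^+ 3 * wderiv u x * v x).

Definition variational_solution T (a k rad rad' f u0 : R -> R) u : Prop :=
  forall v, inV v ->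
    weak_derivative_ae 0 T (fun t => ip (u t) v)
      (fun t => - (atilde a k rad rad' t (u t) v + ip (f \o u t) v)) /\
    (exists w : R -> R,
      [/\ {within `[0, T], continuous w},
          {ae mu, forall t, 0 < t < T -> ip (u t) v = w t} &
          w 0 = ip u0 v]).

End variational_problem.

(* Main.v *)
Require Import Defs.
From HB Require Import structures.
From mathcomp Require Import all_boot all_order all_algebra.
From mathcomp Require Import all_classical all_reals all_analysis.
From mathcomp Require Import measurable_realfun ess_sup_inf ring lra.

Set Implicit Arguments.
Unset Strict Implicit.
Unset Printing Implicit Defensive.

Import Order.TTheory GRing.Theory Num.Theory.
Import numFieldNormedType.Exports.

Local Open Scope classical_set_scope.
Local Open Scope ring_scope.

(* Let m be the essential bound of u0. Testing with phi(u), where phi = Phi' and Phi is a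
   convex function vanishing exactly on [-m, m], the energy
   E(t) = \int_0^1 x^2 Phi(u(t, x)) dx should satisfy E' <= C E with E(0) = 0: the drift term
   is absorbed by the diffusion since phi^2 <= C phi' Phi, and the reaction has a sign
   where phi does not vanish. As u' is not available down to t = 0, the equation is
   tested instead with the frozen function phi(u(tau)) between the times s and tau; by
   convexity
     E(tau) - E(s) <= <u(tau) - u(s), phi(u(tau))>,
   and the right-hand side is the integral over (s, tau) of an expression bounded by
   C E(tau) + C eta |u(tau)|_V^2 + (C / eta) |u(.) - u(tau)|_V^2. Averaging over s close to tau, the
   last term tends to 0 because translations are continuous in L^2(0, T; V). Letting then
   eta tend to 0, Gronwall's argument yields E = 0, that is |u| <= m almost everywhere. *)

(** * Integration *)

(** Three obstacles shape the details. For a fixed test function the equation yields information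
    outside a null set of times depending on it, whereas [phi \o u tau] changes with [tau]; a
    countable family approximating almost every value of [u] gives one null set for all test
    functions. Next, energies are compared only at almost all pairs of times, with errors small only
    in the mean, so Gronwall's argument is run on the primitive of the energy. The average is over s
    in ]tau - 2h, tau - h[, not up to tau: integrating over tau in ]0, t[ then leaves the primitive
    at t - h, to be compared with its value at t. Lastly, Phi must meet opposite demands: [phi] is
    C^1 and Lipschitz, so that phi(u) stays in V; Phi grows faster than linearly, for phi^2 <= C
    phi' Phi; and |f| |phi| grows at most quadratically, to be controlled by the norm of H. With
    [phi] growing like |u|^(2 - alpha) and f at most like |u|^(p - 1), this asks for p - 1 <= alpha
    < 2, whence the role of p < 3; alpha >= 1 keeps [phi] Lipschitz. *)

Section integration_facts.
Context d (T : measurableType d) (R : realType) (mu : {measure set T -> \bar R}).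
Implicit Types (D : set T) (f g h : T -> R).

Lemma gen_ae_imp (P Q : T -> Prop) : {ae mu, forall x, P x} ->
  (forall x, P x -> Q x) -> {ae mu, forall x, Q x}.
Proof. by move=> hP PQ; apply: filterS hP. Qed.

Lemma gen_ae_imp2 (P P' Q : T -> Prop) : {ae mu, forall x, P x} ->
  {ae mu, forall x, P' x} -> (forall x, P x -> P' x -> Q x) ->
  {ae mu, forall x, Q x}.
Proof. by move=> hP hP' PQ; apply: filterS2 hP hP'. Qed.

Lemma gen_integrable_mul_bounded D f h (C : R) : measurable D ->
  mu.-integrable D (EFin \o f) -> measurable_fun D h ->
  (forall x, D x -> `|h x| <= C) ->
  mu.-integrable D (EFin \o (fun x => f x * h x)).
Proof.
move=> mD fi mh hC.
have := integrableZl mD C fi.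
apply: le_integrable => //.
  apply/measurable_EFinP/measurable_funM => //.
  by case/integrableP : fi => /measurable_EFinP.
move=> x Dx /=; rewrite lee_fin normrM mulrC normrM ler_wpM2r//.
by rewrite (le_trans (hC _ Dx))// ler_norm.
Qed.

Lemma gen_le_integrable_R D f g : measurable D -> measurable_fun D f ->
  (forall x, D x -> `|f x| <= g x) -> mu.-integrable D (EFin \o g) ->
  mu.-integrable D (EFin \o f).
Proof.
move=> mD mf fg; apply: le_integrable => //; first exact/measurable_EFinP.
by move=> x Dx; rewrite lee_fin (le_trans (fg _ Dx))// ler_norm.
Qed.

Lemma gen_ae_eq_Rintegral D f g : measurable D -> measurable_fun D f ->
  measurable_fun D g -> {ae mu, forall x, D x -> f x = g x} ->
  \int[mu]_(x in D) f x = \int[mu]_(x in D) g x.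
Proof.
move=> mD mf mg fg; congr fine; apply: ae_eq_integral => //;
  [exact/measurable_EFinP|exact/measurable_EFinP|].
by apply: filterS fg => x h Dx; rewrite h.
Qed.

(** The pointwise comparison of integrals applies to [f \min g], which lies below [g] everywhere and
    equals [f] almost everywhere. *)
Lemma gen_ae_le_Rintegral D f g : measurable D ->
  mu.-integrable D (EFin \o f) -> mu.-integrable D (EFin \o g) ->
  {ae mu, forall x, D x -> f x <= g x} ->
  \int[mu]_(x in D) f x <= \int[mu]_(x in D) g x.
Proof.
move=> mD fi gi fg.
have mf : measurable_fun D f by case/integrableP : fi => /measurable_EFinP.
have mg : measurable_fun D g by case/integrableP : gi => /measurable_EFinP.
have fmi : mu.-integrable D (EFin \o (f \min g)).
  have := integrableD mD (integrable_norm fi) (integrable_norm gi).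
  apply: gen_le_integrable_R => //; first exact: measurable_minr.
  move=> x Dx /=; rewrite /Num.min; case: ifP => _; [rewrite lerDl|rewrite lerDr]; exact: normr_ge0.
rewrite -(@gen_ae_eq_Rintegral D (f \min g) f) //; last 2 first.
- exact: measurable_minr.
- by apply: filterS fg => x h Dx /=; apply/min_idPl/h.
by apply: le_Rintegral => // x Dx /=; rewrite ge_min lexx orbT.
Qed.

Lemma gen_Rdominated_convergence D (f_ : nat -> T -> R) f g : measurable D ->
  (forall n, measurable_fun D (f_ n)) -> measurable_fun D f ->
  {ae mu, forall x, D x -> f_ ^~ x @ \oo --> f x} ->
  mu.-integrable D (EFin \o g) ->
  {ae mu, forall x, D x -> forall n, `|f_ n x| <= g x} ->
  (fun n => \int[mu]_(x in D) f_ n x) @ \oo --> \int[mu]_(x in D) f x.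
Proof.
move=> mD mf_ mf cv gi dom.
have cv' : {ae mu, forall x, D x -> (f_ n x)%:E @[n --> \oo] --> (f x)%:E}.
  apply: filterS cv => x H Dx; apply/cvg_EFin; [exact: nearW|exact: H].
have [fi _ h] := dominated_convergence mD
  (fun n => (measurable_EFinP _ _).2 (mf_ n)) ((measurable_EFinP _ _).2 mf)
  cv' gi (filterS (fun x (H : D x -> _) n Dx => H Dx n) dom).
by apply: fine_cvg; rewrite /Rintegral fineK//; exact: integrable_fin_num.
Qed.

Lemma gen_Rintegral_eq0_outside D A f : A `<=` D ->
  (forall x, D x -> ~ A x -> f x = 0) ->
  \int[mu]_(x in D) f x = \int[mu]_(x in A) f x.
Proof.
move=> AD f0; rewrite Rintegral_mkcond [RHS]Rintegral_mkcond.
congr Rintegral; apply/funext => x; rewrite !patchE.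
have [Dx|Dx] := boolP (x \in D); have [Ax|Ax] := boolP (x \in A) => //.
- by apply: f0; [exact: set_mem|move/mem_set; exact/negP].
- by case/negP: Dx; apply/mem_set/AD/set_mem.
Qed.

End integration_facts.

(* Restated because unification does not recover the canonical measurable
   structure of R from the type of lebesgue_measure. *)
Section lebesgue_integration_facts.
Context {R : realType}.
Local Notation mu := (@lebesgue_measure R).
Implicit Types (D : set R) (f g h : R -> R).

Lemma ae_imp (P Q : R -> Prop) : {ae mu, forall x, P x} ->
  (forall x, P x -> Q x) -> {ae mu, forall x, Q x}.
Proof. exact (@gen_ae_imp _ _ R mu P Q). Qed.

Lemma ae_imp2 (P P' Q : R -> Prop) : {ae mu, forall x, P x} ->
  {ae mu, forall x, P' x} -> (forall x, P x -> P' x -> Q x) ->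
  {ae mu, forall x, Q x}.
Proof. exact (@gen_ae_imp2 _ _ R mu P P' Q). Qed.

Lemma integrable_mul_bounded D f h (C : R) : measurable D ->
  mu.-integrable D (EFin \o f) -> measurable_fun D h ->
  (forall x, D x -> `|h x| <= C) ->
  mu.-integrable D (EFin \o (fun x => f x * h x)).
Proof. exact (@gen_integrable_mul_bounded _ _ R mu D f h C). Qed.

Lemma le_integrable_R D f g : measurable D -> measurable_fun D f ->
  (forall x, D x -> `|f x| <= g x) -> mu.-integrable D (EFin \o g) ->
  mu.-integrable D (EFin \o f).
Proof. exact (@gen_le_integrable_R _ _ R mu D f g). Qed.

Lemma ae_eq_Rintegral D f g : measurable D -> measurable_fun D f ->
  measurable_fun D g -> {ae mu, forall x, D x -> f x = g x} ->
  \int[mu]_(x in D) f x = \int[mu]_(x in D) g x.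
Proof. exact (@gen_ae_eq_Rintegral _ _ R mu D f g). Qed.

Lemma ae_le_Rintegral D f g : measurable D ->
  mu.-integrable D (EFin \o f) -> mu.-integrable D (EFin \o g) ->
  {ae mu, forall x, D x -> f x <= g x} ->
  \int[mu]_(x in D) f x <= \int[mu]_(x in D) g x.
Proof. exact (@gen_ae_le_Rintegral _ _ R mu D f g). Qed.

Lemma Rdominated_convergence D (f_ : nat -> R -> R) f g : measurable D ->
  (forall n, measurable_fun D (f_ n)) -> measurable_fun D f ->
  {ae mu, forall x, D x -> f_ ^~ x @ \oo --> f x} ->
  mu.-integrable D (EFin \o g) ->
  {ae mu, forall x, D x -> forall n, `|f_ n x| <= g x} ->
  (fun n => \int[mu]_(x in D) f_ n x) @ \oo --> \int[mu]_(x in D) f x.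
Proof. exact (@gen_Rdominated_convergence _ _ R mu D f_ f g). Qed.

Lemma Rintegral_eq0_outside D A f : A `<=` D ->
  (forall x, D x -> ~ A x -> f x = 0) ->
  \int[mu]_(x in D) f x = \int[mu]_(x in A) f x.
Proof. exact (@gen_Rintegral_eq0_outside _ _ R mu D A f). Qed.

End lebesgue_integration_facts.

(** * Smooth steps *)

Section flat.
Context {R : realType}.
Implicit Types (P : {poly R}) (x y : R).

(** Induction on [P] for all [k] at once: a factor ['X] is absorbed by raising [k], and a constant
    leaves y^k <= k! exp(y), read off the exponential series. *)
Lemma poly_expR_bound P k : exists2 C : R, 0 <= C &
  forall y, 0 <= y -> `|P.[y]| * y ^+ k <= C * expR y.
Proof.
elim/poly_ind: P k => [|p c IH] k.
  by exists 0 => // y y0; rewrite horner0 normr0 mul0r mul0r.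
have [C C0 hC] := IH k.+1.
have [D D0 hD] : exists2 D : R, 0 <= D & forall y, 0 <= y -> y ^+ k <= D * expR y.
  case: k {IH C C0 hC} => [|k].
    by exists 1 => // y y0; rewrite expr0 mul1r -[leLHS]expR0 ler_expR.
  exists (k.+1)`!%:R => // y y0.
  have := @expR_ge1Dxn R y k y0.
  rewrite -(@ler_pM2l _ (k.+1)`!%:R) ?ltr0n ?fact_gt0//; apply: le_trans.
  rewrite mulrDr mulr1 mulrCA divff ?mulr1; last by rewrite pnatr_eq0 -lt0n fact_gt0.
  by rewrite lerDr.
exists (C + `|c| * D); first by rewrite addr_ge0// mulr_ge0.
move=> y y0; rewrite hornerMXaddC.
apply: (@le_trans _ _ ((`|p.[y]| * y + `|c|) * y ^+ k)).
  apply: ler_wpM2r; first exact: exprn_ge0.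
  by apply: (le_trans (ler_normD _ _)); rewrite normrM (ger0_norm y0).
rewrite mulrDl -mulrA -exprS mulrDl lerD ?hC//.
by rewrite -mulrA ler_wpM2l ?hD.
Qed.

(** The polynomial factor closes the family under derivation: the derivative of P(1/x) exp(-1/x) is
    Q(1/x) exp(-1/x) with Q = X^2 (P - P'). Smoothness of exp(-1/x) thus reduces to one first
    derivative. *)
Definition flat P x : R := if 0 < x then P.[x^-1] * expR (- x^-1) else 0.

Lemma flat_bound P : exists2 C : R, 0 <= C & forall x, `|flat P x| <= C * x ^+ 2.
Proof.
have [C C0 hC] := poly_expR_bound P 2; exists C => // x.
rewrite /flat; case: ifPn => x0; last by rewrite normr0 mulr_ge0// sqr_ge0.
have xV : 0 < x^-1 by rewrite invr_gt0.
have := hC _ (ltW xV).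
rewrite normrM (ger0_norm (expR_ge0 _)) expRN exprVn ler_pdivrMr ?exprn_gt0//.
rewrite ler_pdivrMr ?expR_gt0// => h.
by rewrite mulrAC.
Qed.

Lemma is_derive_flat P x : is_derive x 1 (flat P) (flat ('X^2 * (P - P^`())) x).
Proof.
have [x0|x0|<-] := ltgtP 0 x.
- have H : is_derive x 1 (fun y => P.[y^-1] * expR (- y^-1))
      (flat ('X^2 * (P - P^`())) x).
    have dV : is_derive x 1 (fun y : R => y^-1) (- x ^- 2).
      have h := @is_deriveV R id x 1 1 (lt0r_neq0 x0) (is_derive_id _ _).
      by apply: is_derive_eq h _; rewrite scaler1.
    have d1 : is_derive x 1 (horner P \o (fun y : R => y^-1)) (P^`().[x^-1] * (- x ^- 2)).
      exact: is_derive1_comp.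
    have d2 : is_derive x 1 (expR \o (fun y : R => - y^-1)) (expR (- x^-1) * (x ^- 2)).
      apply: is_derive1_comp.
      by have := is_deriveN dV; rewrite opprK.
    apply: is_derive_eq (is_deriveM d1 d2) _.
    rewrite /flat x0 !hornerE /= ?hornerXn /GRing.scale /= -?exprVn; ring.
  apply: near_eq_is_derive H.
  near=> y; rewrite /flat ifT//; near: y; exact: lt_nbhsr.
- apply: (@near_eq_is_derive _ _ _ (cst 0)).
    near=> y; rewrite /flat ifF//; apply/negbTE; rewrite -leNgt; apply/ltW.
    near: y; exact: lt_nbhsl.
  apply: is_derive_eq (is_derive_cst _ _ _) _.
  by rewrite /flat ltNge (ltW x0).
(* At 0 the quadratic bound makes the difference quotient O(|h|). *)
- have -> : flat ('X^2 * (P - P^`())) 0 = 0 by rewrite /flat ltxx.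
  have [C C0 hC] := flat_bound P.
  have cv : (h^-1 *: (flat P (h *: 1 + 0) - flat P 0)) @[h --> 0^'] --> (0:R).
    apply/cvgr0Pnorm_lt => e e0.
    near=> h.
    have h0 : h != 0 by near: h; exact: nbhs_dnbhs_neq.
    rewrite [flat P 0]/flat ltxx subr0 addr0 [_ *: 1]mulr1 normrZ normrV ?unitfE//.
    rewrite mulrC ltr_pdivrMr ?normr_gt0//.
    apply: (le_lt_trans (hC h)).
    rewrite -[h ^+ 2]real_normK ?num_real// expr2 mulrA ltr_pM2r ?normr_gt0//.
    apply: (@le_lt_trans _ _ ((C + 1) * `|h|)); first by rewrite ler_wpM2r// lerDl.
    rewrite mulrC -ltr_pdivlMr; last by lra.
    near: h; apply: dnbhs0_lt.
    by apply: divr_gt0 => //; lra.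
  split; first by apply/cvg_ex; exists 0.
  exact/cvg_lim.
Unshelve. all: by end_near. Qed.

Lemma flat_ge0 x : 0 <= flat 1 x.
Proof. by rewrite /flat; case: ifP => // _; rewrite hornerC mul1r expR_ge0. Qed.

Lemma flat_gt0 x : 0 < x -> 0 < flat 1 x.
Proof. by rewrite /flat => ->; rewrite hornerC mul1r expR_gt0. Qed.

Lemma flat_le0 P x : x <= 0 -> flat P x = 0.
Proof. by rewrite /flat ltNge => ->. Qed.

End flat.

Section smooth_step.
Context {R : realType}.
Implicit Types (s e x : R).

Let D x : R := flat 1 (1 + x) + flat 1 (1 - x).

Let D_gt0 x : 0 < D x.
Proof.
rewrite /D; have [x1|x1] := ltP (-1) x.
  by rewrite ltr_pwDl ?flat_ge0// flat_gt0//; lra.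
by rewrite ltr_wpDl ?flat_ge0// flat_gt0//; lra.
Qed.

(** The classical quotient passing from 0 at -1 to 1 at 1; its denominator never vanishes because 1
    + x and 1 - x are not both nonpositive. *)
Definition smooth_step x : R := flat 1 (1 + x) / D x.

Lemma smooth_step_ge0 x : 0 <= smooth_step x.
Proof. by rewrite divr_ge0 ?flat_ge0// ltW. Qed.

Lemma smooth_step_le1 x : smooth_step x <= 1.
Proof. by rewrite ler_pdivrMr// mul1r /D lerDl flat_ge0. Qed.

Lemma smooth_step0 x : x <= -1 -> smooth_step x = 0.
Proof. by move=> h; rewrite /smooth_step flat_le0 ?mul0r//; lra. Qed.

Lemma smooth_step1 x : 1 <= x -> smooth_step x = 1.
Proof.
move=> h; rewrite /smooth_step /D [flat _ (1 - x)]flat_le0 ?addr0; last by lra.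
by rewrite divff// gt_eqF// flat_gt0//; lra.
Qed.

(* A class of functions closed under derivation that contains the smooth steps;
   the affine substitutions are built in, so that no chain rule for higher
   derivatives is needed. *)
Inductive step_class : (R -> R) -> Prop :=
| SC_flat P c d : step_class (fun x => flat P (c * x + d))
| SC_cst c : step_class (cst c)
| SC_inv c d : step_class (fun x => (D (c * x + d))^-1)
| SC_add f g : step_class f -> step_class g -> step_class (f + g)
| SC_mul f g : step_class f -> step_class g -> step_class (f * g).

Let is_derive_affine c d x : is_derive x 1 (fun y : R => c * y + d) c.
Proof.
have h := is_deriveD (is_deriveZ c (is_derive_id x (1:R))) (is_derive_cst d x 1).
by apply: is_derive_eq h _; rewrite addr0 [_ *: _]mulr1.
Qed.

Let is_derive_D x : is_derive x 1 D
  (flat ('X^2 * (1 - 1^`())) (1 + x) - flat ('X^2 * (1 - 1^`())) (1 - x)).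
Proof.
have a1 := is_derive_affine 1 1 x; have a2 := is_derive_affine (-1) 1 x.
have d1 := @is_derive1_comp R (flat 1) _ x _ _ (is_derive_flat 1 _) a1.
have d2 := @is_derive1_comp R (flat 1) _ x _ _ (is_derive_flat 1 _) a2.
have -> : D = (flat 1 \o (fun y => 1 * y + 1)) + (flat 1 \o (fun y => -1 * y + 1)).
  by apply/funext => y; rewrite /D !fctE /= mul1r mulN1r addrC (addrC 1) [in RHS]addrC (addrC (-y)).
apply: is_derive_eq (is_deriveD d1 d2) _.
by rewrite mulr1 mulrN1 mul1r mulN1r (addrC x) (addrC (- x)).
Qed.

Let step_class_derive f : step_class f ->
  exists2 f', step_class f' & forall x, is_derive x 1 f (f' x).
Proof.
elim=> {f}[P c d|c|c d|f g _ [f' Sf' df] _ [g' Sg' dg]|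
    f g Sf [f' Sf' df] Sg [g' Sg' dg]].
- exists (fun x => flat ('X^2 * (P - P^`())) (c * x + d) * c).
    exact: (SC_mul (SC_flat _ _ _) (SC_cst c)).
  move=> x.
  exact: (@is_derive1_comp R (flat P) _ x _ _ (is_derive_flat P _) (is_derive_affine c d x)).
- by exists (cst 0); [exact: SC_cst|move=> x; exact: is_derive_cst].
- pose Q : {poly R} := 'X^2 * (1 - 1^`()).
  pose I := fun x => (D (c * x + d))^-1.
  exists (cst (- c) * ((I * I) *
      ((fun x => flat Q (c * x + (1 + d))) + cst (-1) * (fun x => flat Q (- c * x + (1 - d)))))).
    apply: SC_mul; first exact: SC_cst.
    apply: SC_mul; first by apply: SC_mul; exact: SC_inv.
    apply: SC_add; first exact: SC_flat.
    by apply: SC_mul; [exact: SC_cst|exact: SC_flat].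
  move=> x.
  have dD := @is_derive1_comp R D _ x _ _ (is_derive_D _) (is_derive_affine c d x).
  apply: is_derive_eq (is_deriveV _ dD) _; first by rewrite /= gt_eqF.
  rewrite !fctE /I /= -/Q (_ : forall a b : R, a *: b = a * b)//.
  have -> : c * x + (1 + d) = 1 + (c * x + d) by ring.
  have -> : - c * x + (1 - d) = 1 - (c * x + d) by ring.
  rewrite -exprVn; ring.
- exists (f' + g'); [exact: SC_add|move=> x; exact: is_deriveD].
- exists (f * g' + g * f'); first by apply: SC_add; apply: SC_mul.
  move=> x; exact: (is_deriveM (df x) (dg x)).
Qed.

Let step_class_smooth f n : step_class f -> forall x, derivable (derive1n n f) x 1.
Proof.
move=> Sf; suff : step_class (derive1n n f).
  by move=> /step_class_derive[g _ dg] x; have [] := dg x.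
elim: n => [|n /step_class_derive[g Sg dg]]; first by rewrite derive1n0.
rewrite derive1nS (_ : derive1 (derive1n n f) = g)//.
by apply/funext => x; rewrite derive1E; have [] := dg x.
Qed.

Lemma smooth_stepB_smooth s t e n x :
  derivable (derive1n n (fun x => smooth_step ((x - s) / e) - smooth_step ((x - t) / e))) x 1.
Proof.
apply: step_class_smooth.
pose F r := (fun x => flat 1 (e^-1 * x + (1 - r / e))) * (fun x => (D (e^-1 * x - r / e))^-1).
have -> : (fun x => smooth_step ((x - s) / e) - smooth_step ((x - t) / e)) =
    F s + cst (-1) * F t.
  apply/funext => y; rewrite /smooth_step /F !fctE.
  have E r : (y - r) / e = e^-1 * y - r / e by ring.
  by rewrite !E mulN1r !(addrCA 1).
by apply: SC_add; [|apply: SC_mul; first exact: SC_cst];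
  apply: SC_mul; [exact: SC_flat|exact: SC_inv|exact: SC_flat|exact: SC_inv].
Qed.

Lemma derivable_smooth_step x : derivable smooth_step x 1.
Proof.
have : step_class ((fun x => flat 1 (1 * x + 1)) * (fun x => (D (1 * x + 0))^-1)).
  by apply: SC_mul; [exact: SC_flat|exact: SC_inv].
move=> /step_class_derive[g _ dg].
have -> : smooth_step = (fun x => flat 1 (1 * x + 1)) * (fun x => (D (1 * x + 0))^-1).
  by apply/funext => y; rewrite /smooth_step !fctE mul1r addr0 addrC.
by have [] := dg x.
Qed.

Lemma continuous_derive1_smooth_step : continuous (derive1 smooth_step).
Proof.
have : step_class ((fun x => flat 1 (1 * x + 1)) * (fun x => (D (1 * x + 0))^-1)).
  by apply: SC_mul; [exact: SC_flat|exact: SC_inv].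
move=> /step_class_derive[g Sg dg].
have -> : smooth_step = (fun x => flat 1 (1 * x + 1)) * (fun x => (D (1 * x + 0))^-1).
  by apply/funext => y; rewrite /smooth_step !fctE mul1r addr0 addrC.
rewrite (_ : derive1 _ = g); last by apply/funext => x; rewrite derive1E; have [] := dg x.
have [g' _ dg'] := step_class_derive Sg.
by move=> x; apply/differentiable_continuous/derivable1_diffP; have [] := dg' x.
Qed.

End smooth_step.

(** * Mollifiers obtained from steps *)

Section mollified_steps.
Context {R : realType}.
Local Notation mu := (@lebesgue_measure R).
Implicit Types (s t e x : R) (g h : R -> R).

(** A smoothed Heaviside function at [s]: its derivative is a mollifier carried by [s - e, s + e],
    of integral 1 and size O(1 / e). *)
Definition step s e x : R := smooth_step ((x - s) / e).

Lemma is_derive_step s e x :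
  is_derive x 1 (step s e) (e^-1 * derive1 smooth_step ((x - s) / e)).
Proof.
have h1 : is_derive x 1 (fun y : R => (y - s) / e) e^-1.
  have -> : (fun y : R => (y - s) / e) = e^-1 *: ((id : R -> R) + cst (- s)).
    by apply/funext => y; rewrite !fctE [RHS]mulrC.
  apply: is_derive_eq
    (is_deriveZ e^-1 (is_deriveD (is_derive_id x (1:R)) (is_derive_cst (- s) x 1))) _.
  by rewrite addr0 [LHS]mulr1.
have h2 : is_derive ((x - s) / e) 1 smooth_step (derive1 smooth_step ((x - s) / e)).
  by rewrite derive1E; apply: DeriveDef => //; exact: derivable_smooth_step.
have h3 := @is_derive1_comp R smooth_step (fun y : R => (y - s) / e) x _ _ h2 h1.
by rewrite (mulrC e^-1).
Qed.

Lemma derive1_step s e x :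
  derive1 (step s e) x = e^-1 * derive1 smooth_step ((x - s) / e).
Proof. by rewrite derive1E; have [] := is_derive_step s e x. Qed.

Lemma continuous_derive1_step s e : continuous (derive1 (step s e)).
Proof.
rewrite (_ : derive1 _ = fun x => e^-1 * derive1 smooth_step ((x - s) / e)); last first.
  by apply/funext => x; rewrite derive1_step.
move=> x; apply: cvgM; first exact: cvg_cst.
apply: (@continuous_comp _ _ _ (fun x => (x - s) / e) (derive1 smooth_step)).
  by apply: cvgM; [apply: cvgB; [exact: cvg_id|exact: cvg_cst]|exact: cvg_cst].
exact: continuous_derive1_smooth_step.
Qed.

Lemma derive1_smooth_step_eq0 x : 1 < `|x| -> derive1 smooth_step x = 0.
Proof.
rewrite lter_normr => /orP[x1|x1].
- rewrite derive1E (@near_eq_derive _ R R smooth_step (cst 1)) ?derive_cst//.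
  near=> y; rewrite smooth_step1//; apply/ltW; near: y; exact: lt_nbhsr.
- rewrite derive1E (@near_eq_derive _ R R smooth_step (cst 0)) ?derive_cst//.
  near=> y; rewrite smooth_step0//; apply/ltW.
  by near: y; apply: lt_nbhsl; lra.
Unshelve. all: by end_near. Qed.

Lemma derive1_smooth_step_bound :
  exists2 K : R, 0 <= K & forall x, `|derive1 smooth_step x| <= K.
Proof.
have c : {within `[-1, 1], continuous (fun x : R => `|derive1 smooth_step x|)}.
  apply: continuous_subspaceT => x.
  by apply: (@cvg_norm _ _ _ (nbhs x)); exact: continuous_derive1_smooth_step.
have [|c0 _ hc] := EVT_max _ c; first by lra.
exists `|derive1 smooth_step c0|; first exact: normr_ge0.
move=> x.
have [x1|x1] := leP `|x| 1; last by rewrite derive1_smooth_step_eq0// normr0.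
by apply: hc; rewrite in_itv/= -ler_norml.
Qed.

Lemma derive1_step_eq0 s e x : 0 < e -> e < `|x - s| -> derive1 (step s e) x = 0.
Proof.
move=> e0 h; rewrite derive1_step derive1_smooth_step_eq0 ?mulr0//.
by rewrite normrM normfV (gtr0_norm e0) ltr_pdivlMr// mul1r.
Qed.

Lemma integral_derive1_step s e : 0 < e ->
  \int[mu]_(x in `[s - e, s + e]) derive1 (step s e) x = 1.
Proof.
move=> e0; have lt_se : s - e < s + e by lra.
rewrite /Rintegral (@continuous_FTC2 _ _ (step s e))//.
- rewrite /= /step smooth_step1 ?smooth_step0 ?subr0//.
    by rewrite (_ : s - e - s = - e) ?mulNr ?divff ?gt_eqF//; ring.
  by rewrite (_ : s + e - s = e) ?divff ?gt_eqF//; ring.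
- by apply: continuous_subspaceT; exact: continuous_derive1_step.
- split.
  + by move=> x _; have [] := is_derive_step s e x.
  + apply: cvg_at_right_filter; apply/differentiable_continuous/derivable1_diffP.
    by have [] := is_derive_step s e (s - e).
  + apply: cvg_at_left_filter; apply/differentiable_continuous/derivable1_diffP.
    by have [] := is_derive_step s e (s + e).
Qed.

Lemma lebesgue_ptP g x : lebesgue_pt g x -> forall eps, 0 < eps ->
  exists2 del, 0 < del & forall r, 0 < r -> r < del -> (davg g x r < eps%:E)%E.
Proof.
move=> gx eps eps0.
have : \forall r \near 0^'+, (davg g x r < eps%:E)%E.
  have U0 : nbhs (0%E : \bar R) [set y | (y < eps%:E)%E].
    by apply: open_nbhs_nbhs; split; [exact: open_ereal_lt_ereal|rewrite /= lte_fin].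
  exact: gx _ U0.
rewrite near_withinE => /nbhs_ballP[del /= del0 hdel].
exists del => // r r0 rdel; apply: hdel => //.
by rewrite /ball/= sub0r normrN gtr0_norm.
Qed.

(** As the mollifier has integral 1, the error is the integral of g - g(s) against it; the bound K /
    e on an interval of length 2e turns this into 2K times the mean oscillation [davg]. *)
Lemma mollify_bound g s e K : 0 < e ->
  (forall x, `|derive1 smooth_step x| <= K) ->
  mu.-integrable `[s - e, s + e] (EFin \o g) ->
  `| (\int[mu]_(x in `[s - e, s + e]) (g x * derive1 (step s e) x)) - g s | <=
  2 * K * fine (davg g s e).
Proof.
move=> e0 hK ig; have lt_se : s - e < s + e by lra.
have mg : measurable_fun `[s - e, s + e] g by case/integrableP: ig => /measurable_EFinP.
have ms : measurable_fun `[s - e, s + e] (derive1 (step s e)).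
  by apply: measurable_funTS; apply: continuous_measurable_fun; exact: continuous_derive1_step.
have bs x : `|derive1 (step s e) x| <= K / e.
  rewrite derive1_step normrM normfV (gtr0_norm e0) mulrC.
  by rewrite ler_wpM2r// invr_ge0 ltW.
have ist : mu.-integrable `[s - e, s + e] (EFin \o derive1 (step s e)).
  apply: continuous_compact_integrable; first exact: segment_compact.
  by apply: continuous_subspaceT; exact: continuous_derive1_step.
have igs : mu.-integrable `[s - e, s + e] (EFin \o (fun x => g x * derive1 (step s e) x)).
  by apply: (integrable_mul_bounded _ ig ms (fun x _ => bs x)).
have ics : mu.-integrable `[s - e, s + e] (EFin \o (fun x => g s * derive1 (step s e) x)).
  exact: (integrableZl _ (g s) ist).
have -> : \int[mu]_(x in `[s - e, s + e]) (g x * derive1 (step s e) x) - g s =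
    \int[mu]_(x in `[s - e, s + e])
      (g x * derive1 (step s e) x - g s * derive1 (step s e) x).
  by rewrite RintegralB// RintegralZl// integral_derive1_step// mulr1.
have ic : mu.-integrable `[s - e, s + e] (EFin \o cst (g s)).
  apply: continuous_compact_integrable; first exact: segment_compact.
  by apply: continuous_subspaceT => ?; exact: cvg_cst.
have igc : mu.-integrable `[s - e, s + e] (EFin \o (fun x => g x - g s)).
  exact: (integrableB _ ig ic).
have in' := integrable_norm igc.
apply: le_trans; first apply: le_normr_Rintegral => //; first exact: (integrableB _ igs ics).
have iK : mu.-integrable `[s - e, s + e] (EFin \o (fun x => K / e * `|g x - g s|)).
  exact: (integrableZl _ (K / e) in').
apply: (@le_trans _ _ (\int[mu]_(x in `[s - e, s + e]) (K / e * `|g x - g s|))).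
  apply: le_Rintegral => //.
    exact: (integrable_norm (integrableB _ igs ics)).
  by move=> x _; rewrite -mulrBl normrM mulrC ler_wpM2r.
rewrite RintegralZl//.
rewrite /davg /iavg ball_itv /= lebesgue_measure_itv /= lte_fin lt_se -EFinD.
have -> : (s + e - (s - e)) = 2 * e by ring.
rewrite inver ifF; last by rewrite mulf_eq0 gt_eqF//= gt_eqF.
rewrite /Rintegral -(@integral_itv_bndoo _ _ _ (fun x => `|(g x - g s)%:E|%E) true false)//; last first.
  apply/measurable_EFinP/measurableT_comp => //; apply: measurable_funB => //.
  by apply: measurable_funS mg => //; exact: subset_itv_oo_cc.
rewrite fineM//; last exact: integrable_fin_num in'.
rewrite le_eqVlt; apply/orP; left; apply/eqP => /=; field.
by rewrite gt_eqF.
Qed.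

End mollified_steps.

(** * Weak derivatives on an interval *)

Section weak_derivative_theory.
Context {R : realType}.
Local Notation mu := (@lebesgue_measure R).
Implicit Types (a b s t e x : R) (g h : R -> R).

Lemma ae_neq s : {ae mu, forall x, x != s}.
Proof.
exists [set s]; split => //; first exact: lebesgue_measure_set1.
by move=> x /= /negP; rewrite negbK => /eqP.
Qed.

Lemma locally_integrable_itv a b c d g : locally_integrable `]a, b[ g ->
  a < c -> d < b -> mu.-integrable `[c, d] (EFin \o g).
Proof.
move=> [mg _ ig] ac db.
have sub : `[c, d] `<=` `]a, b[.
  by move=> x /=; rewrite !in_itv/= => /andP[? ?]; apply/andP; split; lra.
apply/integrableP; split; last exact: ig (@segment_compact _ _ _).
by apply/measurable_EFinP; apply: measurable_funS mg.
Qed.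

(** A smooth approximation of the indicator of ]s, t[ whose derivative is a mollifier at [s] minus a
    mollifier at [t]; tested against a weak derivative, it produces the difference of two point
    values. *)
Definition plateau s t e x : R := step s e x - step t e x.

Lemma plateau_norm s t e x : `|plateau s t e x| <= 1.
Proof.
have h1 := smooth_step_ge0 ((x - s) / e); have h2 := smooth_step_le1 ((x - s) / e).
have h3 := smooth_step_ge0 ((x - t) / e); have h4 := smooth_step_le1 ((x - t) / e).
by rewrite ler_norml /plateau /step; apply/andP; split; lra.
Qed.

Lemma stepl s e x : 0 < e -> x <= s - e -> step s e x = 0.
Proof. by move=> e0 h; apply: smooth_step0; rewrite ler_pdivrMr//; lra. Qed.

Lemma stepr s e x : 0 < e -> s + e <= x -> step s e x = 1.
Proof. by move=> e0 h; apply: smooth_step1; rewrite ler_pdivlMr//; lra. Qed.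

Lemma plateau_eq0 s t e x : 0 < e -> s <= t -> ~~ (s - e <= x <= t + e) ->
  plateau s t e x = 0.
Proof.
move=> e0 st; rewrite negb_and -!ltNge => /orP[] h.
  by rewrite /plateau !stepl ?subr0//; lra.
by rewrite /plateau !stepr ?subrr//; lra.
Qed.

Lemma plateau_test a b s t e : 0 < e -> s <= t -> a < s - e -> t + e < b ->
  test_function a b (plateau s t e).
Proof.
move=> e0 st ase teb; split; first by move=> n x; exact: smooth_stepB_smooth.
exists (s - e), (t + e); split => // x.
by apply: contraNT => h; rewrite plateau_eq0.
Qed.

Lemma derive1_plateau s t e x :
  derive1 (plateau s t e) x = derive1 (step s e) x - derive1 (step t e) x.
Proof.
have h := is_deriveB (is_derive_step s e x) (is_derive_step t e x).
by rewrite derive1E (@derive_val _ _ _ _ _ _ _ h) !derive1_step.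
Qed.

Lemma measurable_plateau s t e (D : set R) : measurable_fun D (plateau s t e).
Proof.
apply: measurable_funTS; apply: continuous_measurable_fun => x.
apply: cvgB; apply/differentiable_continuous/derivable1_diffP;
  [have [] := is_derive_step s e x|have [] := is_derive_step t e x] => //.
Qed.

(** [e0] is half the room left around [s, t], so that all the plateaux of width [e_ n] live in the
    one compact interval [s - e0, t + e0] of ]a, b[, where locally integrable functions are
    integrable. *)
Lemma small_steps a b s t : a < s -> t < b -> exists e0 (e_ : nat -> R),
  [/\ a < s - e0, t + e0 < b, forall n, 0 < e_ n <= e0 & e_ @ \oo --> 0].
Proof.
move=> as_ tb; pose e0 := Num.min (s - a) (b - t) / 2.
have m0 : 0 < Num.min (s - a) (b - t) by rewrite lt_min !subr_gt0 as_ tb.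
have m1 : Num.min (s - a) (b - t) <= s - a by rewrite ge_min lexx.
have m2 : Num.min (s - a) (b - t) <= b - t by rewrite ge_min lexx orbT.
have e00 : 0 < e0 by rewrite /e0; lra.
exists e0, (fun n => e0 / n.+1%:R); split.
- by rewrite /e0; lra.
- by rewrite /e0; lra.
- by move=> n; rewrite divr_gt0//= ler_pdivrMr// ler_peMr ?ler1n// ltW.
- by rewrite -[X in _ --> X](mulr0 e0); apply: cvgM; [exact: cvg_cst|exact: cvg_harmonic].
Qed.

Lemma cvg_plateau_integral a b s t e0 (e_ : nat -> R) h :
  locally_integrable `]a, b[ h -> s < t -> a < s - e0 -> t + e0 < b ->
  (forall n, 0 < e_ n <= e0) -> e_ @ \oo --> 0 ->
  (fun n => \int[mu]_(x in `]a, b[) (h x * plateau s t (e_ n) x)) @ \oo -->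
  \int[mu]_(x in `]s, t[) h x.
Proof.
move=> lh st ae0 eb0 eb ecvg.
have e00 : 0 < e0 by have /andP[] := eb 0; exact: lt_le_trans.
have eps_gt0 n : 0 < e_ n by have /andP[] := eb n.
have eps_le n : e_ n <= e0 by have /andP[] := eb n.
have sub1 : `[s - e0, t + e0] `<=` `]a, b[.
  by move=> x /=; rewrite !in_itv/= => /andP[? ?]; apply/andP; split; lra.
have sub2 : `]s, t[ `<=` `[s - e0, t + e0].
  by move=> x /=; rewrite !in_itv/= => /andP[? ?]; apply/andP; split; lra.
have ih : mu.-integrable `[s - e0, t + e0] (EFin \o h).
  exact: (locally_integrable_itv lh).
have mh : measurable_fun `[s - e0, t + e0] h.
  by case/integrableP : ih => /measurable_EFinP.
rewrite (_ : (fun n => _) = (fun n => \int[mu]_(x in `[s - e0, t + e0])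
    (h x * plateau s t (e_ n) x))); last first.
  apply/funext => n; apply: Rintegral_eq0_outside => // x _ /=.
  rewrite in_itv/= => /negP nx.
  rewrite plateau_eq0 ?mulr0//; [exact: ltW|].
  apply: contra nx => /andP[h1 h2]; have := eps_le n => h3.
  by apply/andP; split; lra.
rewrite (_ : \int[mu]_(x in `]s, t[) h x =
    \int[mu]_(x in `[s - e0, t + e0]) (h x * \1_(`]s, t[ : set R) x)); last first.
  transitivity (\int[mu]_(x in `]s, t[) (h x * \1_(`]s, t[ : set R) x)).
    by apply: eq_Rintegral => x xst; rewrite indicE xst mulr1.
  by apply/esym/Rintegral_eq0_outside => // x _ nx; rewrite indicE memNset ?mulr0.
apply: (@Rdominated_convergence R _
  (fun n x => h x * plateau s t (e_ n) x)
  (fun x => h x * \1_(`]s, t[ : set R) x) (fun x => `|h x|)) => //.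
- by move=> n; apply: measurable_funM => //; exact: measurable_plateau.
- by apply: measurable_funM => //; exact: measurable_indic.
(* Away from [s] and [t] the sequence is eventually constant, as soon as [e_ n] is smaller than the
   distance to both points. *)
- apply: (ae_imp2 (ae_neq s) (ae_neq t)) => x xs xt _.
  apply: cvgM; first exact: cvg_cst.
  apply: cvg_near_cst.
  have ev (del : R) : 0 < del -> \forall n \near \oo, e_ n < del.
    by move=> d0; apply: (@cvgr_lt _ _ _ _ _ 0 ecvg).
  have [xs'|xs'|xs'] := ltgtP x s; last by rewrite xs' eqxx in xs.
  + near=> n; rewrite indicE memNset /=; last by rewrite in_itv/= (lt_gtF xs').
    rewrite plateau_eq0//; [exact: ltW|].
    have : e_ n < s - x by near: n; apply: ev; rewrite subr_gt0.
    by move=> h1; apply/negP => /andP[? ?]; lra.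
  + have [xt'|xt'|xt'] := ltgtP x t; last by rewrite xt' eqxx in xt.
    * near=> n; rewrite indicE mem_set /=; last by rewrite in_itv/= xs' xt'.
      have e1 : e_ n < x - s by near: n; apply: ev; rewrite subr_gt0.
      have e2 : e_ n < t - x by near: n; apply: ev; rewrite subr_gt0.
      by rewrite /plateau stepr ?stepl ?subr0//; (exact: eps_gt0 || lra).
    * near=> n; rewrite indicE memNset /=; last by rewrite in_itv/= (lt_gtF xt') andbF.
      rewrite plateau_eq0//; [exact: ltW|].
      have : e_ n < x - t by near: n; apply: ev; rewrite subr_gt0.
      by move=> h1; apply/negP => /andP[? ?]; lra.
- exact: integrable_norm.
- apply: aeW => x _ n.
  by rewrite normrM -[leRHS]mulr1 ler_wpM2l// plateau_norm.
Unshelve. all: by end_near. Qed.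

(** Test with plateaux shrinking to the indicator of ]s, t[. The side of [h] converges by
    domination; on the side of [g], the mollifiers recover g(s) - g(t) because [s] and [t] are
    Lebesgue points. *)
Lemma weak_derivative_FTC a b g h s t : weak_derivative a b g h ->
  a < s -> s < t -> t < b -> lebesgue_pt g s -> lebesgue_pt g t ->
  g t - g s = \int[mu]_(x in `]s, t[) h x.
Proof.
move=> [lg lh gh] as_ st tb gs gt.
have [e0 [e_ [ae0 eb0 eb ecvg]]] := small_steps as_ tb.
have e00 : 0 < e0 by have /andP[] := eb 0; exact: lt_le_trans.
have e_gt0 n : 0 < e_ n by have /andP[] := eb n.
have e_le n : e_ n <= e0 by have /andP[] := eb n.
have C1 := cvg_plateau_integral lh st ae0 eb0 eb ecvg.
have [K K0 hK] := @derive1_smooth_step_bound R.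
have mol r n : a < r - e0 -> r + e0 < b ->
    \int[mu]_(x in `]a, b[) (g x * derive1 (step r (e_ n)) x) =
    \int[mu]_(x in `[r - e_ n, r + e_ n]) (g x * derive1 (step r (e_ n)) x).
  move=> ar rb; have h3 := e_le n; apply: Rintegral_eq0_outside.
    by move=> x /=; rewrite !in_itv/= => /andP[? ?]; apply/andP; split; lra.
  move=> x _ /= /negP; rewrite in_itv/= negb_and -!ltNge => nx.
  rewrite derive1_step_eq0 ?mulr0//.
  by rewrite lter_normr; apply/orP; case/orP: nx => h4; [right|left]; lra.
have igs r n : a < r - e0 -> r + e0 < b ->
    mu.-integrable `[r - e_ n, r + e_ n] (EFin \o g).
  move=> ar rb; have h3 := e_le n.
  by apply: (locally_integrable_itv lg); lra.
have lim r : a < r - e0 -> r + e0 < b -> lebesgue_pt g r ->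
    (fun n => \int[mu]_(x in `]a, b[) (g x * derive1 (step r (e_ n)) x)) @ \oo --> g r.
  move=> ar rb gr; apply/cvgrPdist_lt => eps eps0.
  have d0 : 0 < eps / (2 * K + 1) by apply: divr_gt0 => //; lra.
  have [del del0 hdel] := lebesgue_ptP gr d0.
  have : \forall n \near \oo, e_ n < del by apply: (@cvgr_lt _ _ _ _ _ 0 ecvg).
  apply: filterS => n en; rewrite distrC mol//.
  apply: le_lt_trans (mollify_bound (e_gt0 n) hK (igs r n ar rb)) _.
  have := hdel _ (e_gt0 n) en; have := davg_ge0 g r (e_ n).
  case: davg => //= q; rewrite lee_fin lte_fin => q0.
  rewrite ltr_pdivlMr; last by lra.
  by apply: le_lt_trans; rewrite mulrC ler_wpM2l//; lra.
have C2 : (fun n => \int[mu]_(x in `]a, b[) (g x * derive1 (step s (e_ n)) x) -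
    \int[mu]_(x in `]a, b[) (g x * derive1 (step t (e_ n)) x)) @ \oo --> g s - g t.
  by apply: cvgB; apply: lim => //; lra.
have E n : \int[mu]_(x in `]a, b[) (g x * derive1 (step s (e_ n)) x) -
    \int[mu]_(x in `]a, b[) (g x * derive1 (step t (e_ n)) x) =
    - \int[mu]_(x in `]a, b[) (h x * plateau s t (e_ n) x).
  have h3 := e_le n.
  rewrite -gh; last by apply: plateau_test; [exact: e_gt0|exact: ltW|lra|lra].
  have ext r : s <= r <= t ->
     mu.-integrable `]a, b[ (EFin \o (fun x => g x * derive1 (step r (e_ n)) x)).
    move=> /andP[sr rt].
    have -> : EFin \o (fun x => g x * derive1 (step r (e_ n)) x) =
       (EFin \o (fun x => g x * derive1 (step r (e_ n)) x)) \_ `[s - e0, t + e0].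
      apply/funext => x; rewrite patchE; case: ifPn => // /negP nx /=.
      rewrite derive1_step_eq0 ?mulr0//.
      rewrite ltNge; apply/negP; rewrite ler_norml => /andP[? ?].
      by apply: nx; apply/mem_set => /=; rewrite in_itv/=; apply/andP; split; lra.
    apply/integrable_restrict => //.
    apply: (@integrableS _ _ _ mu `[s - e0, t + e0]) => //; first exact: measurableI.
    apply: (@integrable_mul_bounded R _ g _ (K / e_ n)) => //.
    + exact: (locally_integrable_itv lg).
    + by apply: measurable_funTS; apply: continuous_measurable_fun; exact: continuous_derive1_step.
    + move=> x _; rewrite derive1_step normrM normfV (gtr0_norm (e_gt0 n)) mulrC.
      by rewrite ler_wpM2r// invr_ge0 ltW.
  have es : s <= s <= t by rewrite lexx ltW.
  have et : s <= t <= t by rewrite lexx ltW.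
  rewrite -(RintegralB _ (ext s es) (ext t et))//.
  by apply: eq_Rintegral => x _; rewrite derive1_plateau mulrBr.
have C3 : (fun n => - \int[mu]_(x in `]a, b[) (h x * plateau s t (e_ n) x)) @ \oo --> g s - g t.
  by move: C2; under eq_fun do rewrite E.
have := @cvg_unique _ _ _ _ _ _ C3 (cvgN C1).
by move=> /(_ (@norm_hausdorff _ _)) H; rewrite -[LHS]opprK opprB H opprK.
Qed.

Lemma weak_derivative_Rintegral_unique a b g h1 h2 s t :
  weak_derivative a b g h1 -> weak_derivative a b g h2 ->
  a < s -> s < t -> t < b ->
  \int[mu]_(x in `]s, t[) h1 x = \int[mu]_(x in `]s, t[) h2 x.
Proof.
move=> [lg lh1 gh1] [_ lh2 gh2] as_ st tb.
have [e0 [e_ [ae0 eb0 eb ecvg]]] := small_steps as_ tb.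
have := cvg_plateau_integral lh1 st ae0 eb0 eb ecvg.
have -> : (fun n => \int[mu]_(x in `]a, b[) (h1 x * plateau s t (e_ n) x)) =
    (fun n => \int[mu]_(x in `]a, b[) (h2 x * plateau s t (e_ n) x)).
  apply/funext => n; apply: oppr_inj; have /andP[e1 e2] := eb n.
  have tst : test_function a b (plateau s t (e_ n)).
    by apply: plateau_test => //; [exact: ltW|lra|lra].
  by rewrite -gh1// -gh2.
move=> C1; have C2 := cvg_plateau_integral lh2 st ae0 eb0 eb ecvg.
exact: (cvg_unique (@norm_hausdorff _ _) C1 C2).
Qed.

End weak_derivative_theory.

(** * Lebesgue points and uniqueness of weak derivatives *)

Section lebesgue_points.
Context {R : realType}.
Local Notation mu := (@lebesgue_measure R).
Implicit Types (a b s t e x : R) (g h : R -> R).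

Lemma near_davg_eq g g' x (c d : R) : c < x < d ->
  (forall y, c < y < d -> g y = g' y) ->
  lebesgue_pt g x -> lebesgue_pt g' x.
Proof.
move=> /andP[cx xd] gg'; rewrite /lebesgue_pt; apply: cvg_trans.
apply: near_eq_cvg; near=> r.
rewrite /davg /iavg; congr (_ * _)%E; apply: eq_integral => y.
rewrite inE ball_itv/= in_itv/= => /andP[h1 h2].
have rx : r < x - c by near: r; apply: nbhs_right_lt; rewrite subr_gt0.
have rd : r < d - x by near: r; apply: nbhs_right_lt; rewrite subr_gt0.
rewrite /= -!gg' ?cx//.
by apply/andP; split; lra.
Unshelve. all: by end_near. Qed.

(** The differentiation theorem concerns functions on the whole line: it is applied to [g] cut off
    to compact intervals exhausting ]a, b[, and being a Lebesgue point is a local property. *)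
Lemma ae_lebesgue_pt a b g : locally_integrable `]a, b[ g ->
  {ae mu, forall x, a < x < b -> lebesgue_pt g x}.
Proof.
move=> lg; pose D n : set R := `[a + n.+1%:R^-1, b - n.+1%:R^-1]%classic.
have : forall n, {ae mu, forall x, lebesgue_pt (g \_ (D n)) x}.
  move=> n; apply: lebesgue_differentiation.
  apply: integrable_locally_restrict; first by rewrite /D; exact: measurable_itv.
  by rewrite /D; apply: (locally_integrable_itv lg); rewrite ?ltrDl ?gtrBl invr_gt0.
move/ae_foralln => H; apply: (ae_imp H) => x hx /andP[ax xb].
have m0 : 0 < Num.min (x - a) (b - x) by rewrite lt_min !subr_gt0 ax xb.
have [n _ /(_ n (leqnn n)) hn] := near_infty_natSinv_lt (PosNum m0).
move: hn; rewrite /= lt_min => /andP[n1 n2].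
apply: (near_davg_eq (c := a + n.+1%:R^-1) (d := b - n.+1%:R^-1)) (hx n).
  by rewrite -ltrBrDl n1 ltrBrDl -ltrBrDr n2.
move=> y /andP[y1 y2]; rewrite patchE mem_set// /D /= in_itv/=.
by rewrite !ltW.
Qed.

(** If h(x) exceeded C, the mean of [h] over a small ball around x, being within h(x) - C of h(x),
    would exceed C too. *)
Lemma lebesgue_pt_le a b h C x : locally_integrable `]a, b[ h -> a < x < b ->
  (forall s t, a < s -> s < t -> t < b -> \int[mu]_(y in `]s, t[) h y <= C * (t - s)) ->
  lebesgue_pt h x -> h x <= C.
Proof.
move=> lh /andP[ax xb] hC hx; rewrite leNgt; apply/negP => Ch.
have e0 : 0 < h x - C by lra.
have [del del0 hdel] := lebesgue_ptP hx e0.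
(* Small enough for the oscillation bound and for the closed ball to stay inside ]a, b[. *)
pose r := Num.min (del / 2) (Num.min ((x - a) / 2) ((b - x) / 2)).
have r0 : 0 < r by rewrite !lt_min; apply/and3P; split; lra.
have r1 : r <= del / 2 by rewrite ge_min lexx.
have r2 : r <= (x - a) / 2 by rewrite !ge_min lexx orbT.
have r3 : r <= (b - x) / 2 by rewrite !ge_min lexx !orbT.
have h1 : \int[mu]_(y in `]x - r, x + r[) h y <= C * (x + r - (x - r)).
  by apply: hC; lra.
have ih : mu.-integrable `]x - r, x + r[ (EFin \o h).
  apply: (@integrableS _ _ _ mu `[x - r, x + r]) => //; first exact: subset_itv_oo_cc.
  by apply: (locally_integrable_itv lh); lra.
have ic : mu.-integrable `]x - r, x + r[ (EFin \o cst (h x)).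
  apply: (@integrableS _ _ _ mu `[x - r, x + r]) => //; first exact: subset_itv_oo_cc.
  apply: continuous_compact_integrable; first exact: segment_compact.
  by apply: continuous_subspaceT => ?; exact: cvg_cst.
have ihc : mu.-integrable `]x - r, x + r[ (EFin \o (fun y => h y - h x)).
  exact: (integrableB _ ih ic).
have mur : mu `]x - r, x + r[ = (2 * r)%:E.
  rewrite lebesgue_measure_itv /= lte_fin ifT; last by lra.
  by rewrite -EFinD; congr EFin; ring.
have h2 : \int[mu]_(y in `]x - r, x + r[) `|h y - h x| < (h x - C) * (2 * r).
  have := hdel r r0; rewrite (_ : r < del); last by lra.
  move=> /(_ isT); rewrite /davg /iavg ball_itv mur inver ifF; last first.
    by apply/negbTE; rewrite mulf_neq0// gt_eqF.
  have fin := integrable_fin_num _ (integrable_norm ihc).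
  rewrite -[X in (_ * X)%E]fineK; last by apply: fin.
  rewrite -EFinM lte_fin mulrC ltr_pdivrMr//; lra.
have h3 : `| \int[mu]_(y in `]x - r, x + r[) (h y - h x)| <= \int[mu]_(y in `]x - r, x + r[) `|h y - h x|.
  exact: le_normr_Rintegral.
move: h3; rewrite RintegralB//.
have -> : \int[mu]_(y in `]x - r, x + r[) (cst (h x)) y = h x * (2 * r).
  by rewrite Rintegral_cst//= [mu _]mur.
rewrite ler_norml => /andP[h4 _].
have arith (I1 I2 c q y z : R) : I1 <= c * (y + z - (y - z)) ->
    I2 < (q - c) * (2 * z) -> - I2 <= I1 - q * (2 * z) -> False by clear; lra.
exact: arith h1 h2 h4.
Qed.

Lemma weak_derivative_unique a b g h1 h2 :
  weak_derivative a b g h1 -> weak_derivative a b g h2 ->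
  {ae mu, forall x, a < x < b -> h1 x = h2 x}.
Proof.
move=> w1 w2; have [_ l1 _] := w1; have [_ l2 _] := w2.
have I s t : a < s -> s < t -> t < b -> mu.-integrable `]s, t[ (EFin \o h1) /\
    mu.-integrable `]s, t[ (EFin \o h2).
  move=> ? ? ?.
  split; apply: (@integrableS _ _ _ mu `[s, t]) => //; try exact: subset_itv_oo_cc.
  - exact: (locally_integrable_itv l1).
  - exact: (locally_integrable_itv l2).
have H1 := ae_lebesgue_pt (locally_integrableB l1 l2).
have H2 := ae_lebesgue_pt (locally_integrableB l2 l1).
apply: (ae_imp2 H1 H2) => x p1 p2 xab; apply/eqP; rewrite eq_le; apply/andP; split; rewrite -subr_le0.
- apply: (lebesgue_pt_le (locally_integrableB l1 l2) xab _ (p1 xab)) => s t as_ st tb.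
  have [i1 i2] := I s t as_ st tb.
  by rewrite RintegralB// (weak_derivative_Rintegral_unique w1 w2)// subrr mul0r.
- apply: (lebesgue_pt_le (locally_integrableB l2 l1) xab _ (p2 xab)) => s t as_ st tb.
  have [i1 i2] := I s t as_ st tb.
  by rewrite RintegralB// (weak_derivative_Rintegral_unique w1 w2)// subrr mul0r.
Qed.

Lemma eq_weak_derivative a b g g' h h' : weak_derivative a b g h ->
  measurable_fun (`]a, b[ : set R) g' -> measurable_fun (`]a, b[ : set R) h' ->
  {ae mu, forall x, a < x < b -> g x = g' x} ->
  {ae mu, forall x, a < x < b -> h x = h' x} ->
  weak_derivative a b g' h'.
Proof.
move=> [lg lh gh] mg' mh' gg' hh'.
have L f f' : locally_integrable `]a, b[ f -> measurable_fun (`]a, b[ : set R) f' ->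
    {ae mu, forall x, a < x < b -> f x = f' x} -> locally_integrable `]a, b[ f'.
  move=> [mf of_ lf] mf' ff'; split => // K Kab cK.
  have mK : measurable K by exact: compact_measurable.
  suff -> : (\int[mu]_(x in K) `|f' x|%:E = \int[mu]_(x in K) `|f x|%:E)%E by exact: lf.
  apply: ae_eq_integral => //.
  - by apply/measurable_EFinP/measurableT_comp => //; exact: measurable_funS mf'.
  - by apply/measurable_EFinP/measurableT_comp => //; exact: measurable_funS mf.
  - apply: (ae_imp ff') => x hx Kx; rewrite hx//.
    by have := Kab _ Kx; rewrite /= in_itv.
split; [exact: L lg _ _|exact: L lh _ _|].
move=> phi tphi; have := gh phi tphi.
have [sm _] := tphi.
have mp (D : set R) : measurable_fun D phi.
  apply: measurable_funTS; apply: continuous_measurable_fun => x.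
  by apply/differentiable_continuous/derivable1_diffP; have := sm 0%N x; rewrite derive1n0.
have mdp (D : set R) : measurable_fun D (derive1 phi).
  apply: measurable_funTS; apply: continuous_measurable_fun => x.
  by apply/differentiable_continuous/derivable1_diffP; have := sm 1%N x; rewrite derive1n1.
have [mg _ _] := lg; have [mh _ _] := lh.
have -> : \int[mu]_(x in `]a, b[) (g x * derive1 phi x) =
    \int[mu]_(x in `]a, b[) (g' x * derive1 phi x).
  apply: ae_eq_Rintegral => //; [exact: measurable_funM|exact: measurable_funM|].
  by apply: (ae_imp gg') => x hx; rewrite /= in_itv/= => xab; rewrite hx.
have -> : \int[mu]_(x in `]a, b[) (h x * phi x) =
    \int[mu]_(x in `]a, b[) (h' x * phi x).
  apply: ae_eq_Rintegral => //; [exact: measurable_funM|exact: measurable_funM|].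
  by apply: (ae_imp hh') => x hx; rewrite /= in_itv/= => xab; rewrite hx.
by [].
Qed.

End lebesgue_points.

(** * The spaces H and V *)

Section weighted_space.
Context {R : realType}.
Local Notation mu := (@lebesgue_measure R).
Local Notation I01 := (`]0%R, 1%R[%classic : set R).
Implicit Types (c s t x y : R) (u v g h w : R -> R).

Lemma inH_measurable u : inH u -> measurable_fun I01 u.
Proof. by case. Qed.

Lemma measurable_weight u v n : measurable_fun I01 u -> measurable_fun I01 v ->
  measurable_fun I01 (fun x => x ^+ n * u x * v x).
Proof.
by move=> mu_ mv; apply: measurable_funM => //; apply: measurable_funM => //;
  exact: measurable_funX.
Qed.

Lemma inH_sq_integrable u : inH u ->
  mu.-integrable I01 (EFin \o (fun x => x ^+ 2 * u x ^+ 2)).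
Proof.
move=> [mu_ fu]; apply/integrableP; split.
  apply/measurable_EFinP; apply: measurable_funM; exact: measurable_funX.
apply: le_lt_trans fu; apply: ge0_le_integral => //=.
- apply/measurable_EFinP/measurableT_comp => //.
  by apply: measurable_funM; exact: measurable_funX.
- by apply/measurable_EFinP; apply: measurable_funM; exact: measurable_funX.
- by move=> x _; rewrite ger0_norm// mulr_ge0// sqr_ge0.
Qed.

Lemma integrable_inH u (g : R -> R) : measurable_fun I01 u ->
  mu.-integrable I01 (EFin \o g) ->
  (forall x, 0 < x < 1 -> x ^+ 2 * u x ^+ 2 <= g x) -> inH u.
Proof.
move=> mu_ ig ug.
have : mu.-integrable I01 (EFin \o (fun x => x ^+ 2 * u x ^+ 2)).
  apply: le_integrable_R ig => //; first by apply: measurable_funM; exact: measurable_funX.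
  by move=> x; rewrite /= in_itv/= => xI; rewrite ger0_norm ?ug// mulr_ge0// sqr_ge0.
by move=> i; split => //; exact: (integrable_lty _ i).
Qed.

Lemma inH_le u v : measurable_fun I01 u -> inH v ->
  (forall x, 0 < x < 1 -> u x ^+ 2 <= v x ^+ 2) -> inH u.
Proof.
move=> mu_ hv uv; apply: (integrable_inH mu_ (inH_sq_integrable hv)) => x xI.
by rewrite ler_wpM2l ?sqr_ge0// uv.
Qed.

Lemma inH_ip_integrable u v : inH u -> inH v ->
  mu.-integrable I01 (EFin \o (fun x => x ^+ 2 * u x * v x)).
Proof.
move=> hu hv.
have iD : mu.-integrable I01 (EFin \o (fun x => x ^+ 2 * u x ^+ 2 + x ^+ 2 * v x ^+ 2)).
  exact: (integrableD _ (inH_sq_integrable hu) (inH_sq_integrable hv)).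
apply: le_integrable_R iD => //; first by apply: measurable_weight; apply: inH_measurable.
move=> x _ /=; rewrite -mulrDr -mulrA normrM ger0_norm ?sqr_ge0// ler_wpM2l ?sqr_ge0//.
rewrite ler_norml; have := sqr_ge0 (u x + v x); have := sqr_ge0 (u x - v x).
have := sqr_ge0 (u x); have := sqr_ge0 (v x).
rewrite !expr2 => *; apply/andP; split; nra.
Qed.

Lemma inHD u v : inH u -> inH v -> inH (u \+ v).
Proof.
move=> hu hv; have [mu_ _] := hu; have [mv _] := hv.
have iu := inH_sq_integrable hu; have iv := inH_sq_integrable hv.
have iD : mu.-integrable I01 (EFin \o (fun x => 2 * (x ^+ 2 * u x ^+ 2 + x ^+ 2 * v x ^+ 2))).
  exact: (integrableZl _ 2 (integrableD _ iu iv)).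
apply: integrable_inH iD _; first exact: measurable_funD.
move=> x _; rewrite -mulrDr (mulrCA 2) ler_wpM2l ?sqr_ge0//=.
by have := sqr_ge0 (u x - v x); rewrite !expr2; nra.
Qed.

Lemma inHZ (k : R) u : inH u -> inH (fun x => k * u x).
Proof.
move=> hu; have [mu_ _] := hu.
have iD : mu.-integrable I01 (EFin \o (fun x => k ^+ 2 * (x ^+ 2 * u x ^+ 2))).
  exact: (integrableZl _ (k ^+ 2) (inH_sq_integrable hu)).
apply: integrable_inH iD _; first exact: measurable_funM.
by move=> x _; rewrite exprMn (mulrCA (x ^+ 2)).
Qed.

Lemma ip_ge0 u : 0 <= ip u u.
Proof. by apply: Rintegral_ge0 => x _; rewrite -mulrA -expr2 mulr_ge0// sqr_ge0. Qed.

Lemma ipC u v : ip u v = ip v u.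
Proof. by apply: eq_Rintegral => x _; ring. Qed.

Lemma ipDl u v h : inH u -> inH v -> inH h -> ip (u \+ v) h = ip u h + ip v h.
Proof.
move=> hu hv hh; rewrite -RintegralD//; try exact: inH_ip_integrable.
by apply: eq_Rintegral => x _ /=; ring.
Qed.

Lemma ipZl k u h : inH u -> inH h -> ip (fun x => k * u x) h = k * ip u h.
Proof.
move=> hu hh; rewrite -RintegralZl//; try exact: inH_ip_integrable.
by apply: eq_Rintegral => x _ /=; ring.
Qed.

Lemma ae_eq_ip u u' v v' : measurable_fun I01 u -> measurable_fun I01 u' ->
  measurable_fun I01 v -> measurable_fun I01 v' ->
  {ae mu, forall x, 0 < x < 1 -> u x = u' x} ->
  {ae mu, forall x, 0 < x < 1 -> v x = v' x} -> ip u v = ip u' v'.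
Proof.
move=> m1 m2 m3 m4 uu' vv'; apply: ae_eq_Rintegral => //; try exact: measurable_weight.
by apply: (ae_imp2 uu' vv') => x e1 e2; rewrite /= in_itv/= => xI; rewrite e1// e2.
Qed.

(** On ]c, 1[ the weight is at least c^2, so H controls the unweighted L^2 norm there: away from 0,
    V behaves like a one-dimensional Sobolev space. *)
Lemma inH_sq_integrable_itv c v : 0 < c -> c < 1 -> inH v ->
  mu.-integrable `]c, 1[ (EFin \o (fun x => v x ^+ 2)) /\
  \int[mu]_(x in `]c, 1[) (v x ^+ 2) <= c^-1 ^+ 2 * ip v v.
Proof.
move=> c0 c1 hv; have [mv _] := hv.
have sub : `]c, 1[ `<=` I01.
  by move=> x /=; rewrite !in_itv/= => /andP[? ?]; apply/andP; split => //; lra.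
have i1 : mu.-integrable I01 (EFin \o (fun x => c^-1 ^+ 2 * (x ^+ 2 * v x ^+ 2))).
  exact: (integrableZl _ _ (inH_sq_integrable hv)).
have i2 : mu.-integrable `]c, 1[ (EFin \o (fun x => c^-1 ^+ 2 * (x ^+ 2 * v x ^+ 2))).
  by apply: (@integrableS _ _ _ mu I01).
have le x : c < x -> v x ^+ 2 <= c^-1 ^+ 2 * (x ^+ 2 * v x ^+ 2).
  move=> cx; rewrite mulrA -exprMn ler_peMl ?sqr_ge0//.
  by rewrite exprn_ege1// mulrC ler_pdivlMr// mul1r ltW.
have i3 : mu.-integrable `]c, 1[ (EFin \o (fun x => v x ^+ 2)).
  apply: le_integrable_R i2 => //.
    by apply: measurable_funX; exact: measurable_funS mv.
  by move=> x; rewrite /= in_itv/= => /andP[cx _]; rewrite ger0_norm ?sqr_ge0// le.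
split => //.
apply: (@le_trans _ _ (\int[mu]_(x in `]c, 1[) (c^-1 ^+ 2 * (x ^+ 2 * v x ^+ 2)))).
  by apply: le_Rintegral => // x; rewrite /= in_itv/= => /andP[cx _]; rewrite le.
apply: (@le_trans _ _ (\int[mu]_(x in I01) (c^-1 ^+ 2 * (x ^+ 2 * v x ^+ 2)))).
  apply: fine_le; [exact: integrable_fin_num _ i2|exact: integrable_fin_num _ i1|].
  apply: ge0_subset_integral => //; first by case/integrableP : i1.
  move=> x _; rewrite lee_fin; apply: mulr_ge0; first exact: sqr_ge0.
  by apply: mulr_ge0; exact: sqr_ge0.
rewrite RintegralZl//; last exact: inH_sq_integrable.
rewrite ler_wpM2l ?sqr_ge0// le_eqVlt; apply/orP; left; apply/eqP.
by apply: eq_Rintegral => x _; ring.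
Qed.

Lemma inH_integrable_itv c v : 0 < c -> c < 1 -> inH v ->
  mu.-integrable `]c, 1[ (EFin \o v).
Proof.
move=> c0 c1 hv; have [mv _] := hv.
have [i1 _] := inH_sq_integrable_itv c0 c1 hv.
have i2 : mu.-integrable `]c, 1[ (EFin \o cst (1:R)).
  apply: (@integrableS _ _ _ mu `[c, 1]) => //; first exact: subset_itv_oo_cc.
  apply: continuous_compact_integrable; first exact: segment_compact.
  by apply: continuous_subspaceT => ?; exact: cvg_cst.
have iD : mu.-integrable `]c, 1[ (EFin \o (fun x => 1 + v x ^+ 2)).
  exact: (integrableD _ i2 i1).
apply: le_integrable_R iD => //.
  apply: measurable_funS mv => // x /=; rewrite !in_itv/= => /andP[? ?].
  by apply/andP; split => //; lra.
move=> x _ /=; rewrite ler_norml.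
have := sqr_ge0 (v x - 1); have := sqr_ge0 (v x + 1); have := sqr_ge0 (v x).
by rewrite !expr2 => *; apply/andP; split; nra.
Qed.

End weighted_space.

(** * Continuous representatives and the trace at 1 *)

Section weighted_sobolev_space.
Context {R : realType}.
Local Notation mu := (@lebesgue_measure R).
Local Notation I01 := (`]0%R, 1%R[%classic : set R).
Implicit Types (c s t x y : R) (u v g h w W : R -> R).

Lemma Rintegral_itv_split (f : R -> R) (a x b : R) : a <= x <= b ->
  mu.-integrable `]a, b[ (EFin \o f) ->
  \int[mu]_(y in `]a, b[) f y = \int[mu]_(y in `]a, x[) f y + \int[mu]_(y in `]x, b[) f y.
Proof.
move=> /andP[ax]; rewrite le_eqVlt => /predU1P[->|xb] fi.
  by rewrite (_ : `]b, b[%classic = set0) ?Rintegral_set0 ?addr0// set_itvoo0.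
have fi' : mu.-integrable `]a, x[ (EFin \o f).
  apply: (@integrableS _ _ _ mu `]a, b[) => //.
  by move=> y /=; rewrite !in_itv/= => /andP[-> /lt_trans]; apply.
have := @Rintegral_itvB R f (BRight a) (BLeft b) x fi.
rewrite !bnd_simp ax xb => /(_ isT isT) <-.
by rewrite (Rintegral_itv_bndo_bndc fi') addrCA subrr addr0.
Qed.

Lemma Rintegral_cst_oo (k a b : R) : a <= b -> \int[mu]_(_ in `]a, b[) k = k * (b - a).
Proof.
rewrite le_eqVlt => /predU1P[->|ab].
  by rewrite set_itvoo0 ?Rintegral_set0 ?subrr ?mulr0.
have mI : mu `]a, b[ = (b - a)%:E by rewrite lebesgue_measure_itv/= lte_fin ab.
by rewrite Rintegral_cst//= [mu _]mI.
Qed.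

Lemma integrable_cst_oo (k a b : R) : mu.-integrable `]a, b[ (EFin \o cst k).
Proof.
apply: (@integrableS _ _ _ mu `[a, b]) => //; first exact: subset_itv_oo_cc.
apply: continuous_compact_integrable; first exact: segment_compact.
by apply: continuous_subspaceT => ?; exact: cvg_cst.
Qed.

Lemma ae_itv_exists (P : R -> Prop) (a b : R) : a < b -> {ae mu, forall x, P x} ->
  exists2 x, a < x < b & P x.
Proof.
move=> ab [N [mN N0 PN]]; apply: contrapT => nP.
have sub : `]a, b[ `<=` N.
  move=> x /=; rewrite in_itv/= => xab; apply: PN => /= Px; apply: nP.
  by exists x.
have : (mu `]a, b[ <= mu N)%E by apply: le_measure => //; rewrite inE.
rewrite [mu N]N0 lebesgue_measure_itv/= lte_fin ab -EFinD lee_fin.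
by rewrite subr_le0 leNgt ab.
Qed.

(** The two functions agree at points arbitrarily close to 1, hence at 1. This makes the choice in
    [trace1] harmless. *)
Lemma ae_eq_at1 w W : {within `]0, 1], continuous w} -> {within `]0, 1], continuous W} ->
  {ae mu, forall x, 0 < x < 1 -> w x = W x} -> w 1 = W 1.
Proof.
move=> /subspace_continuousP cw /subspace_continuousP cW wW.
apply/eqP; rewrite eq_le !leNgt -negb_or; apply/negP => ne.
have d0 : 0 < `|w 1 - W 1| / 2.
  by rewrite divr_gt0// normr_gt0 subr_eq0; case/orP : ne => /lt_eqF; [move=> /negbT; rewrite eq_sym|move=> /negbT].
have m1 : (`]0, 1]%classic : set R) 1 by rewrite /= in_itv/= ltr01 lexx.
have := cw _ m1 => /cvgrPdist_lt /(_ _ d0); have := cW _ m1 => /cvgrPdist_lt /(_ _ d0).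
rewrite !near_withinE => /nbhs_ballP[e1 /= e10 h1] /nbhs_ballP[e2 /= e20 h2].
pose e := Num.min (Num.min e1 e2) 1.
have e0 : 0 < e by rewrite !lt_min e10 e20 ltr01.
have le1 : e <= e1 by rewrite !ge_min lexx.
have le2 : e <= e2 by rewrite !ge_min lexx orbT.
have le3 : e <= 1 by rewrite !ge_min lexx !orbT.
have [x /andP[x1 x2] wx] := @ae_itv_exists _ (1 - e) 1 ltac:(lra) wW.
have I : (`]0, 1]%classic : set R) x by rewrite /= in_itv/=; apply/andP; split; lra.
have b1 : ball (1:R) e1 x by rewrite /ball/= ger0_norm; lra.
have b2 : ball (1:R) e2 x by rewrite /ball/= ger0_norm; lra.
have A : `|W 1 - W x| < `|w 1 - W 1| / 2 := h1 x b1 I.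
have : `|w 1 - w x| < `|w 1 - W 1| / 2 := h2 x b2 I.
rewrite wx => [B|]; last by apply/andP; split; lra.
have : `|w 1 - W 1| <= `|w 1 - W x| + `|W 1 - W x|.
  by rewrite (distrC (W 1)); apply: le_trans (ler_normD _ _); rewrite addrA subrK.
lra.
Qed.

Lemma trace1E v W : {within `]0, 1], continuous W} ->
  {ae mu, forall x, 0 < x < 1 -> v x = W x} -> trace1 v = W 1.
Proof.
move=> cW vW; rewrite /trace1.
case: xgetP => [c -> [w [cw vw <-]]|/(_ (W 1)) []]; last by exists W.
apply: ae_eq_at1 => //; apply: (ae_imp2 vW vw) => x h1 h2 xI.
by rewrite -h1// h2.
Qed.

Lemma wderiv_weak v : inV v -> weak_derivative 0 1 v (wderiv v).
Proof.
move=> [_ [g vg _]]; rewrite /wderiv.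
by case: xgetP => [h -> //|/(_ g)].
Qed.

Lemma wderiv_eq v g : weak_derivative 0 1 v g ->
  {ae mu, forall x, 0 < x < 1 -> wderiv v x = g x}.
Proof.
move=> vg; apply: (weak_derivative_unique _ vg).
by rewrite /wderiv; case: xgetP => [h -> //|/(_ g)].
Qed.

Lemma weak_derivative_measurable v g : weak_derivative 0 1 v g ->
  measurable_fun I01 v /\ measurable_fun I01 g.
Proof. by move=> [[? _ _] [? _ _] _]. Qed.

Lemma inH_ae_eq u v : measurable_fun I01 u -> inH v ->
  {ae mu, forall x, 0 < x < 1 -> u x = v x} -> inH u.
Proof.
move=> mu_ hv uv; split => //; have [mv fv] := hv.
suff -> : (\int[mu]_(x in I01) (x ^+ 2 * u x ^+ 2)%:E =
  \int[mu]_(x in I01) (x ^+ 2 * v x ^+ 2)%:E)%E by [].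
apply: ae_eq_integral => //.
- by apply/measurable_EFinP; apply: measurable_funM; exact: measurable_funX.
- by apply/measurable_EFinP; apply: measurable_funM; exact: measurable_funX.
- by apply: (ae_imp uv) => x h; rewrite /= in_itv/= => xI; rewrite h.
Qed.

Lemma inH_wderiv v : inV v -> inH (wderiv v).
Proof.
move=> vV; have [_ [g vg gH]] := vV.
apply: inH_ae_eq gH (wderiv_eq vg).
by have [] := weak_derivative_measurable (wderiv_weak vV).
Qed.

(** Integrates |g| <= d g^2 + 1 / d, a substitute for the Cauchy-Schwarz inequality in which [d] is
    left to be chosen: small for continuity, the inverse of the integral for the trace. *)
Lemma integral_norm_modulus c x y g (d : R) : 0 < c -> c <= x -> x <= y -> y <= 1 -> c < 1 ->
  inH g -> 0 < d ->
  `| \int[mu]_(z in `]x, y[) g z | <= d * (c^-1 ^+ 2 * ip g g) + (y - x) / d.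
Proof.
move=> c0 cx; rewrite le_eqVlt => /predU1P[->|xy] y1 c1 hg d0.
  rewrite (_ : `]y, y[%classic = set0) ?Rintegral_set0 ?normr0 ?set_itvoo0//.
  rewrite subrr mul0r addr0; apply: mulr_ge0; first exact: ltW.
  by apply: mulr_ge0; [exact: sqr_ge0|exact: ip_ge0].
have sub : `]x, y[ `<=` `]c, 1[.
  by move=> z /=; rewrite !in_itv/= => /andP[? ?]; apply/andP; split; lra.
have i0 := inH_integrable_itv c0 c1 hg.
have [j0 hj0] := inH_sq_integrable_itv c0 c1 hg.
have i1 : mu.-integrable `]x, y[ (EFin \o g) by apply: (@integrableS _ _ _ mu `]c, 1[).
have j1 : mu.-integrable `]x, y[ (EFin \o (fun z => g z ^+ 2)).
  by apply: (@integrableS _ _ _ mu `]c, 1[).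
have k1 := integrable_cst_oo d^-1 x y.
have j2 : mu.-integrable `]x, y[ (EFin \o (fun z => d * g z ^+ 2)).
  exact: (integrableZl _ d j1).
apply: le_trans (le_normr_Rintegral _ i1) _ => //.
apply: (@le_trans _ _ (\int[mu]_(z in `]x, y[) (d * g z ^+ 2 + d^-1))).
  apply: le_Rintegral => //; [exact: integrable_norm|exact: (integrableD _ j2 k1)|].
  move=> z _; have dV : d * d^-1 = 1 by rewrite divff// gt_eqF.
  have dp : 0 < d^-1 by rewrite invr_gt0.
  have sq1 : 0 <= d * (g z - d^-1) ^+ 2 by rewrite mulr_ge0 ?sqr_ge0// ltW.
  have sq2 : 0 <= d * (g z + d^-1) ^+ 2 by rewrite mulr_ge0 ?sqr_ge0// ltW.
  have sq3 : 0 <= d * g z ^+ 2 by rewrite mulr_ge0 ?sqr_ge0// ltW.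
  have e1 : d * (g z - d^-1) ^+ 2 = d * g z ^+ 2 - 2 * (d * d^-1) * g z + (d * d^-1) * d^-1 by ring.
  have e2 : d * (g z + d^-1) ^+ 2 = d * g z ^+ 2 + 2 * (d * d^-1) * g z + (d * d^-1) * d^-1 by ring.
  rewrite e1 dV in sq1; rewrite e2 dV in sq2.
  by rewrite ler_norml; apply/andP; split; lra.
rewrite RintegralD// RintegralZl//; apply: lerD.
  rewrite ler_wpM2l// ?(ltW d0)//; apply: le_trans hj0.
  apply: fine_le; [exact: integrable_fin_num _ j1|exact: integrable_fin_num _ j0|].
  apply: ge0_subset_integral => //; first by case/integrableP : j0.
  by move=> z _; rewrite lee_fin sqr_ge0.
by rewrite Rintegral_cst_oo 1?mulrC// ltW.
Qed.

(** [W] is the primitive of the weak derivative normalised at one Lebesgue point [s0] of [v]; by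
    [weak_derivative_FTC] it agrees with [v] at every Lebesgue point. *)
Lemma inV_rep v : inV v -> exists W, [/\ {within `]0, 1], continuous W},
  {ae mu, forall x, 0 < x < 1 -> v x = W x}, trace1 v = W 1 &
  forall x y, 0 < x -> x <= y -> y <= 1 ->
    W y - W x = \int[mu]_(z in `]x, y[) wderiv v z].
Proof.
move=> vV; have vg := wderiv_weak vV; have gH := inH_wderiv vV.
set g := wderiv v in vg gH *.
have [lv _ _] := vg.
have pt := ae_lebesgue_pt lv.
have [s0 /andP[s00 s01] ls0] := @ae_itv_exists _ 0 1 ltr01 pt.
pose W x := v s0 + \int[mu]_(z in `]s0, 1[) g z - \int[mu]_(z in `]x, 1[) g z.
have Wd x y : 0 < x -> x <= y -> y <= 1 -> W y - W x = \int[mu]_(z in `]x, y[) g z.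
  move=> x0 xy; rewrite le_eqVlt => /predU1P[->|y1].
    by rewrite /W (_ : `]1, 1[%classic = set0) ?set_itvoo0// Rintegral_set0; ring.
  have h := @Rintegral_itv_split g x y 1.
  rewrite /W h; [by ring|by rewrite xy ltW|].
  by apply: inH_integrable_itv => //; exact: le_lt_trans xy y1.
have cW : {within `]0, 1], continuous W}.
  apply/subspace_continuousP => x /=; rewrite in_itv/= => /andP[x0 x1].
  apply/cvgrPdist_lt => e e0; rewrite near_withinE.
  pose c := x / 2; have c0 : 0 < c by rewrite /c; lra.
  pose G := c^-1 ^+ 2 * ip g g.
  have G0 : 0 <= G by apply: mulr_ge0; [exact: sqr_ge0|exact: ip_ge0].
  (* The first term of [integral_norm_modulus] is then below e / 2 whatever the interval, and the
     second one is below e / 2 once the length is less than d e / 2. *)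
  pose d := e / (2 * (G + 1)).
  have d0 : 0 < d by apply: divr_gt0 => //; lra.
  have dG : d * G < e / 2.
    by rewrite /d -mulrA ltr_pM2l// mulrC ltr_pdivrMr; lra.
  have mod (y z : R) : c <= y -> y <= z -> z <= 1 -> z - y < d * (e / 2) -> `|W z - W y| < e.
    move=> cy yz z1 zy; rewrite Wd//; last exact: lt_le_trans cy.
    apply: le_lt_trans (integral_norm_modulus c0 cy yz z1 _ gH d0) _; first by rewrite /c; lra.
    have : (z - y) / d < e / 2 by rewrite ltr_pdivrMr// mulrC.
    rewrite -/G; lra.
  apply/nbhs_ballP; exists (Num.min c (d * (e / 2))) => /=.
    by rewrite lt_min c0 mulr_gt0//; lra.
  move=> y; rewrite /ball/= lt_min => /andP[xyc xyd]; rewrite in_itv/= => /andP[y0 y1].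
  suff : `|W x - W y| < e by [].
  have /andP[a1 a2] : - c < x - y < c by rewrite -ltr_norml.
  have /andP[a3 a4] : - (d * (e / 2)) < x - y < d * (e / 2) by rewrite -ltr_norml.
  have [xy|yx] := leP x y.
    by rewrite distrC; apply: mod => //; rewrite /c in a1 a2 *; lra.
  by apply: mod => //; rewrite /c in a1 a2 *; lra.
have vW : {ae mu, forall x, 0 < x < 1 -> v x = W x}.
  apply: (ae_imp pt) => x hx xI; have lx := hx xI.
  have s0I : 0 < s0 < 1 by rewrite s00.
  have ls := ls0 s0I; have /andP[x0 x1] := xI.
  have W0 : W s0 = v s0 by rewrite /W addrK.
  have [xs|sx|->//] := ltgtP x s0.
    have := weak_derivative_FTC vg x0 xs s01 lx ls.
    by rewrite -Wd// ?W0; [lra|exact: ltW|exact: ltW].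
  have := weak_derivative_FTC vg s00 sx x1 ls lx.
  by rewrite -Wd// ?W0; [lra|exact: ltW|exact: ltW].
by exists W; split => //; exact: trace1E.
Qed.

(** The square of [norm1]. Estimates are written with it to avoid square roots, at the price of a
    factor 2 in each use of the triangle inequality. *)
Definition sqn1 v : R := ip v v + ip (wderiv v) (wderiv v).

Lemma sqn1_ge0 v : 0 <= sqn1 v.
Proof. by rewrite addr_ge0// ip_ge0. Qed.

(** W(1)^2 <= 2 W(x)^2 + 2 (W(1) - W(x))^2 is averaged over x in ]1/2, 1[, where the weight is at
    least 1/4 and the increment is controlled by the derivative. *)
Lemma trace1_bound v : inV v -> trace1 v ^+ 2 <= 16 * sqn1 v.
Proof.
move=> vV; have [vH _] := vV; have gH := inH_wderiv vV.
have [W [cW vW -> Wd]] := inV_rep vV.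
have c0 : 0 < 2^-1 :> R by lra. have c1 : 2^-1 < 1 :> R by lra.
have [iv lv] := inH_sq_integrable_itv c0 c1 vH.
pose G := ip (wderiv v) (wderiv v).
have G0 : 0 <= G := ip_ge0 _.
have bd x : 2^-1 < x -> x < 1 -> (W 1 - W x) ^+ 2 <= 8 * G.
  move=> x2 x1; rewrite Wd ?lexx//; [|lra|exact: ltW].
  have h d := @integral_norm_modulus 2^-1 x 1 (wderiv v) d c0 (ltW x2) (ltW x1) (lexx 1) c1 gH.
  set J := \int[mu]_(z in `]x, 1[) wderiv v z in h *.
  rewrite -/G (_ : (2^-1)^-1 ^+ 2 = 4 :> R) in h; last by rewrite invrK; ring.
  have [->|J0] := eqVneq J 0; first by rewrite expr0n mulr_ge0.
  have Jp : 0 < `|J| by rewrite normr_gt0.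
  (* With d = 1 / |J| the second term of the modulus is (1 - x) |J| <= |J| / 2 and is absorbed by
     the left-hand side. *)
  have d0 : 0 < `|J|^-1 by rewrite invr_gt0.
  have := h _ d0; rewrite invrK => h'.
  have h2 : `|J| <= 2 * (`|J|^-1 * (4 * G)).
    have : (1 - x) * `|J| <= 2^-1 * `|J| by rewrite ler_wpM2r//; lra.
    lra.
  have := ler_wpM2l (ltW Jp) h2.
  have -> : `|J| * (2 * (`|J|^-1 * (4 * G))) = (`|J| * `|J|^-1) * (8 * G) by ring.
  by rewrite divff ?gt_eqF// mul1r -expr2 real_normK// num_real.
have sub : `]2^-1, 1[ `<=` I01.
  by move=> z /=; rewrite !in_itv/= => /andP[? ?]; apply/andP; split; lra.
have ic k := integrable_cst_oo k 2^-1 1.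
have i2 : mu.-integrable `]2^-1, 1[ (EFin \o (fun x => 2 * v x ^+ 2)).
  exact: (integrableZl _ 2 iv).
have : \int[mu]_(x in `]2^-1, 1[) (W 1 ^+ 2) <=
    \int[mu]_(x in `]2^-1, 1[) (2 * v x ^+ 2 + 16 * G).
  apply: ae_le_Rintegral => //; [exact: ic|exact: (integrableD _ i2 (ic (16 * G)))|].
  apply: (ae_imp vW) => x hx; rewrite /= in_itv/= => /andP[x2 x1].
  rewrite hx; last by apply/andP; split => //; lra.
  have := bd x x2 x1; have := sqr_ge0 (W 1 - 2 * W x); rewrite !expr2; nra.
rewrite RintegralD//; last exact: ic.
rewrite !Rintegral_cst_oo ?(ltW c1)// RintegralZl// /sqn1 -/G.
rewrite (_ : (2^-1)^-1 ^+ 2 = 4 :> R) in lv; last by rewrite invrK; ring.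
lra.
Qed.

End weighted_sobolev_space.

(** * Chain rule in V *)

Section calculus_tools.
Context {R : realType}.
Local Notation mu := (@lebesgue_measure R).
Local Notation I01 := (`]0%R, 1%R[%classic : set R).
Implicit Types (c s t x y : R) (u v g h w W : R -> R).

(** The interval given by [test_function] may be degenerate or empty when phi = 0. Moving its ends
    towards [a] and [b] yields a genuine interval containing the support in its interior, so that
    the derivative vanishes outside as well. *)
Lemma test_function_support (a b : R) (phi : R -> R) : a < b -> test_function a b phi ->
  exists c d, [/\ a < c, c < d, d < b, forall x, ~~ (c < x < d) -> phi x = 0 &
    forall x, ~~ (c < x < d) -> derive1 phi x = 0].
Proof.
move=> ab [_ [c [d [c0 d1 h]]]].
have h0 x : ~~ (c <= x <= d) -> phi x = 0.
  by move=> nx; apply/eqP/negPn/negP => /h; exact/negP.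
pose mid := (a + b) / 2; have [mida midb] : a < mid /\ mid < b by rewrite /mid; split; lra.
pose c1 := (a + Num.min c mid) / 2; pose d1' := (Num.max d mid + b) / 2.
have m1 : Num.min c mid <= c by rewrite ge_min lexx.
have m2 : Num.min c mid <= mid by rewrite ge_min lexx orbT.
have m3 : a < Num.min c mid by rewrite lt_min c0.
have m4 : d <= Num.max d mid by rewrite le_max lexx.
have m5 : mid <= Num.max d mid by rewrite le_max lexx orbT.
have m6 : Num.max d mid < b by rewrite gt_max d1.
have out x : ~~ (c1 < x < d1') -> x < c \/ d < x.
  by rewrite negb_and -!leNgt /c1 /d1' => /orP[]; [left|right]; lra.
exists c1, d1'; split; rewrite /c1 /d1'; try lra.
  move=> x /out xo; apply: h0; rewrite negb_and -!ltNge.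
  by case: xo => ->; rewrite ?orbT.
move=> x /out xo.
rewrite derive1E (@near_eq_derive _ R R phi (cst 0)) ?derive_cst//.
case: xo => xo.
  near=> y; apply: h0; rewrite negb_and -!ltNge; apply/orP; left.
  by near: y; exact: lt_nbhsl.
near=> y; apply: h0; rewrite negb_and -!ltNge; apply/orP; right.
by near: y; exact: lt_nbhsr.
Unshelve. all: by end_near. Qed.

Lemma bounded_derive_lipschitz (phi phi' : R -> R) (L : R) :
  (forall x, is_derive x 1 phi (phi' x)) -> (forall x, `|phi' x| <= L) ->
  forall x y, `|phi x - phi y| <= L * `|x - y|.
Proof.
move=> dphi hL.
have cphi x : {for x, continuous phi}.
  by apply/differentiable_continuous/derivable1_diffP; have [] := dphi x.
suff H x y : x <= y -> `|phi x - phi y| <= L * `|x - y|.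
  move=> x y; have [xy|/ltW yx] := leP x y; first exact: H.
  by rewrite distrC (distrC x); exact: H.
rewrite le_eqVlt => /predU1P[->|xy]; first by rewrite !subrr normr0 mulr0.
have [z _] := @MVT R phi phi' x y xy (fun z _ => dphi z) (continuous_subspaceT cphi).
by rewrite -normrN opprB => ->; rewrite normrM (distrC y) ler_wpM2r.
Qed.

Lemma locally_integrable_mul_bounded (a b : R) g h (L : R) :
  locally_integrable `]a, b[ g -> measurable_fun (`]a, b[%classic : set R) h ->
  (forall x, `|h x| <= L) -> locally_integrable `]a, b[ (fun x => h x * g x).
Proof.
move=> [mg og lg] mh hL; split => //; first exact: measurable_funM.
move=> K Kab cK; have mK := compact_measurable cK.
have ig : mu.-integrable K (EFin \o g).
  apply/integrableP; split; last exact: lg.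
  by apply/measurable_EFinP; exact: measurable_funS mg.
have mhK : measurable_fun K h by exact: measurable_funS mh.
have := integrable_mul_bounded mK ig mhK (fun x _ => hL x).
move=> /integrableP[_]; apply: le_lt_trans.
by rewrite le_eqVlt; apply/orP; left; apply/eqP; apply: eq_integral => x _ /=; rewrite mulrC.
Qed.

Lemma compact_sub_locally_integrable (A : set R) (a b : R) W : `]a, b[ `<=` A ->
  {within A, continuous W} -> measurable A ->
  locally_integrable `]a, b[ W.
Proof.
move=> sub cW mA; split; [|exact: interval_open|].
  by apply: measurable_funS (subspace_continuous_measurable_fun mA cW).
move=> K Kab cK.
have : mu.-integrable K (EFin \o W).
  apply: continuous_compact_integrable => //.
  by apply: continuous_subspaceW cW; exact: subset_trans sub.
by case/integrableP.
Qed.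

Lemma within_continuous_comp (A : set R) (W phi : R -> R) :
  {within A, continuous W} -> continuous phi -> {within A, continuous (phi \o W)}.
Proof.
move=> /subspace_continuousP cW cphi; apply/subspace_continuousP => x xA.
by have := cvg_comp _ _ (cW x xA) (cphi (W x)); exact.
Qed.

Lemma Rintegral_cst_cc (k a b : R) : a <= b -> \int[mu]_(_ in `[a, b]) k = k * (b - a).
Proof.
move=> ab; have mI : mu `[a, b] = (b - a)%:E.
  rewrite lebesgue_measure_itv/= lte_fin; case: ltP => // ba.
  by rewrite (@le_anti _ _ a b) ?subrr// ab.
by rewrite Rintegral_cst//= [mu _]mI.
Qed.

(** Continuous functions are dense in L^1: [G'] approximates [g], and the primitive [G] then
    approximates [W] uniformly. The approximation is made on the larger interval [c', d'] so that
    [G] is differentiable at [c] and [d] too. *)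
Lemma C1_approx W g (c d e : R) : locally_integrable I01 g ->
  (forall x y, 0 < x -> x <= y -> y <= 1 -> W y - W x = \int[mu]_(z in `]x, y[) g z) ->
  0 < c -> c < d -> d < 1 -> 0 < e ->
  exists G' G : R -> R, [/\ continuous G',
    forall x, c <= x <= d -> is_derive x 1 G (G' x),
    \int[mu]_(x in `[c, d]) `|g x - G' x| < e &
    forall x, c <= x <= d -> `|G x - W x| <= e].
Proof.
move=> lg Wd c0 cd d1 e0.
pose c' := c / 2; pose d' := (d + 1) / 2.
have cc' : c' < c by rewrite /c'; lra.
have dd' : d < d' by rewrite /d'; lra.
have c'0 : 0 < c' by rewrite /c'; lra.
have d'1 : d' < 1 by rewrite /d'; lra.
have ig : mu.-integrable `[c', d'] (EFin \o g) by exact: (locally_integrable_itv lg).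
have muf : (mu `[c', d'] < +oo)%E.
  by rewrite lebesgue_measure_itv/=; case: ifP => _; rewrite ?ltry// -EFinD ltry.
have [g_ [cg_ ig_ cv]] := approximation_continuous_integrable (measurable_itv _) muf ig.
have U0 : nbhs (0%E : \bar R) [set y | (y < e%:E)%E].
  by apply: open_nbhs_nbhs; split; [exact: open_ereal_lt_ereal|rewrite /= lte_fin].
have [n _ /(_ n (leqnn n)) /= hn] := cv _ U0.
pose G' := g_ n; pose G x := W c' + \int[mu]_(z in `[c', x]) G' z.
have iG : mu.-integrable `[c', d'] (EFin \o G') := ig_ n.
have idiff : mu.-integrable `[c', d'] (EFin \o (fun x => `|g x - G' x|)).
  exact: (integrable_norm (integrableB _ ig iG)).
have err : \int[mu]_(x in `[c', d']) `|g x - G' x| < e.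
  have fi := integrable_fin_num _ idiff.
  by rewrite -lte_fin fineK//; exact: fi.
exists G', G; split.
- exact: cg_.
- move=> x /andP[cx xd].
  have [] := @continuous_FTC1_closed R G' c' x d' _ iG _ (cg_ n x); try lra.
  move=> dF F'.
  have dF' : is_derive x 1 (fun y => \int[mu]_(z in `[c', y]) G' z) (G' x).
    by split; [exact: dF|rewrite -derive1E; exact: F'].
  by apply: is_derive_eq (is_deriveD (is_derive_cst (W c') x 1) dF') _; rewrite add0r.
- apply: le_lt_trans err.
  apply: fine_le.
  + apply: integrable_fin_num => //; apply: (@integrableS _ _ _ mu `[c', d']) => //.
    by move=> x /=; rewrite !in_itv/= => /andP[? ?]; apply/andP; split; lra.
  + exact: integrable_fin_num.
  apply: ge0_subset_integral => //; first by case/integrableP : idiff.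
  by move=> x /=; rewrite !in_itv/= => /andP[? ?]; apply/andP; split; lra.
- move=> x /andP[cx xd]; apply: ltW; apply: le_lt_trans err.
  have sub : `]c', x[ `<=` `[c', d'].
    by move=> y /=; rewrite !in_itv/= => /andP[? ?]; apply/andP; split; lra.
  have i1 : mu.-integrable `]c', x[ (EFin \o G') by apply: (@integrableS _ _ _ mu `[c', d']).
  have i2 : mu.-integrable `]c', x[ (EFin \o g) by apply: (@integrableS _ _ _ mu `[c', d']).
  have i3 : mu.-integrable `]c', x[ (EFin \o (fun x => `|g x - G' x|)).
    by apply: (@integrableS _ _ _ mu `[c', d']).
  have -> : G x - W x = - (\int[mu]_(z in `]c', x[) (g z - G' z)).
    rewrite RintegralB// -Wd//; try lra.
    rewrite /G -Rintegral_itv_obnd_cbnd; last first.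
      apply: (@integrableS _ _ _ mu `[c', d']) => //.
      by move=> y /=; rewrite !in_itv/= => /andP[? ?]; apply/andP; split; lra.
    rewrite -Rintegral_itv_bndo_bndc//; ring.
  rewrite normrN; apply: le_trans (le_normr_Rintegral _ (integrableB _ i2 i1)) _ => //.
  apply: fine_le; [exact: integrable_fin_num _ i3|exact: integrable_fin_num _ idiff|].
  by apply: ge0_subset_integral => //; case/integrableP : idiff.
Qed.

Lemma cvg_le_seq (a : nat -> R) (l C : R) (e_ : nat -> R) : e_ @ \oo --> 0 ->
  (forall n, `|a n - l| <= C * e_ n) -> a @ \oo --> l.
Proof.
move=> e0 h; apply/cvgrPdist_le => eps eps0.
have : (fun n => C * e_ n) @ \oo --> C * 0 by apply: cvgM => //; exact: cvg_cst.
rewrite mulr0 => /cvgrPdist_le /(_ _ eps0); apply: filterS => n.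
rewrite sub0r normrN distrC => hn; apply: le_trans (h n) _.
exact: le_trans (ler_norm _) hn.
Qed.

End calculus_tools.

Section chain_rule.
Context {R : realType}.
Local Notation mu := (@lebesgue_measure R).
Local Notation I01 := (`]0%R, 1%R[%classic : set R).
Implicit Types (c s t x y : R) (u v g h w W : R -> R).

Section approximation.
Variables (W g phi phi' : R -> R) (L : R).
Hypothesis cW : {within `]0, 1], continuous W}.
Hypothesis lg : locally_integrable I01 g.
Hypothesis Wd : forall x y, 0 < x -> x <= y -> y <= 1 ->
  W y - W x = \int[mu]_(z in `]x, y[) g z.
Hypothesis dphi : forall x, is_derive x 1 phi (phi' x).
Hypothesis cphi' : continuous phi'.
Hypothesis hL : forall x, `|phi' x| <= L.

Let cphi : continuous phi.
Proof. by move=> x; apply/differentiable_continuous/derivable1_diffP; have [] := dphi x. Qed.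

Let mW : measurable_fun I01 W.
Proof.
have mA : measurable (`]0, 1]%classic : set R) by [].
by apply: measurable_funS (subspace_continuous_measurable_fun mA cW) => //; exact: subset_itv_oo_oc.
Qed.

(** For the C^1 approximations G n of [W] the formula is integration by parts on an interval
    carrying the test function; both sides pass to the limit, since G n -> W uniformly there and G'
    n -> g in L^1. *)
Lemma chain_rule_weak : weak_derivative 0 1 (phi \o W) (fun x => phi' (W x) * g x).
Proof.
have lpW : locally_integrable I01 (phi \o W).
  apply: (@compact_sub_locally_integrable R `]0, 1]%classic) => //; first exact: subset_itv_oo_oc.
  exact: within_continuous_comp.
have mp : measurable_fun I01 (phi' \o W).
  by apply: measurableT_comp => //; exact: continuous_measurable_fun.
split => //.
  by apply: (@locally_integrable_mul_bounded R _ _ g (phi' \o W) L) => // x; exact: hL.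
move=> z tz; have [c [d [c0 cd d1 z0 dz0]]] := test_function_support ltr01 tz.
have [sm _] := tz.
have dz x : derivable z x 1 by have := sm 0%N x; rewrite derive1n0.
have cz : continuous z by move=> x; apply/differentiable_continuous/derivable1_diffP.
have cdz : continuous (derive1 z).
  by move=> x; apply/differentiable_continuous/derivable1_diffP; have := sm 1%N x; rewrite derive1n1.
have L0 : 0 <= L by apply: le_trans (hL 0); exact: normr_ge0.
have sub : `[c, d] `<=` I01.
  by move=> x /=; rewrite !in_itv/= => /andP[? ?]; apply/andP; split; lra.
have nin x : ~ (`[c, d]%classic : set R) x -> ~~ (c < x < d).
  by move=> h; apply/negP => /andP[h1 h2]; apply: h; rewrite /= in_itv/= !ltW.
rewrite (Rintegral_eq0_outside sub); last first.
  by move=> x _ nx; rewrite dz0 ?mulr0//; exact: nin.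
rewrite [in RHS](Rintegral_eq0_outside sub); last first.
  by move=> x _ nx; rewrite z0 ?mulr0//; exact: nin.
have bnd (k : R -> R) : continuous k -> exists2 K : R, 0 <= K & forall x, c <= x <= d -> `|k x| <= K.
  move=> ck; have cn : {within `[c, d], continuous (fun x : R => `|k x|)}.
    by apply: continuous_subspaceT => x; apply: (@cvg_norm _ _ _ (nbhs x)); exact: ck.
  have [y _ hy] := EVT_max (ltW cd) cn.
  exists `|k y|; first exact: normr_ge0.
  by move=> x xcd; apply: hy; rewrite in_itv.
have [K0 K00 hK0] := bnd _ cz; have [K1 K10 hK1] := bnd _ cdz.
have ch n : {X : (R -> R) * (R -> R) | [/\ continuous X.1,
    forall x, c <= x <= d -> is_derive x 1 X.2 (X.1 x),
    \int[mu]_(x in `[c, d]) `|g x - X.1 x| < n.+1%:R^-1 &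
    forall x, c <= x <= d -> `|X.2 x - W x| <= n.+1%:R^-1]}.
  apply: cid; have e0 : 0 < n.+1%:R^-1 :> R by rewrite invr_gt0.
  by have [G' [G h]] := C1_approx lg Wd c0 cd d1 e0; exists (G', G).
pose G' n := (sval (ch n)).1; pose G n := (sval (ch n)).2.
have cG' n : continuous (G' n) by have [] := svalP (ch n).
have dG n x : c <= x <= d -> is_derive x 1 (G n) (G' n x) by have [_ + _ _] := svalP (ch n); apply.
have eG' n : \int[mu]_(x in `[c, d]) `|g x - G' n x| < n.+1%:R^-1 by have [] := svalP (ch n).
have eG n x : c <= x <= d -> `|G n x - W x| <= n.+1%:R^-1 by have [_ _ _] := svalP (ch n); apply.
have cGn n x : c <= x <= d -> {for x, continuous (G n)}.
  by move=> xcd; apply/differentiable_continuous/derivable1_diffP; have [] := dG n x xcd.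
have mG n : measurable_fun `[c, d] (G n).
  apply: subspace_continuous_measurable_fun => //.
  apply/subspace_continuousP => x; rewrite /= in_itv/= => xcd.
  by apply: cvg_within_filter; exact: cGn.
have ig : mu.-integrable `[c, d] (EFin \o g) by exact: (locally_integrable_itv lg).
have iG n : mu.-integrable `[c, d] (EFin \o G' n).
  apply: continuous_compact_integrable; first exact: segment_compact.
  exact: continuous_subspaceT.
have mz : measurable_fun `[c, d] z by apply: measurable_funTS; exact: continuous_measurable_fun.
have mdz : measurable_fun `[c, d] (derive1 z) by apply: measurable_funTS; exact: continuous_measurable_fun.
have mW' : measurable_fun `[c, d] W by exact: measurable_funS mW.
have mph (h : R -> R) : measurable_fun `[c, d] h -> measurable_fun `[c, d] (phi' \o h).
  by move=> mh; apply: measurableT_comp => //; exact: continuous_measurable_fun.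
have mph0 (h : R -> R) : measurable_fun `[c, d] h -> measurable_fun `[c, d] (phi \o h).
  by move=> mh; apply: measurableT_comp => //; exact: continuous_measurable_fun.
have ibp n : \int[mu]_(x in `[c, d]) (phi (G n x) * derive1 z x) =
    - \int[mu]_(x in `[c, d]) ((phi' (G n x) * G' n x) * z x).
  have dF x : c <= x <= d -> is_derive x 1 (phi \o G n) (phi' (G n x) * G' n x).
    by move=> xcd; apply: is_derive1_comp; exact: dG.
  have h1 : {within `[c, d], continuous (fun x => phi' (G n x) * G' n x)}.
    apply/subspace_continuousP => x; rewrite /= in_itv/= => xcd.
    apply: cvg_within_filter; apply: cvgM; last exact: cG'.
    by apply: continuous_comp; [exact: cGn|exact: cphi'].
  have h2 : derivable_oo_LRcontinuous (phi \o G n) c d.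
    split.
    + by move=> x; rewrite in_itv/= => /andP[cx xd]; have [] := dF x; rewrite ?ltW.
    + apply: cvg_at_right_filter; apply: continuous_comp; last exact: cphi.
      by apply: cGn; rewrite lexx ltW.
    + apply: cvg_at_left_filter; apply: continuous_comp; last exact: cphi.
      by apply: cGn; rewrite lexx ltW.
  have h3 : {in `]c, d[, derive1 (phi \o G n) =1 (fun x => phi' (G n x) * G' n x)}.
    move=> x; rewrite in_itv/= => /andP[cx xd]; rewrite derive1E.
    by have [] := dF x; rewrite ?ltW.
  have h4 : {within `[c, d], continuous (derive1 z)} by exact: continuous_subspaceT.
  have h5 : derivable_oo_LRcontinuous z c d.
    split.
    + by move=> x _.
    + by apply: cvg_at_right_filter; exact: cz.
    + by apply: cvg_at_left_filter; exact: cz.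
  have := Rintegration_by_parts cd h1 h2 h3 h4 h5 (fun x _ => erefl).
  by rewrite !z0 ?ltxx ?andbF// !mulr0 subrr add0r.
have inv0 : (fun n => n.+1%:R^-1 : R) @ \oo --> 0 by exact: cvg_harmonic.
have inv1 n : n.+1%:R^-1 <= 1 :> R by rewrite invf_le1// ler1n.
have cGW x : c <= x <= d -> (fun n => G n x) @ \oo --> W x.
  move=> xcd; apply: (cvg_le_seq (C := 1) inv0) => n.
  by rewrite mul1r; exact: eG.
have ib (h k : R -> R) (K : R) : measurable_fun `[c, d] h ->
    mu.-integrable `[c, d] (EFin \o k) -> (forall x, c <= x <= d -> `|h x| <= K) ->
    mu.-integrable `[c, d] (EFin \o (fun x => k x * h x)).
  move=> mh ik hb; have hb' x : (`[c, d]%classic : set R) x -> `|h x| <= K.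
    by rewrite /= in_itv/=; exact: hb.
  exact: (integrable_mul_bounded _ ik mh hb').
have ic (k : R -> R) : {within `[c, d], continuous k} -> mu.-integrable `[c, d] (EFin \o k).
  by move=> ck; apply: continuous_compact_integrable => //; exact: segment_compact.
have ipW : mu.-integrable `[c, d] (EFin \o (phi \o W)).
  apply: ic; apply: within_continuous_comp => //.
  by apply: continuous_subspaceW cW; move=> x /=; rewrite !in_itv/= => /andP[? ?]; apply/andP; split; lra.
have ipG n : mu.-integrable `[c, d] (EFin \o (phi \o G n)).
  apply: ic; apply: within_continuous_comp => //; apply/subspace_continuousP => x.
  by rewrite /= in_itv/= => xcd; apply: cvg_within_filter; exact: cGn.
have A : (fun n => \int[mu]_(x in `[c, d]) (phi (G n x) * derive1 z x)) @ \oo -->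
    \int[mu]_(x in `[c, d]) (phi (W x) * derive1 z x).
  have i1 := ib _ _ _ mdz ipW hK1; have i2 n := ib _ _ _ mdz (ipG n) hK1.
  apply: (cvg_le_seq (C := L * K1 * (d - c)) inv0) => n.
  rewrite -(RintegralB _ (i2 n) i1)//.
  have i3 := integrableB _ (i2 n) i1.
  apply: le_trans (le_normr_Rintegral _ (i3 _)) _ => //.
  have ik : mu.-integrable `[c, d] (EFin \o cst (L * n.+1%:R^-1 * K1)).
    by apply: ic; apply: continuous_subspaceT => ?; exact: cvg_cst.
  apply: (@le_trans _ _ (\int[mu]_(x in `[c, d]) (L * n.+1%:R^-1 * K1))).
    apply: le_Rintegral => //; first by apply: integrable_norm; exact: (i3 _).
    move=> x; rewrite /= in_itv/= => xcd; rewrite -mulrBl normrM.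
    apply: ler_pM => //; last exact: hK1.
    apply: le_trans (bounded_derive_lipschitz dphi hL _ _) _.
    by rewrite ler_wpM2l// eG.
  rewrite Rintegral_cst_cc ?(ltW cd)//.
  by rewrite le_eqVlt; apply/orP; left; apply/eqP; ring.
have B : (fun n => \int[mu]_(x in `[c, d]) ((phi' (G n x) * G' n x) * z x)) @ \oo -->
    \int[mu]_(x in `[c, d]) ((phi' (W x) * g x) * z x).
  (* The product phi'(G n) G' n is split into a part that is small in L^1, as phi' is bounded, and a
     part with the fixed factor [g], to which domination applies. *)
  pose P n := \int[mu]_(x in `[c, d]) ((G' n x - g x) * (phi' (G n x) * z x)).
  pose S' n := \int[mu]_(x in `[c, d]) (g x * (phi' (G n x) * z x)).
  have mpz : forall n, measurable_fun `[c, d] (fun x => phi' (G n x) * z x).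
    by move=> m; apply: measurable_funM => //; exact: mph (mG m).
  have mpWz : measurable_fun `[c, d] (fun x => phi' (W x) * z x).
    by apply: measurable_funM => //; exact: mph mW'.
  have bz (y x : R) : c <= x <= d -> `|phi' y * z x| <= L * K0.
    by move=> xcd; rewrite normrM; apply: ler_pM => //; exact: hK0.
  have iD : forall n, mu.-integrable `[c, d] (EFin \o (fun x => G' n x - g x)).
    by move=> m; exact: (integrableB _ (iG m) ig).
  have i1 : forall n, mu.-integrable `[c, d]
      (EFin \o (fun x => (G' n x - g x) * (phi' (G n x) * z x))).
    by move=> m; apply: (ib _ _ (L * K0)) => // x; exact: bz.
  have i2 : forall n, mu.-integrable `[c, d] (EFin \o (fun x => g x * (phi' (G n x) * z x))).
    by move=> m; apply: (ib _ _ (L * K0)) => // x; exact: bz.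
  have E : forall n, \int[mu]_(x in `[c, d]) ((phi' (G n x) * G' n x) * z x) = P n + S' n.
    move=> m; rewrite -(RintegralD _ (i1 m) (i2 m))//.
    by apply: eq_Rintegral => x _; ring.
  under eq_fun do rewrite E.
  have P0 : P @ \oo --> 0.
    apply: (cvg_le_seq (C := L * K0) inv0) => n; rewrite subr0.
    apply: le_trans (le_normr_Rintegral _ (i1 n)) _ => //.
    have iN : mu.-integrable `[c, d] (EFin \o (fun x => `|g x - G' n x|)).
      exact: (integrable_norm (integrableB _ ig (iG n))).
    have iN' : mu.-integrable `[c, d] (EFin \o (fun x => L * K0 * `|g x - G' n x|)).
      exact: (integrableZl _ _ iN).
    apply: (@le_trans _ _ (\int[mu]_(x in `[c, d]) (L * K0 * `|g x - G' n x|))).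
      apply: le_Rintegral => //; first by apply: integrable_norm; exact: (i1 n).
      move=> x; rewrite /= in_itv/= => xcd; rewrite normrM mulrC (distrC (g x)).
      by rewrite ler_wpM2r// bz.
    rewrite RintegralZl// ler_wpM2l//; first by rewrite mulr_ge0.
    by apply: ltW; exact: eG'.
  have S0 : S' @ \oo --> \int[mu]_(x in `[c, d]) (g x * (phi' (W x) * z x)).
    have mg' : measurable_fun `[c, d] g by case/integrableP : ig => /measurable_EFinP.
    have iLg : mu.-integrable `[c, d] (EFin \o (fun x => L * K0 * `|g x|)).
      exact: (integrableZl _ _ (integrable_norm ig)).
    apply: (@Rdominated_convergence _ _ (fun n x => g x * (phi' (G n x) * z x)) _
      (fun x => L * K0 * `|g x|)) => //.
    - by move=> n; exact: measurable_funM.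
    - exact: measurable_funM.
    - apply: aeW => x; rewrite /= in_itv/= => xcd; apply: cvgM; first exact: cvg_cst.
      apply: cvgM; last exact: cvg_cst.
      by apply: continuous_cvg; [exact: cphi'|exact: cGW].
    - apply: aeW => x; rewrite /= in_itv/= => xcd n; rewrite normrM mulrC.
      by rewrite ler_wpM2r// bz.
  have -> : \int[mu]_(x in `[c, d]) ((phi' (W x) * g x) * z x) =
      0 + \int[mu]_(x in `[c, d]) (g x * (phi' (W x) * z x)).
    by rewrite add0r; apply: eq_Rintegral => x _; ring.
  exact: cvgD P0 S0.
have A' : (fun n => \int[mu]_(x in `[c, d]) (phi (G n x) * derive1 z x)) @ \oo -->
    - \int[mu]_(x in `[c, d]) ((phi' (W x) * g x) * z x).
  by under eq_fun do rewrite ibp; exact: cvgN.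
exact: (cvg_unique (@norm_hausdorff _ _) A A').
Qed.

End approximation.
End chain_rule.

(** * Linear operations and composition in V *)

Section sobolev_operations.
Context {R : realType}.
Local Notation mu := (@lebesgue_measure R).
Local Notation I01 := (`]0%R, 1%R[%classic : set R).
Implicit Types (c s t x y k : R) (u v g h w W : R -> R).

Lemma test_integrable (a b : R) g (phi : R -> R) : a < b -> locally_integrable `]a, b[ g -> test_function a b phi ->
  mu.-integrable `]a, b[ (EFin \o (fun x => g x * phi x)) /\
  mu.-integrable `]a, b[ (EFin \o (fun x => g x * derive1 phi x)).
Proof.
move=> ab lg tz; have [c [d [c0 cd d1 z0 dz0]]] := test_function_support ab tz.
have [sm _] := tz.
have ig : mu.-integrable `[c, d] (EFin \o g) by exact: (locally_integrable_itv lg).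
have K (z : R -> R) : continuous z -> (forall x, ~~ (c < x < d) -> z x = 0) ->
    mu.-integrable `]a, b[ (EFin \o (fun x => g x * z x)).
  move=> cz z0'.
  have -> : EFin \o (fun x => g x * z x) = (EFin \o (fun x => g x * z x)) \_ `[c, d].
    apply/funext => x; rewrite patchE; case: ifPn => // /negP nx /=.
    rewrite z0' ?mulr0//; apply/negP => /andP[h1 h2]; apply: nx; apply/mem_set.
    by rewrite /= in_itv/= !ltW.
  apply/integrable_restrict => //.
  apply: (@integrableS _ _ _ mu `[c, d]) => //; first exact: measurableI.
  have cn : {within `[c, d], continuous (fun x : R => `|z x|)}.
    by apply: continuous_subspaceT => x; apply: (@cvg_norm _ _ _ (nbhs x)); exact: cz.
  have [y _ hy] := EVT_max (ltW cd) cn.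
  have mz : measurable_fun `[c, d] z by apply: measurable_funTS; exact: continuous_measurable_fun.
  have hb x : (`[c, d]%classic : set R) x -> `|z x| <= `|z y| by move=> xcd; apply: hy.
  exact: (integrable_mul_bounded _ ig mz hb).
split; apply: K => // x; apply/differentiable_continuous/derivable1_diffP.
  by have := sm 0%N x; rewrite derive1n0.
by have := sm 1%N x; rewrite derive1n1.
Qed.

Lemma locally_integrableZ (a b : R) k g : locally_integrable `]a, b[ g ->
  locally_integrable `]a, b[ (fun x => k * g x).
Proof.
move=> lg; apply: (@locally_integrable_mul_bounded R a b g (cst k) `|k|) => //.
Qed.

Lemma weak_derivativeD (a b : R) u v g h : a < b -> weak_derivative a b u g -> weak_derivative a b v h ->
  weak_derivative a b (u \+ v) (g \+ h).
Proof.
move=> ab [lu lg ug] [lv lh vh]; split; [exact: locally_integrableD|exact: locally_integrableD|].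
move=> z tz.
have [iu iu'] := test_integrable ab lu tz; have [iv iv'] := test_integrable ab lv tz.
have [ig _] := test_integrable ab lg tz; have [ih _] := test_integrable ab lh tz.
transitivity (\int[mu]_(x in `]a, b[) (u x * derive1 z x + v x * derive1 z x)).
  by apply: eq_Rintegral => x _ /=; rewrite mulrDl.
rewrite (RintegralD _ iu' iv')// ug// vh// -opprD -(RintegralD _ ig ih)//.
by congr (- _); apply: eq_Rintegral => x _ /=; rewrite mulrDl.
Qed.

Lemma weak_derivativeZ (a b : R) k u g : a < b -> weak_derivative a b u g ->
  weak_derivative a b (fun x => k * u x) (fun x => k * g x).
Proof.
move=> ab [lu lg ug]; split; [exact: locally_integrableZ|exact: locally_integrableZ|].
move=> z tz.
have [iu iu'] := test_integrable ab lu tz; have [ig _] := test_integrable ab lg tz.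
transitivity (\int[mu]_(x in `]a, b[) (k * (u x * derive1 z x))).
  by apply: eq_Rintegral => x _ /=; rewrite mulrA.
rewrite (RintegralZl _ _ iu')// ug// mulrN -(RintegralZl _ _ ig)//.
by congr (- _); apply: eq_Rintegral => x _ /=; rewrite mulrA.
Qed.

Lemma inVD u v : inV u -> inV v -> inV (u \+ v).
Proof.
move=> [hu [g ug gH]] [hv [h vh hH]]; split; first exact: inHD.
by exists (g \+ h); [exact: weak_derivativeD|exact: inHD].
Qed.

Lemma inVZ k u : inV u -> inV (fun x => k * u x).
Proof.
move=> [hu [g ug gH]]; split; first exact: inHZ.
by exists (fun x => k * g x); [exact: weak_derivativeZ|exact: inHZ].
Qed.

Lemma inV_sub u v : inV u -> inV v -> inV (u \- v).
Proof.
move=> uV vV; have -> : u \- v = u \+ (fun x => -1 * v x).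
  by apply/funext => x /=; rewrite mulN1r.
by apply: inVD => //; exact: inVZ.
Qed.

Lemma inV0 : inV (cst 0 : R -> R).
Proof.
have l0 : locally_integrable I01 (cst 0 : R -> R).
  split; [exact: measurable_cst|exact: interval_open|].
  by move=> K _ _; under eq_integral do rewrite normr0; rewrite integral0 ltry.
have H0 : inH (cst 0 : R -> R).
  split => //; under eq_integral do rewrite expr0n/= mulr0; by rewrite integral0 ltry.
split => //; exists (cst 0) => //; split => // z _.
under eq_Rintegral do rewrite mul0r.
by under [in RHS]eq_Rintegral do rewrite mul0r; rewrite /Rintegral integral0 /= oppr0.
Qed.

Lemma wderivD u v : inV u -> inV v ->
  {ae mu, forall x, 0 < x < 1 -> wderiv (u \+ v) x = wderiv u x + wderiv v x}.
Proof. by move=> uV vV; apply: wderiv_eq; apply: (weak_derivativeD ltr01); exact: wderiv_weak. Qed.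

Lemma wderivZ k u : inV u ->
  {ae mu, forall x, 0 < x < 1 -> wderiv (fun x => k * u x) x = k * wderiv u x}.
Proof. by move=> uV; apply: wderiv_eq; apply: (weak_derivativeZ _ ltr01); exact: wderiv_weak. Qed.

Lemma wderivB u v : inV u -> inV v ->
  {ae mu, forall x, 0 < x < 1 -> wderiv (u \- v) x = wderiv u x - wderiv v x}.
Proof.
move=> uV vV; have -> : u \- v = u \+ (fun x => -1 * v x).
  by apply/funext => x /=; rewrite mulN1r.
apply: (ae_imp2 (wderivD uV (inVZ (-1) vV)) (wderivZ (-1) vV)) => x h1 h2 xI.
by rewrite h1// h2// mulN1r.
Qed.

Lemma wderiv_measurable u : inV u -> measurable_fun I01 (wderiv u).
Proof. by move=> /inH_wderiv/inH_measurable. Qed.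

Lemma ip_le_sqD u v : inH u -> inH v -> ip (u \+ v) (u \+ v) <= 2 * ip u u + 2 * ip v v.
Proof.
move=> hu hv; have iu := inH_ip_integrable hu hu; have iv := inH_ip_integrable hv hv.
have iu' : mu.-integrable I01 (EFin \o (fun x => 2 * (x ^+ 2 * u x * u x))).
  exact: (integrableZl _ 2 iu).
have iv' : mu.-integrable I01 (EFin \o (fun x => 2 * (x ^+ 2 * v x * v x))).
  exact: (integrableZl _ 2 iv).
rewrite -(RintegralZl _ _ iu)// -(RintegralZl _ _ iv)// -(RintegralD _ iu' iv')//.
apply: le_Rintegral => //; [by apply: inH_ip_integrable; exact: inHD|exact: (integrableD _ iu' iv')|].
move=> x _ /=.
have : 0 <= x ^+ 2 * (u x - v x) ^+ 2 by rewrite mulr_ge0 ?sqr_ge0.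
have -> : x ^+ 2 * (u x - v x) ^+ 2 = 2 * (x ^+ 2 * u x * u x) + 2 * (x ^+ 2 * v x * v x)
  - x ^+ 2 * (u x + v x) * (u x + v x) by ring.
by rewrite subr_ge0.
Qed.

Lemma sqn1D_le u v : inV u -> inV v -> sqn1 (u \+ v) <= 2 * sqn1 u + 2 * sqn1 v.
Proof.
move=> uV vV; have [hu _] := uV; have [hv _] := vV.
have hu' := inH_wderiv uV; have hv' := inH_wderiv vV.
have uvV := inVD uV vV.
have E : ip (wderiv (u \+ v)) (wderiv (u \+ v)) =
    ip (wderiv u \+ wderiv v) (wderiv u \+ wderiv v).
  by apply: ae_eq_ip; rewrite //=; try exact: wderivD; try exact: wderiv_measurable;
    apply: measurable_funD; exact: wderiv_measurable.
rewrite /sqn1 E.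
have arith (x1 x2 x3 y1 y2 y3 : R) : x1 <= 2 * x2 + 2 * x3 -> y1 <= 2 * y2 + 2 * y3 ->
    x1 + y1 <= 2 * (x2 + y2) + 2 * (x3 + y3) by clear; lra.
exact: arith (ip_le_sqD hu hv) (ip_le_sqD hu' hv').
Qed.

Lemma sqn1Z k u : inV u -> sqn1 (fun x => k * u x) = k ^+ 2 * sqn1 u.
Proof.
move=> uV; have [hu _] := uV; have hu' := inH_wderiv uV.
have kuV := inVZ k uV.
have E : ip (wderiv (fun x => k * u x)) (wderiv (fun x => k * u x)) =
    ip (fun x => k * wderiv u x) (fun x => k * wderiv u x).
  by apply: ae_eq_ip; rewrite //=; try exact: wderivZ; try exact: wderiv_measurable;
    apply: measurable_funM => //; exact: wderiv_measurable.
rewrite /sqn1 E.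
have Z (w : R -> R) : inH w -> ip (fun x => k * w x) (fun x => k * w x) = k ^+ 2 * ip w w.
  by move=> hw; rewrite ipZl//; [rewrite ipC ipZl// mulrA|exact: inHZ].
by rewrite !Z// mulrDr.
Qed.

Lemma trace1D u v : inV u -> inV v -> trace1 (u \+ v) = trace1 u + trace1 v.
Proof.
move=> uV vV; have [U [cU uU -> _]] := inV_rep uV; have [W [cW vW -> _]] := inV_rep vV.
rewrite (@trace1E _ (u \+ v) (U \+ W))//.
  move/subspace_continuousP : cU => cU; move/subspace_continuousP : cW => cW.
  by apply/subspace_continuousP => x xA; exact: (cvgD (cU x xA) (cW x xA)).
by apply: (ae_imp2 uU vW) => x h1 h2 xI /=; rewrite h1// h2.
Qed.

Lemma trace1Z k u : inV u -> trace1 (fun x => k * u x) = k * trace1 u.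
Proof.
move=> uV; have [U [cU uU -> _]] := inV_rep uV.
rewrite (@trace1E _ (fun x => k * u x) (fun x => k * U x))//.
  by apply: (within_continuous_comp cU) => x; apply: (@continuousM _ _ (cst k) id); [exact: cvg_cst|exact: cvg_id].
by apply: (ae_imp uU) => x h1 xI /=; rewrite h1.
Qed.

Lemma trace1B u v : inV u -> inV v -> trace1 (u \- v) = trace1 u - trace1 v.
Proof.
move=> uV vV; have -> : u \- v = u \+ (fun x => -1 * v x).
  by apply/funext => x /=; rewrite mulN1r.
by rewrite trace1D//; [rewrite trace1Z// mulN1r|exact: inVZ].
Qed.

(** The chain rule is known for the continuous representative and is carried to [v] almost
    everywhere. With phi(0) = 0, |phi(v)| <= L |v| gives membership in H. *)
Lemma inV_comp v (phi phi' : R -> R) (L : R) : inV v ->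
  (forall x, is_derive x 1 phi (phi' x)) -> continuous phi' ->
  (forall x, `|phi' x| <= L) -> phi 0 = 0 ->
  [/\ inV (phi \o v),
    {ae mu, forall x, 0 < x < 1 -> wderiv (phi \o v) x = phi' (v x) * wderiv v x} &
    trace1 (phi \o v) = phi (trace1 v)].
Proof.
move=> vV dphi cphi' hL phi0; have [vH _] := vV; have gH := inH_wderiv vV.
have [W [cW vW trW Wd]] := inV_rep vV.
have [mv mg] := weak_derivative_measurable (wderiv_weak vV).
have cphi : continuous phi.
  by move=> x; apply/differentiable_continuous/derivable1_diffP; have [] := dphi x.
have L0 : 0 <= L by apply: le_trans (hL 0); exact: normr_ge0.
have [_ lg _] := wderiv_weak vV.
have cr := chain_rule_weak cW lg Wd dphi cphi' hL.
have mpv : measurable_fun I01 (phi \o v).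
  by apply: measurableT_comp => //; exact: continuous_measurable_fun.
have mp'v : measurable_fun I01 (phi' \o v).
  by apply: measurableT_comp => //; exact: continuous_measurable_fun.
have wd : weak_derivative 0 1 (phi \o v) (fun x => phi' (v x) * wderiv v x).
  apply: (eq_weak_derivative cr) => //.
  - exact: measurable_funM.
  - by apply: (ae_imp vW) => x h xI /=; rewrite h.
  - by apply: (ae_imp vW) => x h xI /=; rewrite h.
split.
- split.
    apply: (inH_le mpv (inHZ L vH)) => x _ /=.
    have := bounded_derive_lipschitz dphi hL (v x) 0; rewrite phi0 !subr0 => h.
    rewrite -(real_normK (num_real (phi (v x)))) -(real_normK (num_real (L * v x))).
    by rewrite ler_pXn2r ?nnegrE// normrM (ger0_norm L0).
  exists (fun x => phi' (v x) * wderiv v x) => //.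
  apply: (inH_le _ (inHZ L gH)) => [|x _ /=]; first exact: measurable_funM.
  rewrite !exprMn ler_wpM2r ?sqr_ge0// -(real_normK (num_real (phi' (v x)))).
  by rewrite ler_pXn2r ?nnegrE.
- exact: wderiv_eq.
- rewrite trW (@trace1E _ _ (phi \o W))//; first exact: within_continuous_comp.
  by apply: (ae_imp vW) => x h xI /=; rewrite h.
Qed.

End sobolev_operations.

(** * The truncation *)

(* Psi z = z^3 (1 + z)^(-alpha) with alpha = (p + 1) / 2: cubic at 0, so that Psi is C^2
   and (Psi')^2 <= C Psi'' Psi; and p - 1 <= alpha < 2, so that |f| |Psi'| grows at
   most quadratically. *)
Section truncation.
Context {R : realType}.
Implicit Types (x y z s r : R).

(** The quadratic bound forces the derivative at the junction to be 0, which matches the left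
    branch. *)
Lemma is_derive_glue0 (F F' : R -> R) (C : R) :
  (forall x, 0 < x -> is_derive x 1 F (F' x)) ->
  (forall x, 0 < x -> `|F x| <= C * x ^+ 2) ->
  forall x, is_derive x 1 (fun y => if 0 < y then F y else 0) (if 0 < x then F' x else 0).
Proof.
move=> dF bF x; have [x0|x0|<-] := ltgtP 0 x.
- apply: near_eq_is_derive (dF x x0).
  by near=> y; rewrite ifT//; near: y; exact: lt_nbhsr.
- apply: (@near_eq_is_derive _ R R (cst 0)) (is_derive_cst _ _ _).
  by near=> y; rewrite ifF//; apply/lt_gtF; near: y; exact: lt_nbhsl.
- have C0 : 0 <= C by apply: le_trans (normr_ge0 (F 1)) _; have := bF _ ltr01; rewrite expr1n mulr1.
  pose G y : R := if 0 < y then F y else 0.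
  have bG y : `|G y| <= C * y ^+ 2.
    by rewrite /G; case: ifPn => [/bF//|_]; rewrite normr0 mulr_ge0// sqr_ge0.
  have cv : (h^-1 *: (G (h *: 1 + 0) - G 0)) @[h --> 0^'] --> (0:R).
    apply/cvgr0Pnorm_lt => e e0.
    near=> h.
    have h0 : h != 0 by near: h; exact: nbhs_dnbhs_neq.
    rewrite [G 0]/G ltxx subr0 addr0 [_ *: 1]mulr1 normrZ normrV ?unitfE//.
    rewrite mulrC ltr_pdivrMr ?normr_gt0//.
    apply: (le_lt_trans (bG h)).
    rewrite -[h ^+ 2]real_normK ?num_real// expr2 mulrA ltr_pM2r ?normr_gt0//.
    apply: (@le_lt_trans _ _ ((C + 1) * `|h|)); first by rewrite ler_wpM2r// lerDl.
    rewrite mulrC -ltr_pdivlMr; last by lra.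
    near: h; apply: dnbhs0_lt.
    by apply: divr_gt0 => //; lra.
  split; first by apply/cvg_ex; exists 0.
  exact/cvg_lim.
Unshelve. all: by end_near. Qed.

Variable alpha : R.
Hypothesis alpha12 : 1 <= alpha < 2.

Let p z : R := (1 + z) `^ (- alpha).

Let p_gt0 z : 0 < z -> 0 < p z.
Proof. by move=> z0; apply: powR_gt0; lra. Qed.

Let p_le z : 0 < z -> p z <= (1 + z)^-1.
Proof.
move=> z0; have z1 : 0 < 1 + z by lra.
rewrite /p -(powR_inv1 (ltW z1)); apply: ler_powR; first by lra.
by have /andP[] := alpha12; lra.
Qed.

Let dp z : 0 < z -> is_derive z 1 p (- alpha * p z / (1 + z)).
Proof.
move=> z0; have z1 : 0 < 1 + z by lra.
have d1 : is_derive z 1 (fun y : R => 1 + y) (0 + 1).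
  exact: (is_deriveD (is_derive_cst (1:R) z 1) (is_derive_id z 1)).
have d2 := @is_derive1_comp R (fun x => x `^ (- alpha)) _ z _ _ (@is_derive1_powR R (- alpha) _ z1) d1.
apply: is_derive_eq d2 _; rewrite add0r mulr1 -mulrA; congr (_ * _).
by rewrite /p powRB ?powRr1 ?(ltW z1)// (gt_eqF z1) implybT.
Qed.

Let Psi0 z := z ^+ 3 * p z.
Let psi0 z := z ^+ 2 * (3 + (3 - alpha) * z) * p z / (1 + z).
Let psi0' z := z * (6 + 6 * (2 - alpha) * z + (3 - alpha) * (2 - alpha) * z ^+ 2) * p z / (1 + z) ^+ 2.

Let dPsi0 z : 0 < z -> is_derive z 1 Psi0 (psi0 z).
Proof.
move=> z0; have z1 : 1 + z != 0 by rewrite gt_eqF//; lra.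
have -> : Psi0 = (id : R -> R) ^+ 3 * p by apply/funext => y; rewrite /Psi0 !fctE.
have d := is_deriveM (is_deriveX 3 (is_derive_id z (1:R))) (dp z0).
apply: is_derive_eq d _.
rewrite /psi0 /GRing.scale/= !fctE; field.
exact: z1.
Qed.

Let dpsi0 z : 0 < z -> is_derive z 1 psi0 (psi0' z).
Proof.
move=> z0; have z1 : 1 + z != 0 by rewrite gt_eqF//; lra.
have d1 : is_derive z 1 (fun y : R => 1 + y) (0 + 1).
  exact: (is_deriveD (is_derive_cst (1:R) z 1) (is_derive_id z 1)).
have d2 := @is_deriveV R (fun y : R => 1 + y) z _ 1 z1 d1.
have d3 : is_derive z 1 (fun y : R => 3 + (3 - alpha) * y) (0 + (3 - alpha)).
  have := is_deriveD (is_derive_cst (3:R) z 1) (is_deriveZ (3 - alpha) (is_derive_id z (1:R))).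
  by rewrite [_ *: 1]mulr1.
have d4 := is_deriveM (is_deriveM (is_deriveM (is_deriveX 2 (is_derive_id z (1:R))) d3) (dp z0)) d2.
have -> : psi0 = (id : R -> R) ^+ 2 * (fun y : R => 3 + (3 - alpha) * y) * p *
    (fun y : R => (1 + y)^-1).
  by apply/funext => y; rewrite /psi0 !fctE.
apply: is_derive_eq d4 _.
rewrite /psi0' /GRing.scale/= !fctE; field.
exact: z1.
Qed.

Let psi0_bound z : 0 < z -> 0 <= psi0 z <= 3 * z ^+ 2 * p z.
Proof.
move=> z0; have /andP[a1 a2] := alpha12; have pz := p_gt0 z0.
have z1 : 0 < 1 + z by lra.
have -> : psi0 z = ((z ^+ 2 * p z) * (3 + (3 - alpha) * z)) / (1 + z) by rewrite /psi0; ring.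
have zp : 0 <= z ^+ 2 * p z by rewrite mulr_ge0 ?sqr_ge0// ltW.
have q0 : 0 <= 3 + (3 - alpha) * z by nra.
apply/andP; split; first by rewrite divr_ge0 ?mulr_ge0// ltW.
rewrite ler_pdivrMr// (_ : 3 * z ^+ 2 * p z * (1 + z) = (z ^+ 2 * p z) * (3 * (1 + z))); last by ring.
rewrite ler_wpM2l//; nra.
Qed.

(** The bound 6 makes [psi] Lipschitz; the bound 6z gives the continuity of [psi'] at 0. *)
Let psi0'_bound z : 0 < z -> 0 <= psi0' z <= 6 /\ psi0' z <= 6 * z.
Proof.
move=> z0; have /andP[a1 a2] := alpha12; have pz := p_gt0 z0.
have z1 : 0 < 1 + z by lra.
pose q := 6 + 6 * (2 - alpha) * z + (3 - alpha) * (2 - alpha) * z ^+ 2.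
have q0 : 0 <= q.
  rewrite /q !addr_ge0// ?mulr_ge0 ?sqr_ge0//; lra.
have q1 : q <= 6 * (1 + z) ^+ 2.
  have : 0 <= (2 - (3 - alpha) * (2 - alpha)) by nra.
  have : 0 <= z * (alpha - 1) by nra.
  rewrite /q !expr2; nra.
have -> : psi0' z = z * p z * (q / (1 + z) ^+ 2) by rewrite /psi0' /q; ring.
have r0 : 0 <= q / (1 + z) ^+ 2 by rewrite divr_ge0// sqr_ge0.
have r1 : q / (1 + z) ^+ 2 <= 6 by rewrite ler_pdivrMr// exprn_gt0.
have zp0 : 0 <= z * p z by rewrite mulr_ge0// ltW.
have pl := p_le z0.
have i1 : (1 + z)^-1 <= 1 by rewrite invf_le1//; lra.
have zp1 : z * p z <= 1.
  apply: (@le_trans _ _ (z * (1 + z)^-1)); first by rewrite ler_wpM2l// ltW.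
  by rewrite ler_pdivrMr//; lra.
have zpz : z * p z <= z by rewrite ler_piMr//; [exact: ltW|exact: le_trans i1].
split; first apply/andP; first split.
- by rewrite mulr_ge0.
- by rewrite -[leRHS]mul1r ler_pM.
- by rewrite mulrC ler_pM.
Qed.

Definition Psi z := if 0 < z then Psi0 z else 0.
Definition psi z := if 0 < z then psi0 z else 0.
Definition psi' z := if 0 < z then psi0' z else 0.

Lemma is_derive_Psi z : is_derive z 1 Psi (psi z).
Proof.
apply: (@is_derive_glue0 Psi0 psi0 1 dPsi0) => x x0; have pl := p_le x0.
have p0 := p_gt0 x0; have x1 : 0 < 1 + x by lra.
rewrite mul1r /Psi0 ger0_norm; last by rewrite mulr_ge0 ?exprn_ge0// ltW.
rewrite exprSr -mulrA ler_piMr ?sqr_ge0//.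
apply: (@le_trans _ _ (x * (1 + x)^-1)); first by rewrite ler_wpM2l// ltW.
by rewrite ler_pdivrMr//; lra.
Qed.

Lemma is_derive_psi z : is_derive z 1 psi (psi' z).
Proof.
apply: (@is_derive_glue0 psi0 psi0' 3 dpsi0) => x x0; have pl := p_le x0.
have p0 := p_gt0 x0; have x1 : 0 < 1 + x by lra.
have /andP[b0 b1] := psi0_bound x0.
rewrite ger0_norm//; apply: le_trans b1 _; rewrite ler_piMr//.
  by rewrite mulr_ge0// sqr_ge0.
by apply: le_trans pl _; rewrite invf_le1//; lra.
Qed.

Lemma psi'_bound z : 0 <= psi' z <= 6.
Proof.
rewrite /psi'; case: ifPn => [/psi0'_bound[]//|_]; rewrite lexx/=; lra.
Qed.

Lemma continuous_psi' : continuous psi'.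
Proof.
move=> x; have [x0|x0|<-] := ltgtP 0 x.
- have z1 : 1 + x != 0 by rewrite gt_eqF//; lra.
  have c0 : {for x, continuous psi0'}.
    have cid : {for x, continuous (fun z : R => z)} by exact: cvg_id.
    have ck (k : R) : {for x, continuous (fun=> k)} by exact: cvg_cst.
    have c1 : {for x, continuous (fun z : R => (1 + z) ^+ 2)}.
      by apply: (@continuous_comp _ _ _ (fun z : R => 1 + z) (fun z => z ^+ 2));
        [apply: cvgD; [exact: ck|exact: cid]|exact: exprn_continuous].
    apply: cvgM; last by apply: cvgV; [rewrite expf_neq0|exact: c1].
    apply: cvgM.
      apply: cvgM; first exact: cid.
      apply: cvgD; last by apply: cvgM; [exact: ck|exact: exprn_continuous].
      by apply: cvgD; [exact: ck|apply: cvgM; [exact: ck|exact: cid]].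
    by apply/differentiable_continuous/derivable1_diffP; have [] := dp x0.
  have E : \near x, psi0' x = psi' x.
    by near=> y; rewrite /psi' ifT//; near: y; exact: lt_nbhsr.
  rewrite /continuous_at {2}/psi' x0.
  exact: cvg_trans (near_eq_cvg E) c0.
- rewrite /continuous_at {2}/psi' (lt_gtF x0); apply: cvg_near_cst.
  by near=> y; rewrite /psi' ifF//; apply/lt_gtF; near: y; exact: lt_nbhsl.
- rewrite /continuous_at {2}/psi' ltxx; apply/cvgrPdist_lt => e e0.
  apply/nbhs_ballP; exists (e / 6) => /=; first by lra.
  move=> y; rewrite /ball/= !sub0r !normrN => ye.
  have [y0|y0] := ltP 0 y; last by rewrite /psi' (le_gtF y0) normr0.
  have [/andP[h1 h2] h3] := psi0'_bound y0.
  by rewrite /psi' y0 ger0_norm//; move: ye; rewrite gtr0_norm//; lra.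
Unshelve. all: by end_near. Qed.

Lemma Psi_ge0 z : 0 <= Psi z.
Proof.
rewrite /Psi; case: ifPn => // z0; rewrite mulr_ge0 ?exprn_ge0//; apply: ltW => //.
exact: p_gt0.
Qed.

Lemma Psi_gt0 z : 0 < z -> 0 < Psi z.
Proof. by move=> z0; rewrite /Psi z0 mulr_gt0 ?exprn_gt0// p_gt0. Qed.

Lemma psi_ge0 z : 0 <= psi z.
Proof. by rewrite /psi; case: ifPn => // /psi0_bound/andP[]. Qed.

Lemma psi_le z : 0 < z -> psi z <= 3 * z ^+ 2 * (1 + z) `^ (- alpha).
Proof. by move=> z0; rewrite /psi z0; have /andP[] := psi0_bound z0. Qed.

Lemma psi_nondecreasing x y : x <= y -> psi x <= psi y.
Proof.
rewrite le_eqVlt => /predU1P[->//|xy].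
have cpsi z : {for z, continuous psi}.
  by apply/differentiable_continuous/derivable1_diffP; have [] := is_derive_psi z.
have [z _ E] := @MVT R psi psi' x y xy (fun z _ => is_derive_psi z) (continuous_subspaceT cpsi).
rewrite -subr_ge0 E mulr_ge0 ?subr_ge0 ?(ltW xy)//.
by have /andP[] := psi'_bound z.
Qed.

Lemma Psi_convex x y : Psi y - Psi x <= psi y * (y - x).
Proof.
have cPsi z : {for z, continuous Psi}.
  by apply/differentiable_continuous/derivable1_diffP; have [] := is_derive_Psi z.
have [xy|yx|->] := ltgtP x y; last by rewrite !subrr mulr0.
  have [z] := @MVT R Psi psi x y xy (fun z _ => is_derive_Psi z) (continuous_subspaceT cPsi).
  rewrite in_itv/= => /andP[_ zy] ->; rewrite ler_wpM2r ?subr_ge0 ?(ltW xy)//.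
  exact/psi_nondecreasing/ltW.
have [z] := @MVT R Psi psi y x yx (fun z _ => is_derive_Psi z) (continuous_subspaceT cPsi).
rewrite in_itv/= => /andP[yz _] E.
rewrite -lerN2 opprB E -mulrN opprB ler_wpM2r ?subr_ge0 ?(ltW yx)//.
exact/psi_nondecreasing/ltW.
Qed.

(** Up to the common factor X^2, both sides are polynomials of degree 2 in z, compared coefficient
    by coefficient. The quadratic coefficient on the right carries a factor 2 - alpha, for which the
    constant compensates: this uses alpha < 2. *)
Lemma psi_sq_le z : psi z ^+ 2 <= 9 / (2 - alpha) * (psi' z * Psi z).
Proof.
rewrite /psi /psi' /Psi; case: ifPn => z0; last by rewrite expr0n/= !mulr0.
have /andP[a1 a2] := alpha12; have pz := p_gt0 z0.
have z1 : 0 < 1 + z by lra.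
pose X := z ^+ 2 * p z / (1 + z).
pose q := 6 + 6 * (2 - alpha) * z + (3 - alpha) * (2 - alpha) * z ^+ 2.
have -> : psi0 z ^+ 2 = X ^+ 2 * (3 + (3 - alpha) * z) ^+ 2 by rewrite /psi0 /X; ring.
have -> : psi0' z * Psi0 z = X ^+ 2 * q.
  by rewrite /psi0' /Psi0 /X /q; field; rewrite gt_eqF.
rewrite [leRHS]mulrCA ler_wpM2l ?sqr_ge0// [leRHS]mulrAC ler_pdivlMr; last by lra.
have h1 : 0 <= 2 - alpha <= 1 by lra.
have h2 : 0 <= (2 - alpha) * z by nra.
have h3 : 0 <= (2 - alpha) * z ^+ 2 by rewrite mulr_ge0 ?sqr_ge0//; lra.
have h4 : (2 - alpha) * ((3 - alpha) ^+ 2 * z ^+ 2) <= 9 * ((3 - alpha) * (2 - alpha) * z ^+ 2).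
  have -> : (2 - alpha) * ((3 - alpha) ^+ 2 * z ^+ 2) = ((2 - alpha) * z ^+ 2) * (3 - alpha) ^+ 2 by ring.
  have -> : 9 * ((3 - alpha) * (2 - alpha) * z ^+ 2) = ((2 - alpha) * z ^+ 2) * (9 * (3 - alpha)) by ring.
  by rewrite ler_wpM2l//; nra.
have h5 : (2 - alpha) * (6 * (3 - alpha) * z) <= 54 * ((2 - alpha) * z).
  by rewrite (_ : (2 - alpha) * (6 * (3 - alpha) * z) = (6 * (3 - alpha)) * ((2 - alpha) * z)); [rewrite ler_wpM2r//; lra|ring].
have -> : (3 + (3 - alpha) * z) ^+ 2 * (2 - alpha) =
  9 * (2 - alpha) + (2 - alpha) * (6 * (3 - alpha) * z) + (2 - alpha) * ((3 - alpha) ^+ 2 * z ^+ 2) by ring.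
rewrite /q; lra.
Qed.

End truncation.

(** * Truncation on both sides of the level *)

Section two_sided_truncation.
Context {R : realType}.
Implicit Types (x y z s r : R).
Variables (alpha m : R).
Hypothesis alpha12 : 1 <= alpha < 2.
Hypothesis m0 : 0 <= m.

Definition trPhi y : R := Psi alpha (y - m) + Psi alpha (- y - m).
Definition trphi y : R := psi alpha (y - m) - psi alpha (- y - m).
Definition trphi' y : R := psi' alpha (y - m) + psi' alpha (- y - m).

Lemma psi_le0 z : z <= 0 -> [/\ Psi alpha z = 0, psi alpha z = 0 & psi' alpha z = 0].
Proof. by move=> z0; rewrite /Psi /psi /psi' (le_gtF z0). Qed.

Lemma is_derive_trphi y : is_derive y 1 trphi (trphi' y).
Proof.
have d1 : is_derive y 1 (fun x : R => x - m) (1 - 0).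
  exact: (is_deriveB (is_derive_id y (1:R)) (is_derive_cst m y 1)).
have d2 : is_derive y 1 (fun x : R => - x - m) (- 1 - 0).
  exact: (is_deriveB (is_deriveN (is_derive_id y (1:R))) (is_derive_cst m y 1)).
have e1 := @is_derive1_comp R (psi alpha) _ y _ _ (is_derive_psi alpha12 (y - m)) d1.
have e2 := @is_derive1_comp R (psi alpha) _ y _ _ (is_derive_psi alpha12 (- y - m)) d2.
by apply: is_derive_eq (is_deriveB e1 e2) _; rewrite /trphi'; ring.
Qed.

Lemma continuous_trphi' : continuous trphi'.
Proof.
move=> y; apply: cvgD.
  apply: (@continuous_comp _ _ _ (fun x : R => x - m) (psi' alpha)); last exact: continuous_psi'.
  by apply: cvgB; [exact: cvg_id|exact: cvg_cst].
apply: (@continuous_comp _ _ _ (fun x : R => - x - m) (psi' alpha)); last exact: continuous_psi'.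
by apply: cvgB; [apply: cvgN; exact: cvg_id|exact: cvg_cst].
Qed.

Lemma continuous_trPhi : continuous trPhi.
Proof.
have cP : continuous (Psi alpha).
  by move=> z; apply/differentiable_continuous/derivable1_diffP; have [] := is_derive_Psi alpha12 z.
move=> y; apply: cvgD.
  apply: (@continuous_comp _ _ _ (fun x : R => x - m) (Psi alpha)); last exact: cP.
  by apply: cvgB; [exact: cvg_id|exact: cvg_cst].
apply: (@continuous_comp _ _ _ (fun x : R => - x - m) (Psi alpha)); last exact: cP.
by apply: cvgB; [apply: cvgN; exact: cvg_id|exact: cvg_cst].
Qed.

(** As m >= 0, at most one of the two one-sided terms is nonzero at a given point. *)
Variant trunc_spec y : R -> R -> R -> Prop :=
| TruncPos of m < y : trunc_spec y (Psi alpha (y - m)) (psi alpha (y - m)) (psi' alpha (y - m))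
| TruncMid of `|y| <= m : trunc_spec y 0 0 0
| TruncNeg of y < - m :
    trunc_spec y (Psi alpha (- y - m)) (- psi alpha (- y - m)) (psi' alpha (- y - m)).

Lemma truncP y : trunc_spec y (trPhi y) (trphi y) (trphi' y).
Proof.
rewrite /trPhi /trphi /trphi'; have hm := m0; have [my|ym] := ltP m y.
  have [-> -> ->] : [/\ Psi alpha (- y - m) = 0, psi alpha (- y - m) = 0 & psi' alpha (- y - m) = 0].
    by apply: psi_le0; lra.
  by rewrite !addr0 subr0; exact: TruncPos.
have [-> -> ->] : [/\ Psi alpha (y - m) = 0, psi alpha (y - m) = 0 & psi' alpha (y - m) = 0].
  by apply: psi_le0; lra.
rewrite !add0r; have [ymm|mym] := ltP y (- m); first exact: TruncNeg.
have [-> -> ->] : [/\ Psi alpha (- y - m) = 0, psi alpha (- y - m) = 0 & psi' alpha (- y - m) = 0].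
  by apply: psi_le0; lra.
by rewrite oppr0; apply: TruncMid; rewrite ler_norml mym.
Qed.

Lemma trphi'_bound y : 0 <= trphi' y <= 6.
Proof.
by case: truncP => _; [exact: psi'_bound|rewrite lexx/=; lra|exact: psi'_bound].
Qed.

Lemma trPhi_ge0 y : 0 <= trPhi y.
Proof. by apply: addr_ge0; exact: Psi_ge0. Qed.

Lemma trPhi_eq0 y : (trPhi y == 0) = (`|y| <= m).
Proof.
case: truncP => [my|->|ym]; last 2 first.
- by rewrite eqxx.
- rewrite gt_eqF ?Psi_gt0//; last lra.
  by apply/esym/negbTE; rewrite -ltNge lter_normr; apply/orP; right; lra.
rewrite gt_eqF ?Psi_gt0//; last lra.
by apply/esym/negbTE; rewrite -ltNge lter_normr my.
Qed.

Lemma trphi_mid y : `|y| <= m -> trphi y = 0.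
Proof. by rewrite ler_norml => /andP[h1 h2]; case: truncP => // *; lra. Qed.

Lemma trPhi_convex x y : trPhi y - trPhi x <= trphi y * (y - x).
Proof.
have := Psi_convex alpha12 (x - m) (y - m); have := Psi_convex alpha12 (- x - m) (- y - m).
rewrite /trPhi /trphi mulrBl.
have -> : - y - m - (- x - m) = - (y - x) by ring.
have -> : y - m - (x - m) = y - x by ring.
rewrite mulrN; lra.
Qed.

Lemma trphi_sq_le y : trphi y ^+ 2 <= 9 / (2 - alpha) * (trphi' y * trPhi y).
Proof.
case: truncP => _; first exact: psi_sq_le.
  by rewrite expr0n/= !mulr0.
by rewrite sqrrN; exact: psi_sq_le.
Qed.

Lemma trphi_sign y : 0 <= y * trphi y.
Proof.
have hm := m0.
case: truncP => [my|_|ym]; last 2 first.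
- by rewrite mulr0.
- by rewrite mulrN -mulNr mulr_ge0 ?psi_ge0//; lra.
by rewrite mulr_ge0 ?psi_ge0//; lra.
Qed.

(** The bound depends only on how far y exceeds the level; its factor (1 + d)^(-alpha) is meant to
    cancel the growth of f in [growth_le]. *)
Lemma trphi_le y d : `|y| - m <= d -> 0 < d ->
  `|trphi y| <= 3 * d ^+ 2 * (1 + d) `^ (- alpha).
Proof.
move=> yd d0; apply: le_trans (psi_le alpha12 d0).
case: truncP => [my|_|ym].
- rewrite ger0_norm ?psi_ge0//; apply: psi_nondecreasing => //.
  by apply: le_trans yd; rewrite lerB// ler_norm.
- by rewrite normr0 psi_ge0.
- rewrite normrN ger0_norm ?psi_ge0//; apply: psi_nondecreasing => //.
  by apply: le_trans yd; rewrite lerB// -normrN ler_norm.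
Qed.

Variables (f : R -> R) (C2 p : R).
Hypothesis cf : continuous f.
Hypothesis C20 : 0 <= C2.
Hypothesis p1 : 1 <= p.
Hypothesis palpha : p - 1 <= alpha.
Hypothesis growth : forall s, `|f s| <= C2 * (1 + `|s| `^ (p - 1)).
Hypothesis sign : forall s, m <= `|s| -> 0 <= s * f s.

(** Both 1 and |s|^(p - 1) are at most ((1 + m)(1 + d))^alpha, because p - 1 <= alpha and |s| <= m +
    d <= (1 + m)(1 + d). Multiplied by [trphi_le], the powers of 1 + d disappear and d^2 remains. *)
Lemma growth_le s d : 0 <= d -> `|s| <= m + d -> `|f s| <= 2 * C2 * (1 + m) `^ alpha * (1 + d) `^ alpha.
Proof.
have hm := m0; have ha := palpha; have hp := p1.
move=> d0 sd; apply: le_trans (growth s) _.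
have a0 : 0 <= alpha by case/andP : alpha12; lra.
rewrite -!mulrA mulrCA ler_wpM2l// -powRM; [|lra|lra].
have h1 : 1 <= (1 + m) * (1 + d) by nra.
have h2 : `|s| <= (1 + m) * (1 + d) by nra.
have h3 : 1 <= ((1 + m) * (1 + d)) `^ alpha.
  by rewrite -[leLHS](powRr0 ((1 + m) * (1 + d))); apply: ler_powR.
have h4 : `|s| `^ (p - 1) <= ((1 + m) * (1 + d)) `^ alpha.
  apply: (@le_trans _ _ (((1 + m) * (1 + d)) `^ (p - 1))); last exact: ler_powR.
  by apply: ge0_ler_powR; rewrite ?nnegrE//; lra.
lra.
Qed.

Lemma f_trphi_abs s r : `|f s * trphi r| <= 6 * C2 * (1 + m) `^ alpha * (1 + (`|s| + `|r|)) ^+ 2.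
Proof.
have hm := m0; have ha := palpha; have hp := p1.
pose d := 1 + (`|s| + `|r|).
have ns := normr_ge0 s; have nr := normr_ge0 r.
have d0 : 0 < d by rewrite /d; lra.
have h1 : `|trphi r| <= 3 * d ^+ 2 * (1 + d) `^ (- alpha) by apply: trphi_le => //; rewrite /d; lra.
have h2 : `|f s| <= 2 * C2 * (1 + m) `^ alpha * (1 + d) `^ alpha.
  by apply: growth_le; rewrite /d; lra.
rewrite normrM; apply: le_trans (ler_pM _ _ h2 h1) _ => //.
rewrite -/d powRN.
have q0 : 0 < (1 + d) `^ alpha by apply: powR_gt0; lra.
rewrite le_eqVlt; apply/orP; left; apply/eqP; field.
by rewrite gt_eqF.
Qed.

Let f_ge0 s : m < s -> 0 <= f s.
Proof.
have hm := m0.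
move=> ms; have s0 : 0 < s by lra.
have := sign (s := s); rewrite (gtr0_norm s0) (ltW ms) => /(_ isT).
by rewrite pmulr_rge0.
Qed.

Let f_le0 s : s < - m -> f s <= 0.
Proof.
have hm := m0.
move=> ms; have s0 : s < 0 by lra.
have := sign (s := s); rewrite (ltr0_norm s0) => /(_ ltac:(lra)).
by rewrite nmulr_rge0.
Qed.

(** When s is beyond the level on the same side as r, the two factors have the same sign. Otherwise,
    if |r| > m, the excess of both |r| and |s| over m is at most d = |s - r|, and [growth_le] and
    [trphi_le] with this d bound the product by a multiple of d^2. *)
Lemma f_trphi_lower s r :
  - (6 * C2 * (1 + m) `^ alpha * (s - r) ^+ 2) <= f s * trphi r.
Proof.
have hm := m0; have ha := palpha; have hp := p1.
set K := 6 * C2 * (1 + m) `^ alpha.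
have K0 : 0 <= K by rewrite /K !mulr_ge0 ?powR_ge0.
have neg : - (K * (s - r) ^+ 2) <= 0 by rewrite oppr_le0 mulr_ge0 ?sqr_ge0.
have key d : 0 < d -> `|s| <= m + d -> `|r| - m <= d -> d ^+ 2 = (s - r) ^+ 2 ->
    - (K * (s - r) ^+ 2) <= f s * trphi r.
  move=> d0 sd rd <-.
  suff : `|f s * trphi r| <= K * d ^+ 2 by rewrite ler_norml => /andP[].
  rewrite normrM; apply: le_trans (ler_pM _ _ (growth_le (ltW d0) sd) (trphi_le rd d0)) _ => //.
  rewrite powRN /K.
  have q0 : 0 < (1 + d) `^ alpha by apply: powR_gt0; lra.
  rewrite le_eqVlt; apply/orP; left; apply/eqP; field.
  by rewrite gt_eqF.
have [rm|rm] := leP `|r| m; first by rewrite trphi_mid// mulr0.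
have [r0|r0] := ltP r 0.
  have rm' : r < - m by move: rm; rewrite ltr0_norm//; lra.
  have [sm|sm] := ltP s (- m).
    apply: le_trans neg _; apply: mulr_le0; first exact: f_le0.
    by have := trphi_sign r; rewrite nmulr_rge0.
  apply: (key (s - r)); [lra| | |by []].
    by rewrite ler_norml; apply/andP; split; lra.
  by rewrite ltr0_norm//; lra.
have rm' : m < r by move: rm; rewrite ger0_norm.
have [sm|sm] := ltP m s.
  apply: le_trans neg _; apply: mulr_ge0; first exact: f_ge0.
  by have := trphi_sign r; rewrite pmulr_rge0//; lra.
apply: (key (r - s)); [lra| | |by rewrite -sqrrN opprB].
  by rewrite ler_norml; apply/andP; split; lra.
by rewrite ger0_norm//; lra.
Qed.

End two_sided_truncation.

(** * Energy estimate at fixed times *)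

Section energy_bound.
Context {R : realType}.
Local Notation mu := (@lebesgue_measure R).
Local Notation I01 := (`]0%R, 1%R[%classic : set R).
Implicit Types (c s t x y k : R) (u v g h w W U V : R -> R).

(* phi = Phi' is the nonlinearity used as a test function. [td_sq] lets the
   diffusion absorb the drift term. In [td_lower], the sign of s f(s) for |s| >= m makes
   f s * phi r nonnegative unless |r| - m <= |s - r|, and phi r is quadratically small
   in |r| - m. *)
Record truncation_data (f phi phi' Phi : R -> R) (m Cs Kf : R) : Prop := {
  td_cf : continuous f;
  td_dphi : forall x, is_derive x 1 phi (phi' x);
  td_cphi' : continuous phi';
  td_phi'_bound : forall x, 0 <= phi' x <= 6;
  td_cPhi : continuous Phi;
  td_Phi_ge0 : forall x, 0 <= Phi x;
  td_Phi_eq0 : forall x, (Phi x == 0) = (`|x| <= m);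
  td_mid : forall x, `|x| <= m -> phi x = 0;
  td_m : 0 <= m;
  td_convex : forall x y, Phi y - Phi x <= phi y * (y - x);
  td_Cs : 0 <= Cs;
  td_Kf : 0 <= Kf;
  td_sq : forall x, phi x ^+ 2 <= Cs * (phi' x * Phi x);
  td_sign : forall x, 0 <= x * phi x;
  td_lower : forall s r, - (Kf * (s - r) ^+ 2) <= f s * phi r;
  td_abs : forall s r, `|f s * phi r| <= Kf * (1 + (`|s| + `|r|)) ^+ 2 }.

Lemma truncation_data_exists (f : R -> R) (m C2 p : R) : 0 <= m -> continuous f ->
  0 <= C2 -> 1 < p < 3 -> (forall s, `|f s| <= C2 * (1 + `|s| `^ (p - 1))) ->
  (forall s, m <= `|s| -> 0 <= s * f s) ->
  exists phi phi' Phi Cs Kf, truncation_data f phi phi' Phi m Cs Kf.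
Proof.
move=> m0 cf C20 /andP[p1 p3] fg fs.
pose alpha := (p + 1) / 2.
have a12 : 1 <= alpha < 2 by rewrite /alpha; apply/andP; split; lra.
have pa : p - 1 <= alpha by rewrite /alpha; lra.
have p1' : 1 <= p by lra.
exists (trphi alpha m), (trphi' alpha m), (trPhi alpha m), (9 / (2 - alpha)), (6 * C2 * (1 + m) `^ alpha).
split.
- exact: cf.
- exact: is_derive_trphi.
- exact: continuous_trphi'.
- exact: trphi'_bound.
- exact: continuous_trPhi.
- exact: trPhi_ge0.
- exact: trPhi_eq0.
- exact: trphi_mid.
- exact: m0.
- exact: trPhi_convex.
- by rewrite divr_ge0//; lra.
- by rewrite !mulr_ge0 ?powR_ge0.
- exact: trphi_sq_le.
- exact: trphi_sign.
- exact: (f_trphi_lower a12 m0 C20 p1' pa fg fs).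
- exact: (f_trphi_abs a12 m0 C20 p1' pa fg).
Qed.

Lemma young eta x y : 0 < eta -> `|x * y| <= (eta^-1 * x ^+ 2 + eta * y ^+ 2) / 2.
Proof.
move=> e0; have ee : eta^-1 * eta = 1 by rewrite mulVf// gt_eqF.
have i0 : 0 <= eta^-1 by rewrite invr_ge0 ltW.
have h1 : 0 <= eta^-1 * (x - eta * y) ^+ 2 by rewrite mulr_ge0// sqr_ge0.
have h2 : 0 <= eta^-1 * (x + eta * y) ^+ 2 by rewrite mulr_ge0// sqr_ge0.
have E1 : eta^-1 * (x - eta * y) ^+ 2 =
  eta^-1 * x ^+ 2 - 2 * (eta^-1 * eta) * (x * y) + (eta^-1 * eta) * (eta * y ^+ 2) by ring.
have E2 : eta^-1 * (x + eta * y) ^+ 2 =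
  eta^-1 * x ^+ 2 + 2 * (eta^-1 * eta) * (x * y) + (eta^-1 * eta) * (eta * y ^+ 2) by ring.
rewrite E1 ee in h1; rewrite E2 ee in h2.
by rewrite ler_norml; apply/andP; split; lra.
Qed.

Lemma mean_bound x y z : 0 <= y -> 0 <= z -> x ^+ 2 <= y * z -> `|x| <= y + z.
Proof.
move=> y0 z0 h; have yz : 0 <= y + z by rewrite addr_ge0.
rewrite -(ler_pXn2r (n := 2)) ?nnegrE// real_normK ?num_real//.
apply: le_trans h _; have : 0 <= y * z by rewrite mulr_ge0.
have := sqr_ge0 y; have := sqr_ge0 z; rewrite !expr2; nra.
Qed.

(** Writing ux = vx + dx, the products containing dx are errors split by [young] (T1, T2; 3 is half
    the bound 6 on phi'), the remaining drift term is absorbed by the diffusion (T3), and the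
    reaction is bounded from below (T4). *)
Lemma pointwise_energy_bound f phi phi' Phi m Cs Kf (a a0 A r r0 eta : R) (x u v ux vx : R) :
  truncation_data f phi phi' Phi m Cs Kf ->
  0 < a0 -> a0 <= a <= A -> `|r| <= r0 -> 0 < eta <= 1 -> 0 < x < 1 ->
  `|phi v| <= 6 * `|v| ->
  - (a * (ux * (phi' v * vx)) - r * (x * (ux * phi v)) + f u * phi v) <=
  r0 ^+ 2 * Cs / a0 * Phi v + (3 * A + 3 * r0 + Kf) / eta * ((u - v) ^+ 2 + (ux - vx) ^+ 2)
  + (3 * A + 3 * r0) * eta * (v ^+ 2 + vx ^+ 2).
Proof.
move=> td a00 /andP[a1 a2] rr /andP[e0 e1] /andP[x0 x1] pv.
have r00 : 0 <= r0 by apply: le_trans rr; exact: normr_ge0.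
have A0 : 0 <= A := le_trans (ltW a00) (le_trans a1 a2).
have /andP[p0 p6] := td_phi'_bound td v.
have Ph0 := td_Phi_ge0 td v.
set dx := ux - vx; set d := u - v.
have -> : ux = vx + dx by rewrite /dx; ring.
have T1 : - (a * (dx * (phi' v * vx))) <= 3 * A * (eta^-1 * dx ^+ 2 + eta * vx ^+ 2).
  have h1 := young dx vx e0.
  have h2 : `|a * (dx * (phi' v * vx))| <= A * 6 * `|dx * vx|.
    rewrite (_ : a * (dx * (phi' v * vx)) = (a * phi' v) * (dx * vx)); last by ring.
    rewrite normrM ler_wpM2r// ger0_norm; last by rewrite mulr_ge0//; lra.
    by rewrite ler_pM//; lra.
  have h3 : A * 6 * `|dx * vx| <= A * 6 * ((eta^-1 * dx ^+ 2 + eta * vx ^+ 2) / 2).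
    by rewrite ler_wpM2l// mulr_ge0.
  move: h2; rewrite ler_norml => /andP[h2 _]; lra.
have T2 : r * (x * (dx * phi v)) <= 3 * r0 * (eta^-1 * dx ^+ 2 + eta * v ^+ 2).
  have h1 := young dx v e0.
  have h2 : `|r * (x * (dx * phi v))| <= r0 * 6 * `|dx * v|.
    rewrite (_ : r * (x * (dx * phi v)) = (r * x) * (dx * phi v)); last by ring.
    rewrite normrM (_ : r0 * 6 * `|dx * v| = r0 * (6 * `|dx * v|)); last by ring.
    apply: ler_pM => //.
      by rewrite normrM -[leRHS]mulr1; apply: ler_pM; rewrite ?normr_ge0// gtr0_norm// ltW.
    by rewrite !normrM mulrCA ler_wpM2l.
  have h3 : r0 * 6 * `|dx * v| <= r0 * 6 * ((eta^-1 * dx ^+ 2 + eta * v ^+ 2) / 2).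
    by rewrite ler_wpM2l// mulr_ge0.
  have := ler_norm (r * (x * (dx * phi v))); lra.
have T3 : r * (x * (vx * phi v)) <= a * (vx * (phi' v * vx)) + r0 ^+ 2 * Cs / a0 * Phi v.
  have h0 : `|r * x| <= r0.
    by rewrite normrM -[leRHS]mulr1; apply: ler_pM; rewrite ?normr_ge0// gtr0_norm// ltW.
  (* The weights [a0] and 1 / a0 cancel in the product of the two terms, leaving r0^2 vx^2 Cs phi'
     Phi, which dominates the square of the left-hand side by [td_sq]. *)
  have h1 : `|r * (x * (vx * phi v))| <= a0 * (phi' v * vx ^+ 2) + r0 ^+ 2 * Cs / a0 * Phi v.
    apply: mean_bound.
    - by apply: mulr_ge0; [exact: ltW|rewrite mulr_ge0// sqr_ge0].
    - by rewrite mulr_ge0// divr_ge0 ?(ltW a00)// mulr_ge0 ?sqr_ge0//; exact: td_Cs td.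
    have -> : a0 * (phi' v * vx ^+ 2) * (r0 ^+ 2 * Cs / a0 * Phi v) =
        (a0 * a0^-1) * ((r0 ^+ 2 * vx ^+ 2) * (Cs * (phi' v * Phi v))) by ring.
    rewrite divff ?gt_eqF// mul1r.
    have -> : (r * (x * (vx * phi v))) ^+ 2 = ((r * x) ^+ 2 * vx ^+ 2) * phi v ^+ 2 by ring.
    apply: ler_pM; [by apply: mulr_ge0; exact: sqr_ge0|exact: sqr_ge0| |exact: td_sq td _].
    rewrite ler_wpM2r ?sqr_ge0// -real_normK ?num_real//.
    by rewrite ler_pXn2r ?nnegrE.
  have h2 : a0 * (phi' v * vx ^+ 2) <= a * (vx * (phi' v * vx)).
    rewrite (_ : a * (vx * (phi' v * vx)) = a * (phi' v * vx ^+ 2)); last by ring.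
    by rewrite ler_wpM2r// mulr_ge0// sqr_ge0.
  have := ler_norm (r * (x * (vx * phi v))); lra.
have T4 : - (f u * phi v) <= Kf * (eta^-1 * d ^+ 2).
  have := td_lower td u v; rewrite -/d => h1.
  have : d ^+ 2 <= eta^-1 * d ^+ 2 by rewrite ler_peMl ?sqr_ge0// invf_ge1.
  move=> /(ler_wpM2l (td_Kf td)); lra.
have i0 : 0 <= eta^-1 by rewrite invr_ge0 ltW.
have A3 : 0 <= 3 * A by rewrite mulr_ge0.
have r3 : 0 <= 3 * r0 by rewrite mulr_ge0.
have Q (k l z : R) : 0 <= k -> 0 <= l -> 0 <= k * (l * z ^+ 2).
  by move=> k0 l0; apply: mulr_ge0 => //; apply: mulr_ge0 => //; exact: sqr_ge0.
have P1 := Q _ _ d A3 i0; have P2 := Q _ _ d r3 i0.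
have P3 := Q _ _ dx (td_Kf td) i0.
have P4 := Q _ _ v A3 (ltW e0); have P5 := Q _ _ vx r3 (ltW e0).
have -> : (3 * A + 3 * r0 + Kf) / eta * (d ^+ 2 + dx ^+ 2) =
  3 * A * (eta^-1 * d ^+ 2) + 3 * r0 * (eta^-1 * d ^+ 2) + Kf * (eta^-1 * d ^+ 2) +
  (3 * A * (eta^-1 * dx ^+ 2) + 3 * r0 * (eta^-1 * dx ^+ 2) + Kf * (eta^-1 * dx ^+ 2)) by ring.
have -> : (3 * A + 3 * r0) * eta * (v ^+ 2 + vx ^+ 2) =
  3 * A * (eta * v ^+ 2) + 3 * r0 * (eta * v ^+ 2) + (3 * A * (eta * vx ^+ 2) + 3 * r0 * (eta * vx ^+ 2)) by ring.
have -> : - (a * ((vx + dx) * (phi' v * vx)) - r * (x * ((vx + dx) * phi v)) + f u * phi v) =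
  - (a * (vx * (phi' v * vx))) - a * (dx * (phi' v * vx)) + r * (x * (vx * phi v)) +
  r * (x * (dx * phi v)) - f u * phi v by ring.
lra.
Qed.

End energy_bound.

Section integrated_energy_bound.
Context {R : realType}.
Local Notation mu := (@lebesgue_measure R).
Local Notation I01 := (`]0%R, 1%R[%classic : set R).
Implicit Types (c s t x y k : R) (u v g h w W U V : R -> R).

Lemma inH_cst k : inH (cst k : R -> R).
Proof.
apply: (@integrable_inH R _ (cst (k ^+ 2)) (measurable_cst _) (integrable_cst_oo _ _ _)).
move=> x /andP[x0 x1] /=; rewrite -[leRHS]mul1r ler_wpM2r ?sqr_ge0//.
by rewrite expr_le1 ?ltW.
Qed.

Variables (f phi phi' Phi : R -> R) (m Cs Kf : R).
Hypothesis td : truncation_data f phi phi' Phi m Cs Kf.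

Lemma td_cphi : continuous phi.
Proof. by move=> x; apply/differentiable_continuous/derivable1_diffP; have [] := td_dphi td x. Qed.

Lemma td_phi'_norm x : `|phi' x| <= 6.
Proof. by have /andP[h1 h2] := td_phi'_bound td x; rewrite ger0_norm. Qed.

Lemma td_phi0 : phi 0 = 0.
Proof. by apply: (td_mid td); rewrite normr0; exact: td_m td. Qed.

Lemma td_phi_le x : `|phi x| <= 6 * `|x|.
Proof.
have := bounded_derive_lipschitz (td_dphi td) td_phi'_norm x 0.
by rewrite td_phi0 !subr0.
Qed.

Lemma td_inV V : inV V -> [/\ inV (phi \o V),
    {ae mu, forall x, 0 < x < 1 -> wderiv (phi \o V) x = phi' (V x) * wderiv V x} &
    trace1 (phi \o V) = phi (trace1 V)].
Proof.
by move=> VV; exact: (inV_comp VV (td_dphi td) (td_cphi' td) td_phi'_norm td_phi0).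
Qed.

Lemma td_Phi_le x : Phi x <= 6 * x ^+ 2.
Proof.
have := td_convex td 0 x; rewrite subr0.
have /eqP -> : Phi 0 == 0 by rewrite (td_Phi_eq0 td) normr0; exact: td_m td.
rewrite subr0 => h; apply: le_trans h _; apply: le_trans (ler_norm _) _.
by rewrite normrM -real_normK ?num_real// expr2 mulrA ler_wpM2r// td_phi_le.
Qed.

Lemma Phi_integrable V : inH V -> mu.-integrable I01 (EFin \o (fun x => x ^+ 2 * Phi (V x))).
Proof.
move=> hV; have mV := inH_measurable hV.
have i6 : mu.-integrable I01 (EFin \o (fun x => 6 * (x ^+ 2 * V x ^+ 2))).
  exact: (integrableZl _ 6 (inH_sq_integrable hV)).
apply: le_integrable_R i6 => //.
  apply: measurable_funM; first exact: measurable_funX.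
  by apply: measurableT_comp mV; apply: continuous_measurable_fun; exact: td_cPhi td.
move=> x _; rewrite ger0_norm; last by apply: mulr_ge0; [exact: sqr_ge0|exact: td_Phi_ge0 td _].
by rewrite (mulrCA 6) ler_wpM2l ?sqr_ge0// td_Phi_le.
Qed.

Definition truncation_energy V : R := \int[mu]_(x in `]0, 1[) (x ^+ 2 * Phi (V x)).

Lemma reaction_integrable U V : inH U -> inH V ->
  mu.-integrable I01 (EFin \o (fun x => x ^+ 2 * (f \o U) x * (phi \o V) x)).
Proof.
move=> hU hV; have mU := inH_measurable hU; have mV := inH_measurable hV.
have j1 := inH_sq_integrable (inH_cst 1).
have j2 := inH_sq_integrable hU; have j3 := inH_sq_integrable hV.
have j4 : mu.-integrable I01 (EFin \o (fun x => 3 * Kf * (x ^+ 2 * cst 1 x ^+ 2 +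
    (x ^+ 2 * U x ^+ 2 + x ^+ 2 * V x ^+ 2)))).
  exact: (integrableZl _ (3 * Kf) (integrableD _ j1 (integrableD _ j2 j3))).
apply: le_integrable_R j4 => //.
  apply: measurable_weight.
    by apply: measurableT_comp mU; apply: continuous_measurable_fun; exact: td_cf td.
  by apply: measurableT_comp mV; apply: continuous_measurable_fun; exact: td_cphi.
move=> x _ /=; rewrite -mulrA normrM ger0_norm ?sqr_ge0// -!mulrDr mulrCA.
rewrite ler_wpM2l ?sqr_ge0//; apply: le_trans (td_abs td _ _) _.
rewrite mulrAC [leRHS]mulrC ler_wpM2l//; first exact: td_Kf td.
rewrite -(real_normK (num_real (U x))) -(real_normK (num_real (V x))).
have := sqr_ge0 (1 - `|U x|); have := sqr_ge0 (1 - `|V x|).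
have := sqr_ge0 (`|U x| - `|V x|); rewrite !expr2; nra.
Qed.

(** The pointwise bound integrated with weight x^2, the factor x^3 of the drift being x^2 times the
    x of that bound. Only the boundary term is new: trace1 U = trace1 V + trace1 (U - V), and the
    part with trace1 V has a sign. *)
Lemma energy_bound (a a0 A k K0 r r0 eta : R) U V : inV U -> inV V ->
  0 < a0 -> a0 <= a <= A -> 0 <= k <= K0 -> `|r| <= r0 -> 0 < eta <= 1 ->
  - (a * \int[mu]_(x in `]0, 1[) (x ^+ 2 * wderiv U x * wderiv (phi \o V) x)
     + a * k * trace1 U * trace1 (phi \o V)
     - r * \int[mu]_(x in `]0, 1[) (x ^+ 3 * wderiv U x * (phi \o V) x)
     + ip (f \o U) (phi \o V)) <=
  r0 ^+ 2 * Cs / a0 * truncation_energy V +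
  (3 * A + 3 * r0 + Kf + 48 * A * K0) / eta * sqn1 (U \- V) +
  (3 * A + 3 * r0 + 48 * A * K0) * eta * sqn1 V.
Proof.
move=> UV VV a00 aA /andP[k0 kK] rr e01.
have [hU _] := UV; have [hV _] := VV.
have hUx := inH_wderiv UV; have hVx := inH_wderiv VV.
have [pV pVx trp] := td_inV VV; have [hpV _] := pV; have hpVx := inH_wderiv pV.
have DV := inV_sub UV VV; have [hD _] := DV; have hDx := inH_wderiv DV.
have /andP[e0 e1] := e01.
have /andP[a1 a2] := aA.
have A0 : 0 <= A := le_trans (ltW a00) (le_trans a1 a2).
have K00 : 0 <= K0 := le_trans k0 kK.
set c1 := r0 ^+ 2 * Cs / a0.
set tr := a * k * trace1 U * trace1 (phi \o V).
(* 48 = 6 * 16 / 2: the Lipschitz constant of [phi], the constant of [trace1_bound], and the half in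
   [young]. *)
have trace_part : - tr <= 48 * A * K0 / eta * sqn1 (U \- V) + 48 * A * K0 * eta * sqn1 V.
  rewrite /tr trp; set tV := trace1 V; set tD := trace1 (U \- V).
  have -> : trace1 U = tV + tD by rewrite /tD trace1B// addrC subrK.
  have s1 : 0 <= a * k * (tV * phi tV).
    by apply: mulr_ge0; [apply: mulr_ge0 => //; lra|exact: td_sign td _].
  have h2 : `|a * k * (tD * phi tV)| <= A * K0 * 6 * `|tD * tV|.
    rewrite normrM (_ : A * K0 * 6 * `|tD * tV| = (A * K0) * (6 * `|tD * tV|)); last by ring.
    apply: ler_pM => //.
      by rewrite ger0_norm; [apply: ler_pM => //; lra|apply: mulr_ge0 => //; lra].
    by rewrite !normrM mulrCA ler_wpM2l// td_phi_le.
  have h3 := young tD tV e0.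
  have AK : 0 <= A * K0 * 6 by rewrite !mulr_ge0.
  have h4 := ler_wpM2l AK h3.
  have b1 := trace1_bound DV; have b2 := trace1_bound VV.
  have i0 : 0 <= eta^-1 by rewrite invr_ge0 ltW.
  have h5 := ler_wpM2l i0 b1; have h6 := ler_wpM2l (ltW e0) b2.
  rewrite -/tD in h5; rewrite -/tV in h6.
  have h7 := ler_wpM2l AK (lerD h5 h6).
  have h8 := ler_norm (- (a * k * (tD * phi tV))); rewrite normrN in h8.
  move: (sqn1 (U \- V)) (sqn1 V) h7 => q1 q2 h7.
  have E1 : 48 * A * K0 / eta * q1 + 48 * A * K0 * eta * q2 =
    A * K0 * 6 * (eta^-1 * (16 * q1) + eta * (16 * q2)) / 2.
    by field; rewrite gt_eqF.
  have E2 : - (a * k * (tV + tD) * phi tV) = - (a * k * (tV * phi tV)) + - (a * k * (tD * phi tV)) by ring.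
  rewrite E1 E2.
  have arith (S T nT k1 Y W Z : R) : 0 <= S -> nT <= k1 * Y -> k1 * Y <= k1 * (W / 2) ->
    k1 * W <= k1 * Z -> - T <= nT -> - S + - T <= k1 * Z / 2 by clear; lra.
  exact: arith s1 h2 h4 h7 h8.
have i1 := inH_ip_integrable hUx hpVx.
have i2 : mu.-integrable I01 (EFin \o (fun x => x ^+ 3 * wderiv U x * (phi \o V) x)).
  have -> : EFin \o (fun x => x ^+ 3 * wderiv U x * (phi \o V) x) =
      EFin \o (fun x => (x ^+ 2 * wderiv U x * (phi \o V) x) * x).
    apply/funext => x /=; congr EFin; ring.
  apply: (@integrable_mul_bounded R _ _ (fun x => x) 1) => //; first exact: inH_ip_integrable.
  by move=> x; rewrite /= in_itv/= => /andP[x0 x1]; rewrite gtr0_norm// ltW.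
have i3 := reaction_integrable hU hV.
have i1' : mu.-integrable I01 (EFin \o (fun x => a * (x ^+ 2 * wderiv U x * wderiv (phi \o V) x))).
  exact: (integrableZl _ a i1).
have i2' : mu.-integrable I01 (EFin \o (fun x => r * (x ^+ 3 * wderiv U x * (phi \o V) x))).
  exact: (integrableZl _ r i2).
have iB : mu.-integrable I01 (EFin \o (fun x => a * (x ^+ 2 * wderiv U x * wderiv (phi \o V) x) -
   r * (x ^+ 3 * wderiv U x * (phi \o V) x))).
  exact: (integrableB _ i1' i2').
have iJ : mu.-integrable I01 (EFin \o (fun x => a * (x ^+ 2 * wderiv U x * wderiv (phi \o V) x) -
   r * (x ^+ 3 * wderiv U x * (phi \o V) x) + x ^+ 2 * (f \o U) x * (phi \o V) x)).
  exact: (integrableD _ iB i3).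
pose d2 := (3 * A + 3 * r0 + Kf) / eta; pose d3 := (3 * A + 3 * r0) * eta.
have p1 : mu.-integrable I01 (EFin \o (fun x => c1 * (x ^+ 2 * Phi (V x)))).
  exact: (integrableZl _ c1 (Phi_integrable hV)).
have jD := inH_ip_integrable hD hD; have jDx := inH_ip_integrable hDx hDx.
have jV := inH_ip_integrable hV hV; have jVx := inH_ip_integrable hVx hVx.
have p2 : mu.-integrable I01 (EFin \o (fun x => d2 * (x ^+ 2 * (U \- V) x * (U \- V) x +
    x ^+ 2 * wderiv (U \- V) x * wderiv (U \- V) x))).
  exact: (integrableZl _ d2 (integrableD _ jD jDx)).
have p3 : mu.-integrable I01 (EFin \o (fun x => d3 * (x ^+ 2 * V x * V x +
    x ^+ 2 * wderiv V x * wderiv V x))).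
  exact: (integrableZl _ d3 (integrableD _ jV jVx)).
have p12 : mu.-integrable I01 (EFin \o (fun x => c1 * (x ^+ 2 * Phi (V x)) +
    d2 * (x ^+ 2 * (U \- V) x * (U \- V) x + x ^+ 2 * wderiv (U \- V) x * wderiv (U \- V) x))).
  exact: (integrableD _ p1 p2).
have p123 : mu.-integrable I01 (EFin \o (fun x => c1 * (x ^+ 2 * Phi (V x)) +
    d2 * (x ^+ 2 * (U \- V) x * (U \- V) x + x ^+ 2 * wderiv (U \- V) x * wderiv (U \- V) x) +
    d3 * (x ^+ 2 * V x * V x + x ^+ 2 * wderiv V x * wderiv V x))).
  exact: (integrableD _ p12 p3).
have iJN : mu.-integrable I01 (EFin \o (fun x => -1 * (a * (x ^+ 2 * wderiv U x * wderiv (phi \o V) x) -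
   r * (x ^+ 3 * wderiv U x * (phi \o V) x) + x ^+ 2 * (f \o U) x * (phi \o V) x))).
  exact: (integrableZl _ (-1) iJ).
have main : \int[mu]_(x in I01) (-1 * (a * (x ^+ 2 * wderiv U x * wderiv (phi \o V) x) -
   r * (x ^+ 3 * wderiv U x * (phi \o V) x) + x ^+ 2 * (f \o U) x * (phi \o V) x)) <=
  \int[mu]_(x in I01) (c1 * (x ^+ 2 * Phi (V x)) +
    d2 * (x ^+ 2 * (U \- V) x * (U \- V) x + x ^+ 2 * wderiv (U \- V) x * wderiv (U \- V) x) +
    d3 * (x ^+ 2 * V x * V x + x ^+ 2 * wderiv V x * wderiv V x)).
  apply: ae_le_Rintegral => //.
  apply: (ae_imp2 pVx (wderivB UV VV)) => x hp hd; rewrite /= in_itv/= => xI.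
  rewrite hp// hd//.
  have := @pointwise_energy_bound R f phi phi' Phi m Cs Kf a a0 A r r0 eta x (U x) (V x)
    (wderiv U x) (wderiv V x) td a00 aA rr e01 xI (td_phi_le (V x)).
  move=> /(ler_wpM2l (sqr_ge0 x)); congr (_ <= _).
    by ring.
  by rewrite /c1 /d2 /d3; ring.
rewrite (RintegralZl _ _ iJ)// (RintegralD _ iB i3)// (RintegralB _ i1' i2')// in main.
rewrite (RintegralZl _ _ i1)// (RintegralZl _ _ i2)// in main.
rewrite (RintegralD _ p12 p3)// (RintegralD _ p1 p2)// (RintegralZl _ _ (Phi_integrable hV))// in main.
rewrite (RintegralZl _ _ (integrableD _ jD jDx))// (RintegralZl _ _ (integrableD _ jV jVx))// in main.
rewrite (RintegralD _ jD jDx)// (RintegralD _ jV jVx)// in main.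
have arith (X1 X2 X3 t E Y1 Y2 Z1 Z2 : R) :
    -1 * (a * X1 - r * X2 + X3) <= c1 * E + d2 * (Y1 + Y2) + d3 * (Z1 + Z2) ->
    - t <= 48 * A * K0 / eta * (Y1 + Y2) + 48 * A * K0 * eta * (Z1 + Z2) ->
    - (a * X1 + t - r * X2 + X3) <= c1 * E +
      (3 * A + 3 * r0 + Kf + 48 * A * K0) / eta * (Y1 + Y2) +
      (3 * A + 3 * r0 + 48 * A * K0) * eta * (Z1 + Z2).
  rewrite /d2 /d3 => h1 h2.
  have := lerD h1 h2; congr (_ <= _); ring.
exact: (arith _ _ _ _ _ _ _ _ _ main trace_part).
Qed.

End integrated_energy_bound.

(** * Measurability and approximation in time *)

Section simple_functions.
Context {R : realType}.
Local Notation mu := (@lebesgue_measure R).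
Implicit Types (t : R) (v w : R -> R).

(** The sets cut the line into finitely many measurable cells on which the function is constant. As
    [F] is arbitrary, this covers [sqn1] of a simple function. *)
Lemma measurable_pattern (I : finType) (A : I -> set R) (F : {ffun I -> bool} -> R) :
  (forall i, measurable (A i)) ->
  measurable_fun [set: R] (fun t => F [ffun i => t \in A i]).
Proof.
move=> mA.
pose B (b : {ffun I -> bool}) : set R :=
  \bigcap_(i in [set: I]) (if b i then A i else ~` A i).
have mB b : measurable (B b).
  by apply: fin_bigcap_measurable => // i _; case: ifP => _; [|apply: measurableC].
rewrite (_ : (fun t => _) = (fun t => \sum_(b <- enum {: {ffun I -> bool}}) F b * \1_(B b) t)).
  apply: measurable_sum => b; apply: measurable_funM => //; exact: measurable_indic.
apply/funext => t; set b0 := [ffun i => t \in A i].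
rewrite big_enum/= (bigD1 b0)//= big1 ?addr0; last first.
  move=> b bb0; rewrite indicE memNset ?mulr0// => Bt.
  case/negP: bb0; apply/eqP/ffunP => i; rewrite ffunE.
  have := Bt i Logic.I; case: ifP => _ h; first by rewrite mem_set.
  by rewrite memNset.
rewrite indicE mem_set ?mulr1// => i _; rewrite /b0 ffunE.
by case: ifPn => [/set_mem//|/negP h1 h2]; apply: h1; exact/mem_set.
Qed.

(** The coefficients are kept apart from the sets, so that the difference of the values of one
    simple function at two times has the same form. *)
Definition simple_comb (n : nat) (c : 'I_n -> R -> R) (k : 'I_n -> R) : R -> R :=
  fun x => \sum_(i < n) k i * c i x.

Lemma simple_comb0 (c : 'I_0 -> R -> R) k : simple_comb c k = cst 0.
Proof. by apply/funext => x; rewrite /simple_comb big_ord0. Qed.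

Lemma simple_combS n (c : 'I_n.+1 -> R -> R) k : simple_comb c k =
  (simple_comb (fun i => c (lift ord0 i)) (fun i => k (lift ord0 i))) \+ (fun x => k ord0 * c ord0 x).
Proof. by apply/funext => x; rewrite /simple_comb big_ord_recl addrC. Qed.

Lemma inV_simple_comb n (c : 'I_n -> R -> R) k : (forall i, inV (c i)) -> inV (simple_comb c k).
Proof.
elim: n c k => [|n IH] c k cV; first by rewrite simple_comb0; exact: inV0.
by rewrite simple_combS; apply: inVD; [exact: IH|exact: inVZ].
Qed.

Lemma sqn10 : sqn1 (cst 0 : R -> R) = 0.
Proof.
have -> : (cst 0 : R -> R) = (fun x => 0 * cst 0 x) by apply/funext => x; rewrite mul0r.
by rewrite (sqn1Z _ (@inV0 R)) expr0n mul0r.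
Qed.

(** 2^n comes from iterating [sqn1D_le]. Its size is harmless: in the averaging argument the simple
    function is fixed before the length of the time step tends to 0. *)
Lemma sqn1_simple_comb n (c : 'I_n -> R -> R) k : (forall i, inV (c i)) ->
  sqn1 (simple_comb c k) <= \sum_(i < n) 2 ^+ n * (k i ^+ 2 * sqn1 (c i)).
Proof.
elim: n c k => [|n IH] c k cV; first by rewrite simple_comb0 big_ord0 sqn10.
rewrite simple_combS big_ord_recl addrC.
have h1 := sqn1D_le (inV_simple_comb (fun i => k (lift ord0 i)) (fun i => cV (lift ord0 i)))
  (inVZ (k ord0) (cV ord0)).
have h2 := IH (fun i => c (lift ord0 i)) (fun i => k (lift ord0 i)) (fun i => cV (lift ord0 i)).
apply: le_trans h1 _; rewrite sqn1Z//; apply: lerD.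
  apply: le_trans (ler_wpM2l _ h2) _ => //.
  by rewrite mulr_sumr; apply: ler_sum => i _; rewrite (exprS 2 n) -[leRHS]mulrA.
apply: ler_wpM2r; first by apply: mulr_ge0; [exact: sqr_ge0|exact: sqn1_ge0].
by rewrite (exprS 2 n) ler_peMr// exprn_ege1//; lra.
Qed.

Lemma X_simpleP (s : R -> R -> R) : X_simple (@inV R) s -> exists n (A : 'I_n -> set R) (c : 'I_n -> R -> R),
  [/\ forall i, measurable (A i), forall i, inV (c i) &
      forall t, s t = simple_comb c (fun i => \1_(A i) t)].
Proof.
move=> [n [A [c [mA cV sE]]]]; exists n, A, c; split => // t.
by rewrite sE.
Qed.

Lemma X_simple_inV (s : R -> R -> R) t : X_simple (@inV R) s -> inV (s t).
Proof. by move=> /X_simpleP[n [A [c [_ cV ->]]]]; exact: inV_simple_comb. Qed.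

Lemma X_simple_patch (s : R -> R -> R) (G : set R) : X_simple (@inV R) s -> measurable G ->
  X_simple (@inV R) (fun t => if t \in G then s t else cst 0).
Proof.
move=> [n [A [c [mA cV sE]]]] mG; exists n, (fun i => A i `&` G), c; split => //.
  by move=> i; exact: measurableI.
apply/funext => t; apply/funext => x; case: ifPn => tG.
  by rewrite sE; apply: eq_bigr => i _; rewrite !indicE in_setI tG andbT.
rewrite big1// => i _; rewrite indicE in_setI (negbTE tG) andbF mul0r//.
Qed.

Lemma measurable_sqn1_simple (s : R -> R -> R) : X_simple (@inV R) s ->
  measurable_fun [set: R] (fun t => sqn1 (s t)).
Proof.
move=> /X_simpleP[n [A [c [mA cV sE]]]].
pose F (b : {ffun 'I_n -> bool}) := sqn1 (simple_comb c (fun i => (b i)%:R)).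
have -> : (fun t => sqn1 (s t)) = (fun t => F [ffun i => t \in A i]).
  apply/funext => t; rewrite sE /F.
  have -> // : (fun i => \1_(A i) t : R) = (fun i => ([ffun i => t \in A i] i)%:R).
  by apply/funext => i; rewrite ffunE indicE.
exact: measurable_pattern.
Qed.

Lemma measurable_sqn1_simpleB (s s' : R -> R -> R) : X_simple (@inV R) s -> X_simple (@inV R) s' ->
  measurable_fun [set: R] (fun t => sqn1 (s t \- s' t)).
Proof.
move=> /X_simpleP[n [A [c [mA cV sE]]]] /X_simpleP[n' [A' [c' [mA' cV' sE']]]].
pose B (i : 'I_n + 'I_n') := match i with inl j => A j | inr j => A' j end.
have mB i : measurable (B i) by case: i.
pose F (b : {ffun 'I_n + 'I_n' -> bool}) := sqn1 (simple_comb c (fun i => (b (inl i))%:R) \-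
  simple_comb c' (fun i => (b (inr i))%:R)).
have -> : (fun t => sqn1 (s t \- s' t)) = (fun t => F [ffun i => t \in B i]).
  apply/funext => t; rewrite sE sE' /F.
  have -> : (fun i => \1_(A i) t : R) = (fun i => ([ffun i => t \in B i] (inl i))%:R).
    by apply/funext => i; rewrite ffunE indicE.
  have -> // : (fun i => \1_(A' i) t : R) = (fun i => ([ffun i => t \in B i] (inr i))%:R).
  by apply/funext => i; rewrite ffunE indicE.
exact: measurable_pattern.
Qed.

Lemma norm1_sqr v : norm1 v ^+ 2 = sqn1 v.
Proof. by rewrite /norm1 sqr_sqrtr// sqn1_ge0. Qed.

Lemma norm1_lt v e : 0 <= e -> (norm1 v < e) = (sqn1 v < e ^+ 2).
Proof.
by move=> e0; rewrite -norm1_sqr ltr_pXn2r// nnegrE// sqrtr_ge0.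
Qed.

Lemma sqn1N v : inV v -> sqn1 (fun x => - v x) = sqn1 v.
Proof.
move=> vV; have -> : (fun x => - v x) = (fun x => -1 * v x) by apply/funext => x; rewrite mulN1r.
by rewrite sqn1Z// sqrrN expr1n mul1r.
Qed.

Lemma sqn1BC u v : inV u -> inV v -> sqn1 (u \- v) = sqn1 (v \- u).
Proof.
move=> uV vV; rewrite -(sqn1N (inV_sub vV uV)); congr sqn1.
by apply/funext => x /=; rewrite opprB.
Qed.

Lemma sqn1_triangle u v w : inV u -> inV v -> inV w ->
  sqn1 (u \- w) <= 2 * sqn1 (u \- v) + 2 * sqn1 (v \- w).
Proof.
move=> uV vV wV; have -> : u \- w = (u \- v) \+ (v \- w).
  by apply/funext => x /=; rewrite addrA subrK.
by apply: sqn1D_le; exact: inV_sub.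
Qed.

(* Strong measurability enters only through a countable family that approximates
   almost every value. *)
Lemma separable_range (T : R) (u : R -> R -> R) : strongly_measurable T (@inV R) norm1 u ->
  exists d : nat -> R -> R, (forall j, inV (d j)) /\
    {ae mu, forall t, 0 < t < T -> forall e, 0 < e -> exists j, sqn1 (d j \- u t) < e}.
Proof.
move=> [s [sS scv]].
have ch n : {X : {n : nat & ('I_n -> set R) * ('I_n -> R -> R)}%type |
  (forall i, inV ((projT2 X).2 i)) /\ forall t, s n t =
    simple_comb (projT2 X).2 (fun i => \1_((projT2 X).1 i) t)}.
  apply: cid; have [k [A [c [_ cV sE]]]] := X_simpleP (sS n).
  by exists (existT _ k (A, c)).
pose c n := (projT2 (sval (ch n))).2.
(* Each value of [s n] is a combination of the [c n] with coefficients 0 or 1; pairs of an index and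
   a list of booleans are countable. *)
pose comb n (b : seq bool) := simple_comb (c n) (fun i => (nth false b i)%:R).
pose d j := match @unpickle (nat * seq bool)%type j with
  Some X => comb X.1 X.2 | None => cst 0 end.
exists d; split.
  move=> j; rewrite /d; case: unpickle => [[n b]|]; last exact: inV0.
  by apply: inV_simple_comb => i; have [h _] := svalP (ch n); exact: h.
apply: (ae_imp scv) => t cv tT e e0.
have sq0 : 0 < Num.sqrt e by rewrite sqrtr_gt0.
have /cvgrPdist_lt/(_ _ sq0)[n _ /(_ n (leqnn n))] := cv tT.
rewrite /= sub0r normrN ger0_norm ?sqrtr_ge0// norm1_lt ?sqrtr_ge0// sqr_sqrtr ?(ltW e0)// => h.
pose A := (projT2 (sval (ch n))).1.
exists (pickle (n, [seq t \in A i | i <- enum 'I_(projT1 (sval (ch n)))])).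
rewrite /d pickleK/= (_ : comb n _ = s n t)//.
have [_ ->] := svalP (ch n); rewrite /comb /c.
have -> // : (fun i : 'I_(projT1 (sval (ch n))) => (nth false [seq t \in A i | i <- enum 'I_(projT1 (sval (ch n)))] i)%:R) =
  (fun i => \1_(A i) t : R).
by apply/funext => i; rewrite indicE (nth_map i) ?size_enum_ord// nth_ord_enum.
Qed.

End simple_functions.

(** * Values of the continuous representatives at almost every time *)

Section weak_values.
Context {R : realType}.
Local Notation mu := (@lebesgue_measure R).
Implicit Types (t : R) (v w : R -> R).

Lemma ip_le_young u v (eta : R) : inH u -> inH v -> 0 < eta ->
  `|ip u v| <= (eta^-1 * ip u u + eta * ip v v) / 2.
Proof.
move=> hu hv e0.
have iuv := inH_ip_integrable hu hv; have iu := inH_ip_integrable hu hu; have iv := inH_ip_integrable hv hv.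
have iu' : mu.-integrable `]0%R, 1%R[ (EFin \o (fun x => 2^-1 * eta^-1 * (x ^+ 2 * u x * u x))).
  exact: (integrableZl _ _ iu).
have iv' : mu.-integrable `]0%R, 1%R[ (EFin \o (fun x => 2^-1 * eta * (x ^+ 2 * v x * v x))).
  exact: (integrableZl _ _ iv).
have -> : (eta^-1 * ip u u + eta * ip v v) / 2 = 2^-1 * eta^-1 * ip u u + 2^-1 * eta * ip v v by ring.
rewrite -(RintegralZl _ _ iu)// -(RintegralZl _ _ iv)// -(RintegralD _ iu' iv')//.
apply: le_trans (le_normr_Rintegral _ iuv) _ => //.
apply: le_Rintegral => //; [exact: integrable_norm|exact: (integrableD _ iu' iv')|].
move=> x _; rewrite -mulrA normrM ger0_norm ?sqr_ge0//.
have h1 : `|u x * v x| <= (eta^-1 * u x ^+ 2 + eta * v x ^+ 2) / 2.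
  have ee : eta^-1 * eta = 1 by rewrite mulVf// gt_eqF.
  have i0 : 0 <= eta^-1 by rewrite invr_ge0 ltW.
  have q1 : 0 <= eta^-1 * (u x - eta * v x) ^+ 2 by rewrite mulr_ge0// sqr_ge0.
  have q2 : 0 <= eta^-1 * (u x + eta * v x) ^+ 2 by rewrite mulr_ge0// sqr_ge0.
  have E1 : eta^-1 * (u x - eta * v x) ^+ 2 =
    eta^-1 * u x ^+ 2 - 2 * (eta^-1 * eta) * (u x * v x) + (eta^-1 * eta) * (eta * v x ^+ 2) by ring.
  have E2 : eta^-1 * (u x + eta * v x) ^+ 2 =
    eta^-1 * u x ^+ 2 + 2 * (eta^-1 * eta) * (u x * v x) + (eta^-1 * eta) * (eta * v x ^+ 2) by ring.
  rewrite E1 ee in q1; rewrite E2 ee in q2.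
  by rewrite ler_norml; apply/andP; split; lra.
have := ler_wpM2l (sqr_ge0 x) h1; move/le_trans; apply.
rewrite le_eqVlt; apply/orP; left; apply/eqP; ring.
Qed.

Lemma ip_le_sqn1 v : ip v v <= sqn1 v.
Proof. by rewrite lerDl ip_ge0. Qed.

Lemma ipBl u v h : inH u -> inH v -> inH h -> ip (u \- v) h = ip u h - ip v h.
Proof.
move=> hu hv hh; have -> : u \- v = u \+ (fun x => -1 * v x).
  by apply/funext => x /=; rewrite mulN1r.
by rewrite ipDl//; [rewrite ipZl// mulN1r|exact: inHZ].
Qed.

Lemma not_negligible_exists (S : set R) (P : R -> Prop) : ~ mu.-negligible S ->
  {ae mu, forall t, P t} -> exists2 t, S t & P t.
Proof.
move=> nS aeP; apply: contrapT => nex; apply: nS.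
by apply: negligibleS aeP => t St /= Pt; apply: nex; exists t.
Qed.

(* The exceptional set of times does not depend on v: this permits
   v = phi (u tau), which varies with tau. *)
Lemma ae_weak_value (T : R) (u : R -> R -> R) :
  {ae mu, forall t, 0 < t < T -> inV (u t)} -> strongly_measurable T (@inV R) norm1 u ->
  {ae mu, forall tau, 0 < tau < T -> forall v w, inH v ->
    {within `[0, T], continuous w} ->
    {ae mu, forall t, 0 < t < T -> ip (u t) v = w t} -> w tau = ip (u tau) v}.
Proof.
move=> hV /separable_range[d [dV dense]].
(* Times of a rational interval at which [u] is close to a given element of the countable family.
   Outside the union [N] of those of these sets that are negligible, each such set containing tau is
   not negligible, hence meets any set of full measure, whatever the test function. *)
pose S (X : (nat * nat) * (rat * rat)) : set R := [set t |
  [/\ ratr X.2.1 < t < ratr X.2.2, 0 < t < T, inV (u t) & sqn1 (d X.1.1 \- u t) < X.1.2.+1%:R^-1]].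
pose N i : set R := match @unpickle ((nat * nat) * (rat * rat))%type i with
  Some X => if `[< mu.-negligible (S X) >] then S X else set0 | None => set0 end.
have Nneg : mu.-negligible (\bigcup_i N i).
  apply: negligible_bigcup => i; rewrite /N; case: unpickle => [X|]; last exact: negligible_set0.
  by case: ifPn => [/asboolP//|_]; exact: negligible_set0.
have NS t X : ~ (\bigcup_i N i) t -> S X t -> ~ mu.-negligible (S X).
  move=> nN StX neg; apply: nN; exists (pickle X) => //.
  by rewrite /N pickleK; case: ifPn => // /asboolP.
have aeN : {ae mu, forall t, ~ (\bigcup_i N i) t}.
  by apply: negligibleS Nneg => t /= /contrapT.
have H2 := ae_imp2 hV dense (fun x => @conj _ _).
apply: (ae_imp2 H2 aeN) => tau [uV dn] nN tT v w hv cw wv.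
have utV := uV tT; have [utH _] := utV.
apply/eqP; rewrite -subr_eq0; apply/negPn/negP => ne.
set eps := `|w tau - ip (u tau) v|.
have eps0 : 0 < eps by rewrite normr_gt0.
have v0 : 0 <= ip v v := ip_ge0 v.
pose eta := eps / (2 * (ip v v + 1)).
have eta0 : 0 < eta by apply: divr_gt0 => //; lra.
have etav : eta * ip v v <= eps / 2.
  by rewrite /eta -mulrA ler_pM2l// mulrC ler_pdivrMr; lra.
(* Two values in the same set have squared distance at most 4 / (k + 1) < eta eps / 2, so the first
   term in Young's inequality is below eps / 2. *)
have kap0 : 0 < eta * eps / 8 by apply: divr_gt0 => //; exact: mulr_gt0.
have [k _ /(_ k (leqnn k)) /= hk] := near_infty_natSinv_lt (PosNum kap0).
have k0 : 0 < k.+1%:R^-1 :> R by rewrite invr_gt0.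
have [j hj] := dn tT _ k0.
move/subspace_continuousP : cw => cw.
have tauI : (`[0, T]%classic : set R) tau.
  by rewrite /= in_itv/=; case/andP : tT => *; rewrite !ltW.
have eps2 : 0 < eps / 2 by rewrite divr_gt0.
have := cw _ tauI => /cvgrPdist_lt/(_ _ eps2).
rewrite near_withinE => /nbhs_ballP[del /= del0 hdel].
have lt1 : tau - del < tau by lra.
have lt2 : tau < tau + del by lra.
have [q1] := rat_in_itvoo lt1; rewrite in_itv/= => /andP[q1a q1b].
have [q2] := rat_in_itvoo lt2; rewrite in_itv/= => /andP[q2a q2b].
have SX : S ((j, k), (q1, q2)) tau by split => //=; rewrite q1b q2a.
have [s [/= /andP[s1 s2] sT sV sd] ws] := not_negligible_exists (NS _ _ nN SX) wv.
have [usH _] := sV.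
have d1 : sqn1 (u s \- u tau) <= 4 * k.+1%:R^-1.
  have := sqn1_triangle sV (dV j) utV; rewrite (sqn1BC sV (dV j)).
  move: (sqn1 (d j \- u s)) (sqn1 (d j \- u tau)) (sqn1 (u s \- u tau)) hj sd.
  by move: (k.+1%:R^-1) => kk x y z h1 h2 h3; lra.
have d2 : `|ip (u s) v - ip (u tau) v| < eps / 2.
  rewrite -ipBl//; have [dH _] := inV_sub sV utV.
  apply: le_lt_trans (ip_le_young dH hv eta0) _.
  have h1 := le_trans (ip_le_sqn1 (u s \- u tau)) d1.
  have h2 : eta^-1 * ip (u s \- u tau) (u s \- u tau) < eps / 2.
    rewrite mulrC ltr_pdivrMr//; apply: le_lt_trans h1 _.
    by move: (k.+1%:R^-1) hk => kk hk; lra.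
  move: (ip (u s \- u tau) (u s \- u tau)) h2 etav => x h2 h3; lra.
have d3 : `|w tau - w s| < eps / 2.
  apply: hdel; rewrite /ball/=.
    by rewrite ltr_norml; apply/andP; split; lra.
  by rewrite in_itv/=; case/andP : sT => *; rewrite !ltW.
have : eps <= `|w tau - w s| + `|ip (u s) v - ip (u tau) v|.
  rewrite -ws//; apply: le_trans (ler_normD _ _).
  by rewrite addrA subrK.
lra.
Qed.

End weak_values.

(** * Measurable majorants and simple approximations in L^2(0, T; V) *)

Section bochner_approximation.
Context {R : realType}.
Local Notation mu := (@lebesgue_measure R).
Implicit Types (t : R) (v w : R -> R).

Lemma limn_esup_ub (a : nat -> \bar R) (b : \bar R) : (\forall n \near \oo, (a n <= b)%E) ->
  (limn_esup a <= b)%E.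
Proof.
move=> ab; rewrite /limn_esup /limf_esup.
apply: (@le_trans _ _ (ereal_sup (a @` [set n | (a n <= b)%E]))).
  by apply: ereal_inf_lbound; exists [set n | (a n <= b)%E].
by apply: ge_ereal_sup => _ [n /= h <-].
Qed.

Lemma limn_esup_lb (a : nat -> \bar R) (b : \bar R) : (\forall n \near \oo, (b <= a n)%E) ->
  (b <= limn_esup a)%E.
Proof.
move=> ab; rewrite /limn_esup /limf_esup.
apply: le_ereal_inf_tmp => _ [V VF <-].
have [n [/= h Vn]] := filter_ex (filterI ab VF).
by apply: le_trans h _; apply: ereal_sup_ubound; exists n.
Qed.

(* No measurability of [g] is needed here: the integral of a non-negative
   function is a supremum over the simple functions below it. *)
Lemma integral_le_nonmeasurable (f g : R -> \bar R) :
  (forall x, (0 <= f x)%E) -> (forall x, (f x <= g x)%E) ->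
  (\int[mu]_x f x <= \int[mu]_x g x)%E.
Proof.
move=> f0 fg; have g0 x : (0 <= g x)%E by exact: le_trans (fg x).
rewrite !ge0_integralTE//; apply: ereal_sup_le => _ [h /= hf <-].
by exists h => // x /=; exact: le_trans (hf x) (fg x).
Qed.

Section approx.
Variables (T : R) (u : R -> R -> R) (s : nat -> R -> R -> R) (N : set R).
Hypothesis sS : forall n, X_simple (@inV R) (s n).
Hypothesis mN : measurable N.
Hypothesis uV : forall t, ~ N t -> 0 < t < T -> inV (u t).
Hypothesis scv : forall t, ~ N t -> 0 < t < T -> norm1 (s n t \- u t) @[n --> \oo] --> 0.

Let near_sqn1 t (e : R) : ~ N t -> 0 < t < T -> 0 < e ->
  \forall n \near \oo, sqn1 (s n t \- u t) < e.
Proof.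
move=> nN tT e0; have sq0 : 0 < Num.sqrt e by rewrite sqrtr_gt0.
have /cvgrPdist_lt/(_ _ sq0) := scv nN tT; apply: filterS => n.
by rewrite sub0r normrN ger0_norm ?sqrtr_ge0// norm1_lt ?sqrtr_ge0// sqr_sqrtr ?(ltW e0).
Qed.

(** A measurable substitute for sqn1 (u t - q t), namely twice the upper limit of sqn1 (s m t - q
    t). The triangle inequality for squares places this upper limit between one half and twice the
    true value, whence the factor 4. *)
Lemma measurable_sqn1_bound (q : R -> R -> R) : X_simple (@inV R) q ->
  exists e : R -> R, [/\ measurable_fun [set: R] e, forall t, 0 <= e t, forall t, N t -> e t = 0 &
    forall t, ~ N t -> 0 < t < T -> sqn1 (u t \- q t) <= e t <= 4 * sqn1 (u t \- q t)].
Proof.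
move=> qS.
pose E t := limn_esup (fun m => (sqn1 (s m t \- q t))%:E).
have mE : measurable_fun [set: R] E.
  apply: measurable_fun_limn_esup => n; apply/measurable_EFinP.
  exact: measurable_sqn1_simpleB.
have E0 t : (0 <= E t)%E.
  by apply: limn_esup_lb; apply: nearW => n; rewrite lee_fin sqn1_ge0.
exists (fun t => 2 * fine (E t) * \1_(~` N) t); split.
- apply: measurable_funM; last exact/measurable_indic/measurableC.
  by apply: measurable_funM => //; exact: measurableT_comp.
- by move=> t; rewrite !mulr_ge0// fine_ge0.
- by move=> t Nt; rewrite indicE memNset ?mulr0// => /(_ Nt).
move=> t nN tT; have qV := X_simple_inV t qS; have utV := uV nN tT.
rewrite indicE mem_set// mulr1.
set a := sqn1 (u t \- q t); have a0 : 0 <= a := sqn1_ge0 _.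
have sV n : inV (s n t) := X_simple_inV t (sS n).
have up (e : R) : 0 < e -> (E t <= (2 * a + e)%:E)%E.
  move=> e0; have e20 : 0 < e / 2 by rewrite divr_gt0.
  apply: limn_esup_ub; apply: filterS (near_sqn1 nN tT e20) => n hn; rewrite lee_fin.
  have := sqn1_triangle (sV n) utV qV; rewrite -/a.
  by move: (sqn1 (s n t \- u t)) (sqn1 (s n t \- q t)) hn => x y h1 h2; lra.
have lo (e : R) : 0 < e -> (((a - e) / 2)%:E <= E t)%E.
  move=> e0; have e20 : 0 < e / 2 by rewrite divr_gt0.
  apply: limn_esup_lb; apply: filterS (near_sqn1 nN tT e20) => n hn; rewrite lee_fin.
  have := sqn1_triangle utV (sV n) qV; rewrite -/a (sqn1BC utV (sV n)).
  by move: (sqn1 (s n t \- u t)) (sqn1 (s n t \- q t)) hn => x y h1 h2; lra.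
have Efin : E t \is a fin_num.
  by rewrite ge0_fin_numE//; apply: le_lt_trans (up 1 ltr01) _; rewrite ltry.
rewrite -(fineK Efin) in up lo.
apply/andP; split.
  apply/ler_addgt0Pr => e e0; have := lo e e0; rewrite lee_fin; lra.
apply/ler_addgt0Pr => e e0; have e20 : 0 < e / 2 by rewrite divr_gt0.
have := up _ e20; rewrite lee_fin; lra.
Qed.

Variable g : R -> R.
Hypothesis mg : measurable_fun [set: R] g.
Hypothesis g0 : forall t, 0 <= g t.
Hypothesis gu : forall t, ~ N t -> 0 < t < T -> sqn1 (u t) <= g t.
Hypothesis ig : mu.-integrable `]0, T[ (EFin \o g).

(** Replacing [s n] by 0 outside [G n] dominates it by [g]. The cut-off does not spoil convergence:
    where g t > 0, sqn1 (s n t - u t) < g t forces sqn1 (s n t) <= 2 g t + 2 g t. *)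
Let G n : set R := [set t | sqn1 (s n t) <= 4 * g t].
Let q n t := if t \in G n then s n t else cst 0.

Let mG n : measurable (G n).
Proof.
have m1 : measurable_fun [set: R] (fun t => 4 * g t - sqn1 (s n t)).
  by apply: measurable_funB; [exact: measurable_funM|exact: measurable_sqn1_simple].
rewrite (_ : G n = setT `&` (fun t => 4 * g t - sqn1 (s n t)) @^-1` `[0, +oo[%classic); last first.
  by apply/seteqP; split => t /=; rewrite in_itv/= andbT subr_ge0 => //; case.
exact: m1.
Qed.

Let qS n : X_simple (@inV R) (q n).
Proof. exact: X_simple_patch. Qed.

Let u_sub0 t : u t \- cst 0 = u t.
Proof. by apply/funext => x /=; rewrite subr0. Qed.

Let q_cvg t (e : R) : ~ N t -> 0 < t < T -> 0 < e ->
  \forall n \near \oo, sqn1 (u t \- q n t) < e.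
Proof.
move=> nN tT e0; have utV := uV nN tT.
have [gt0|] := ltP 0 (g t).
  have m0 : 0 < Num.min e (g t) by rewrite lt_min e0 gt0.
  have m1 : Num.min e (g t) <= e by rewrite ge_min lexx.
  have m2 : Num.min e (g t) <= g t by rewrite ge_min lexx orbT.
  apply: filterS (near_sqn1 nN tT m0) => n h0.
  have h1 := lt_le_trans h0 m1; have h2 := lt_le_trans h0 m2.
  have sV := X_simple_inV t (sS n).
  rewrite /q ifT; first by rewrite sqn1BC.
  apply/mem_set; rewrite /G /=.
  have := sqn1_triangle sV utV (@inV0 R).
  have -> : s n t \- cst 0 = s n t by apply/funext => x /=; rewrite subr0.
  rewrite u_sub0; have := gu nN tT.
  by move: (sqn1 (s n t \- u t)) (sqn1 (s n t)) (sqn1 (u t)) h2 => x y z k1 k2 k3; lra.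
move=> gle; have u0 : sqn1 (u t) <= 0 by exact: le_trans (gu nN tT) gle.
apply: filterS (near_sqn1 nN tT e0) => n h1.
have [->|->] : q n t = s n t \/ q n t = cst 0 by rewrite /q; case: ifP => _; [left|right].
  by rewrite sqn1BC//; exact: X_simple_inV.
by rewrite u_sub0; exact: le_lt_trans u0 e0.
Qed.

Lemma simple_L2_approx (eps : R) : 0 < eps -> exists (q : R -> R -> R) (e : R -> R), [/\ X_simple (@inV R) q,
  measurable_fun [set: R] e, forall t, 0 <= e t, mu.-integrable `]0, T[ (EFin \o e) &
  \int[mu]_(t in `]0, T[) e t < eps] /\
  forall t, ~ N t -> 0 < t < T -> sqn1 (u t \- q t) <= e t.
Proof.
move=> eps0.
have ch n := cid (measurable_sqn1_bound (qS n)).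
pose e n := sval (ch n).
have me n : measurable_fun [set: R] (e n) by have [] := svalP (ch n).
have e0 n t : 0 <= e n t by have [_ + _ _] := svalP (ch n); exact.
have eN n t : N t -> e n t = 0 by have [_ _ + _] := svalP (ch n); exact.
have eu n t : ~ N t -> 0 < t < T -> sqn1 (u t \- q n t) <= e n t <= 4 * sqn1 (u t \- q n t).
  by have [_ _ _] := svalP (ch n); exact.
(* 40 = 4 * (2 * 1 + 2 * 4), from sqn1 (u t) <= g t and sqn1 (q n t) <= 4 g t. *)
have i40 : mu.-integrable `]0, T[ (EFin \o (fun t => 40 * g t)) by exact: (integrableZl _ 40 ig).
have dom n t : 0 < t < T -> e n t <= 40 * g t.
  move=> tT; have [Nt|nN] := pselect (N t); first by rewrite eN// mulr_ge0.
  have /andP[_ h1] := eu n t nN tT; have utV := uV nN tT.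
  have qV := X_simple_inV t (qS n).
  have := sqn1_triangle utV (@inV0 R) qV; rewrite u_sub0 (sqn1BC (@inV0 R) qV).
  have -> : q n t \- cst 0 = q n t by apply/funext => x /=; rewrite subr0.
  have hq : sqn1 (q n t) <= 4 * g t.
    rewrite /q; case: ifPn => [/set_mem//|_]; rewrite sqn10 mulr_ge0//.
  have := gu nN tT.
  move: (sqn1 (u t \- q n t)) (sqn1 (u t)) (sqn1 (q n t)) h1 hq => x y z k1 k2 k3 k4; lra.
have ie n : mu.-integrable `]0, T[ (EFin \o e n).
  apply: le_integrable_R i40 => //; first exact: measurable_funTS.
  by move=> t; rewrite /= in_itv/= => tT; rewrite ger0_norm// dom.
have cv : (fun n => \int[mu]_(t in `]0, T[) e n t) @ \oo --> \int[mu]_(t in `]0, T[) (cst 0 t : R).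
  apply: (@Rdominated_convergence R _ e (cst 0) (fun t => 40 * g t)) => //.
  - by move=> n; exact: measurable_funTS.
  - apply: aeW => t; rewrite /= in_itv/= => tT; apply/cvgrPdist_lt => d d0.
    have [Nt|nN] := pselect (N t).
      by apply: nearW => n; rewrite eN//= subrr normr0.
    have d40 : 0 < d / 4 by rewrite divr_gt0.
    apply: filterS (q_cvg nN tT d40) => n h1; rewrite sub0r normrN ger0_norm//.
    have /andP[_ h2] := eu n t nN tT.
    by move: (sqn1 (u t \- q n t)) h1 h2 => x; lra.
  - by apply: aeW => t; rewrite /= in_itv/= => tT n; rewrite ger0_norm// dom.
have z0 : \int[mu]_(t in `]0, T[) (cst 0 t : R) = 0.
  by rewrite /Rintegral integral0_eq.
rewrite z0 in cv.
have [n _ /(_ n (leqnn n)) /= hn] : \forall n \near \oo, \int[mu]_(t in `]0, T[) e n t < eps.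
  exact: (@cvgr_lt _ _ _ _ _ 0 cv).
exists (q n), (e n); split; first by split => //; exact: qS.
by move=> t nN tT; have /andP[] := eu n t nN tT.
Qed.

End approx.

(** [g] is the measurable majorant obtained for q = 0. It dominates the simple approximations after
    cut-off, which then converge in mean square by dominated convergence. *)
Lemma bochner_L2_approx (T : R) (u : R -> R -> R) : in_Bochner T (@inV R) norm1 2%:E u ->
  exists g : R -> R, [/\ measurable_fun [set: R] g, forall t, 0 <= g t,
    mu.-integrable `]0, T[ (EFin \o g),
    {ae mu, forall t, 0 < t < T -> sqn1 (u t) <= g t} &
    forall eps, 0 < eps -> exists (q : R -> R -> R) (e : R -> R), [/\ X_simple (@inV R) q,
      measurable_fun [set: R] e, forall t, 0 <= e t, mu.-integrable `]0, T[ (EFin \o e) &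
      \int[mu]_(t in `]0, T[) e t < eps] /\
      {ae mu, forall t, 0 < t < T -> sqn1 (u t \- q t) <= e t}].
Proof.
move=> [hV [s [sS scv]] hL].
have := ae_imp2 hV scv (fun t h1 h2 => fun tT : 0 < t < T => conj (h1 tT) (h2 tT)).
move=> [N [mN N0 badN]].
have good t : ~ N t -> 0 < t < T -> inV (u t) /\ norm1 (s n t \- u t) @[n --> \oo] --> 0.
  by move=> nN tT; apply: contrapT => h; apply: nN; apply: badN => /= /(_ tT).
have uV t nN tT := (good t nN tT).1; have sc t nN tT := (good t nN tT).2.
have S0 : X_simple (@inV R) (fun=> cst 0).
  exists 0%N, (fun=> set0), (fun=> cst 0); split => //; first by move=> [].
  by apply/funext => t; apply/funext => x; rewrite big_ord0.
have [g [mg g0 gN gu]] := measurable_sqn1_bound sS mN uV sc S0.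
have u0 t : u t \- cst 0 = u t by apply/funext => x /=; rewrite subr0.
have gu1 t : ~ N t -> 0 < t < T -> sqn1 (u t) <= g t.
  by move=> nN tT; have := gu t nN tT; rewrite u0 => /andP[].
have aeN (P : R -> Prop) : (forall t, ~ N t -> P t) -> {ae mu, forall t, P t}.
  move=> NP; exists N; split => // t /= nP; apply: contrapT => nN; exact/nP/NP.
(* g / 4 lies below the square of [norm1] of [u], and vanishes on the exceptional set; the integral
   of that square is finite by the Bochner hypothesis. *)
have ig4 : mu.-integrable `]0, T[ (EFin \o (fun t => g t / 4)).
  apply/integrableP; split.
    by apply/measurable_EFinP/measurable_funTS; exact: measurable_funM.
  rewrite integral_mkcond.
  have Lfin : (\int[mu]_t (`| ((EFin \o (@norm1 R \o u)) \_ `]0%R, T[) t | `^ 2)%E < +oo)%E.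
    move: hL; rewrite /Lnorm_on unlock.
    by apply: lty_poweRy; rewrite invr_eq0 pnatr_eq0.
  apply: le_lt_trans Lfin; apply: integral_le_nonmeasurable.
    by move=> t; rewrite patchE; case: ifP.
  move=> t; rewrite !patchE; case: ifPn => [/set_mem|_]; last first.
    by have -> : (point : \bar R) = 0%E by []; rewrite poweR_ge0.
  rewrite /= in_itv/= => tT; rewrite ger0_norm ?divr_ge0//.
  have [Nt|nN] := pselect (N t); first by rewrite gN// mul0r lee_fin powR_ge0.
  have /andP[_ h] := gu t nN tT; rewrite u0 in h.
  rewrite lee_fin (ger0_norm (sqrtr_ge0 _)).
  rewrite powR_mulrn ?sqrtr_ge0// norm1_sqr ler_pdivrMr// mulrC.
  exact: h.
have ig : mu.-integrable `]0, T[ (EFin \o g).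
  have -> : EFin \o g = EFin \o (fun t => 4 * (g t / 4)).
    by apply/funext => t /=; rewrite mulrC divfK.
  exact: (integrableZl _ 4 ig4).
exists g; split => //; first by apply: aeN => t nN tT; exact: gu1.
move=> eps eps0.
have [q [e [h1 h2]]] := simple_L2_approx sS mN uV sc mg g0 gu1 ig eps0.
by exists q, e; split => //; apply: aeN.
Qed.

End bochner_approximation.

(** * The energy inequality between two times *)

Section time_inequality.
Context {R : realType}.
Local Notation mu := (@lebesgue_measure R).
Local Notation I01 := (`]0%R, 1%R[%classic : set R).
Implicit Types (t s tau : R) (v w : R -> R).

Lemma within_continuous_lebesgue_pt (a b : R) w t : {within `[a, b], continuous w} ->
  a < t < b -> lebesgue_pt w t.
Proof.
move=> cw tab.
have mw : measurable_fun `[a, b] w by exact: subspace_continuous_measurable_fun.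
apply: (@continuous_lebesgue_pt _ _ _ `]a, b[) => //.
- by apply: (@measurable_funS _ _ _ _ `[a, b]) mw => //; exact: subset_itv_oo_cc.
- have ab : a < b by case/andP: tab; exact: lt_trans.
  have /(continuous_within_itvP _ ab)[h _ _] := cw.
  by apply: h; rewrite in_itv.
Qed.

(** Every interior time is a Lebesgue point of the continuous representative, so for s0 > 0 this is
    [weak_derivative_FTC]. The case s0 = 0 follows by letting s decrease to 0, by continuity of [w]
    and b >= 0. *)
Lemma weak_derivative_le (T : R) w g1 h1 (b : R -> R) (s0 tau : R) : weak_derivative 0 T g1 h1 ->
  {within `[0, T], continuous w} -> {ae mu, forall t, 0 < t < T -> g1 t = w t} ->
  mu.-integrable `]0, T[ (EFin \o b) -> (forall t, 0 <= b t) ->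
  {ae mu, forall t, 0 < t < T -> h1 t <= b t} ->
  0 <= s0 -> s0 < tau -> tau < T -> w tau - w s0 <= \int[mu]_(t in `]s0, tau[) b t.
Proof.
move=> wd cw gw ib b0 hb s00 st tT.
have mwT : measurable_fun `[0, T] w by exact: subspace_continuous_measurable_fun.
have mw : measurable_fun (`]0, T[%classic : set R) w.
  by apply: (@measurable_funS _ _ _ _ `[0, T]) mwT => //; exact: subset_itv_oo_cc.
have [_ [mh _ _] _] := wd; have [_ lh _] := wd.
have wd' : weak_derivative 0 T w h1.
  by apply: (eq_weak_derivative wd) => //; apply: aeW.
have pos s : 0 < s -> s < tau -> w tau - w s <= \int[mu]_(t in `]s, tau[) b t.
  move=> sp stau.
  rewrite (weak_derivative_FTC wd') //; last 2 first.
  - by apply: (within_continuous_lebesgue_pt cw); apply/andP; split; lra.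
  - by apply: (within_continuous_lebesgue_pt cw); apply/andP; split; lra.
  have sub : `]s, tau[ `<=` `]0, T[.
    by move=> t /=; rewrite !in_itv/= => /andP[? ?]; apply/andP; split; lra.
  apply: ae_le_Rintegral => //.
  - apply: (@integrableS _ _ _ mu `[s, tau]) => //; first exact: subset_itv_oo_cc.
    exact: (locally_integrable_itv lh).
  - exact: (@integrableS _ _ _ mu `]0, T[).
  - apply: (ae_imp hb) => t h; rewrite /= in_itv/= => /andP[? ?]; apply: h.
    by apply/andP; split; lra.
move: s00; rewrite le_eqVlt => /predU1P[s0E|s0p]; last exact: pos.
rewrite -s0E in st *.
have ib' : mu.-integrable `]0, tau[ (EFin \o b).
  apply: (@integrableS _ _ _ mu `]0, T[) => //.
  by move=> t /=; rewrite !in_itv/= => /andP[? ?]; apply/andP; split; lra.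
have mono s : 0 < s -> s < tau -> w tau - w s <= \int[mu]_(t in `]0, tau[) b t.
  move=> sp stau; apply: le_trans (pos s sp stau) _.
  have sub : `]s, tau[ `<=` `]0, tau[.
    by move=> t /=; rewrite !in_itv/= => /andP[? ?]; apply/andP; split; lra.
  apply: fine_le; [|exact: integrable_fin_num _ ib'|].
    by apply: integrable_fin_num => //; exact: (@integrableS _ _ _ mu `]0, tau[).
  apply: ge0_subset_integral => //; first by case/integrableP : ib'.
  by move=> t _; rewrite lee_fin.
apply/ler_addgt0Pr => e e0.
move/subspace_continuousP : cw => cw.
have zI : (`[0, T]%classic : set R) 0 by rewrite /= in_itv/= lexx; lra.
have := cw _ zI => /cvgrPdist_lt/(_ _ e0).
rewrite near_withinE => /nbhs_ballP[del /= del0 hdel].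
pose s := Num.min (del / 2) (tau / 2).
have sp : 0 < s by rewrite lt_min; apply/andP; split; lra.
have s1 : s <= del / 2 by rewrite ge_min lexx.
have s2 : s <= tau / 2 by rewrite ge_min lexx orbT.
have h1' := mono s sp (_ : s < tau).
have h2 : `|w 0 - w s| < e.
  apply: hdel; first by rewrite /ball/= sub0r normrN gtr0_norm//; lra.
  by rewrite in_itv/= ltW//=; lra.
have h3 : s < tau by lra.
have := h1' h3; move: h2; rewrite ltr_norml => /andP[h4 h5]; lra.
Qed.

Lemma chained_sqn1_bound (x y z x1 x2 x3 e1 e2 : R) : z <= 2 * x + 2 * y ->
  y <= 2 * x1 + 2 * x2 -> x <= e1 -> x1 <= x3 -> x2 <= e2 -> z <= 2 * e1 + 4 * e2 + 4 * x3.
Proof. lra. Qed.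

Section main_inequality.
Variables (T : R) (rad rad' a k u0 f : R -> R) (u : R -> R -> R).
Variables (phi phi' Phi : R -> R) (m Cs Kf a0 A0 K0 r0 : R).
Hypothesis td : truncation_data f phi phi' Phi m Cs Kf.
Hypothesis a00 : 0 < a0.
Hypothesis K00 : 0 <= K0.
Hypothesis r00 : 0 <= r0.
Hypothesis haA : {ae mu, forall t, 0 < t < T -> a0 <= a t <= A0}.
Hypothesis hkK : {ae mu, forall t, 0 < t < T -> 0 <= k t <= K0}.
Hypothesis hr : {ae mu, forall t, 0 < t < T -> `|rad' t / rad t| <= r0}.
Hypothesis u0H : inH u0.
Hypothesis u0m : {ae mu, forall x, 0 < x < 1 -> `|u0 x| <= m}.
Hypothesis sol : variational_solution T a k rad rad' f u0 u.
Hypothesis hV : {ae mu, forall t, 0 < t < T -> inV (u t)}.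
Hypothesis sm : strongly_measurable T (@inV R) norm1 u.

Let E V := truncation_energy Phi V.
Let c1 := r0 ^+ 2 * Cs / a0.
Let C2 := 3 * A0 + 3 * r0 + Kf + 48 * A0 * K0.
Let C3 := 3 * A0 + 3 * r0 + 48 * A0 * K0.

(* [rate] bounds the right-hand side of the equation at time s tested with
   phi (u tau); jump + e control |u s - u tau|^2 in V through a simple function
   close to u. *)
Definition jump n (A : 'I_n -> set R) (kap : 'I_n -> R) (s t : R) : R :=
  \sum_(i < n) kap i * `|\1_(A i) s - \1_(A i) t|.

Definition rate (c1 C2 C3 eta Et gt : R) (e : R -> R) n (A : 'I_n -> set R) kap (tau s : R) : R :=
  c1 * Et + C3 * eta * gt + C2 / eta * (2 * e s + 4 * e tau + 4 * jump A kap s tau).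

Lemma energy_difference (V W : R -> R) : inH V -> inH W ->
  E V - E W <= ip V (phi \o V) - ip W (phi \o V).
Proof.
move=> hV' hW.
have mV := inH_measurable hV'.
have hp : inH (phi \o V).
  apply: (inH_le _ (inHZ 6 hV')) => [|x _ /=].
    by apply: measurableT_comp mV; apply: continuous_measurable_fun; exact: td_cphi td.
  rewrite -(real_normK (num_real (phi (V x)))) exprMn -(real_normK (num_real (V x))) -exprMn.
  by rewrite ler_pXn2r ?nnegrE ?mulr_ge0//; exact: td_phi_le td _.
have i1 := Phi_integrable td hV'; have i2 := Phi_integrable td hW.
have i3 := inH_ip_integrable hV' hp; have i4 := inH_ip_integrable hW hp.
rewrite -(RintegralB _ i1 i2)// -(RintegralB _ i3 i4)//.
apply: le_Rintegral => //; [exact: (integrableB _ i1 i2)|exact: (integrableB _ i3 i4)|].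
have arith (x P Q y z q : R) : P - Q <= q * (y - z) ->
    x ^+ 2 * P - x ^+ 2 * Q <= x ^+ 2 * y * q - x ^+ 2 * z * q.
  by move=> h; have := ler_wpM2l (sqr_ge0 x) h; move: (x ^+ 2) => X; lra.
by move=> x _; apply: arith; exact: td_convex td (W x) (V x).
Qed.

Lemma energy_initial : E u0 = 0.
Proof.
have mu0 := inH_measurable u0H.
rewrite /E /truncation_energy (@ae_eq_Rintegral R _ _ (cst 0))//.
- by rewrite /Rintegral integral0_eq.
- apply: measurable_funM; first exact: measurable_funX.
  by apply: measurableT_comp mu0; apply: continuous_measurable_fun; exact: td_cPhi td.
- apply: (ae_imp u0m) => x h; rewrite /= in_itv/= => xI.
  by have := h xI; rewrite -(td_Phi_eq0 td) => /eqP ->; rewrite mulr0.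
Qed.

(** For almost every tau, v = phi(u tau) is a legitimate test function, and the representative [w]
    takes the value <u tau, v> at tau itself by [ae_weak_value]. The first conclusion starts from
    time 0, where w 0 = <u0, v> and the energy of [u0] vanishes. *)
Lemma main_inequality (eta : R) (g e : R -> R) n (A : 'I_n -> set R) (c : 'I_n -> R -> R) :
  0 < eta <= 1 -> (forall i, measurable (A i)) -> (forall i, inV (c i)) ->
  measurable_fun [set: R] e -> (forall t, 0 <= e t) -> mu.-integrable `]0, T[ (EFin \o e) ->
  (forall t, 0 <= g t) -> 0 <= A0 ->
  {ae mu, forall t, 0 < t < T -> sqn1 (u t) <= g t} ->
  {ae mu, forall t, 0 < t < T -> sqn1 (u t \- simple_comb c (fun i => \1_(A i) t)) <= e t} ->
  {ae mu, forall tau, 0 < tau < T ->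
    let b := rate c1 C2 C3 eta (E (u tau)) (g tau) e A (fun i => 2 ^+ n * sqn1 (c i)) tau in
    E (u tau) <= \int[mu]_(t in `]0, tau[) b t /\
    {ae mu, forall s, 0 < s < tau -> E (u tau) <= E (u s) + \int[mu]_(t in `]s, tau[) b t}}.
Proof.
move=> eta01 mA cV me e0 ie g0 A00 ug uqe.
have Cs0 : 0 <= Cs := td_Cs td. have Kf0 : 0 <= Kf := td_Kf td.
have c10 : 0 <= c1 by rewrite /c1 divr_ge0 ?(ltW a00)// mulr_ge0// sqr_ge0.
have AK : 0 <= 48 * A0 * K0 by rewrite mulr_ge0 ?mulr_ge0.
have C20 : 0 <= C2 by rewrite /C2; have := r00; lra.
have C30 : 0 <= C3 by rewrite /C3; have := r00; lra.
have /andP[eta0 _] := eta01.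
have wval := ae_weak_value hV sm.
have H1 := ae_imp2 wval hV (fun x => @conj _ _).
have H2 := ae_imp2 ug uqe (fun x => @conj _ _).
apply: (ae_imp2 H1 H2) => tau [wv tV] [tg tqe] tT.
set b := rate _ _ _ _ _ _ _ _ _ _.
have {}tV := tV tT; have {}tg := tg tT; have {}tqe := tqe tT; have {}wv := wv tT.
have [tH _] := tV; have /andP[tau0 tauT] := tT.
have [pV pVx trp] := td_inV td tV; have [pH _] := pV.
have [[g1 [h1 [g1E h1E wd]]] [w [cw wE w0]]] := sol pV.
have Et0 : 0 <= E (u tau).
  apply: Rintegral_ge0 => x _; apply: mulr_ge0; first exact: sqr_ge0.
  exact: td_Phi_ge0 td _.
pose kap i := 2 ^+ n * sqn1 (c i).
have kap0 i : 0 <= kap i by rewrite mulr_ge0 ?exprn_ge0// sqn1_ge0.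
have jump0 s : 0 <= jump A kap s tau.
  by apply: sumr_ge0 => i _; rewrite mulr_ge0.
have mjump : measurable_fun [set: R] (fun s => jump A kap s tau).
  apply: measurable_sum => i; apply: measurable_funM => //; apply: measurableT_comp => //.
  by apply: measurable_funB => //; exact: measurable_indic.
have bE s : b s = (c1 * E (u tau) + C3 * eta * g tau + C2 / eta * (4 * e tau)) +
    (C2 / eta * 2 * e s + C2 / eta * 4 * jump A kap s tau).
  by rewrite /b /rate; ring.
have b0 s : 0 <= b s.
  rewrite bE; have q0 : 0 <= C2 / eta by rewrite divr_ge0// ltW.
  have p1 : 0 <= C3 * eta * g tau by rewrite !mulr_ge0// ltW.
  have p2 : 0 <= c1 * E (u tau) by rewrite mulr_ge0.
  have p3 : 0 <= C2 / eta * (4 * e tau) by rewrite mulr_ge0// mulr_ge0.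
  have p4 : 0 <= C2 / eta * 2 * e s by rewrite mulr_ge0// mulr_ge0.
  have p5 : 0 <= C2 / eta * 4 * jump A kap s tau by rewrite mulr_ge0// mulr_ge0.
  by rewrite !addr_ge0.
have ijump : mu.-integrable `]0, T[ (EFin \o (fun s => jump A kap s tau)).
  apply: (le_integrable_R _ _ _ (integrable_cst_oo (\sum_(i < n) kap i) 0 T)) => //.
    exact: measurable_funTS.
  move=> s _; rewrite ger0_norm//; apply: ler_sum => i _.
  rewrite -[leRHS]mulr1 ler_wpM2l// !indicE.
  by case: (s \in A i); case: (tau \in A i); rewrite ?subrr ?subr0 ?sub0r ?normrN ?normr0 ?normr1.
have ib : mu.-integrable `]0, T[ (EFin \o b).
  have -> : EFin \o b = EFin \o (fun s => (c1 * E (u tau) + C3 * eta * g tau + C2 / eta * (4 * e tau)) +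
    (C2 / eta * 2 * e s + C2 / eta * 4 * jump A kap s tau)).
    by apply/funext => s /=; rewrite bE.
  have j1 : mu.-integrable `]0, T[ (EFin \o (fun s => C2 / eta * 2 * e s)).
    exact: (integrableZl _ _ ie).
  have j2 : mu.-integrable `]0, T[ (EFin \o (fun s => C2 / eta * 4 * jump A kap s tau)).
    exact: (integrableZl _ _ ijump).
  exact: (integrableD _ (integrable_cst_oo _ 0 T) (integrableD _ j1 j2)).
have g1w : {ae mu, forall t, 0 < t < T -> g1 t = w t}.
  by apply: (ae_imp2 g1E wE) => t q1 q2 tt; rewrite -q1// q2.
have hb : {ae mu, forall t, 0 < t < T -> h1 t <= b t}.
  have K1 := ae_imp2 haA hkK (fun x => @conj _ _).
  have K2 := ae_imp2 K1 hr (fun x => @conj _ _).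
  have K3 := ae_imp2 K2 hV (fun x => @conj _ _).
  have K4 := ae_imp2 K3 uqe (fun x => @conj _ _).
  apply: (ae_imp2 K4 h1E) => s [[[[q1 q2] q3] q4] q5] q6 sT.
  rewrite -q6//; have sV := q4 sT.
  apply: le_trans (energy_bound td sV tV a00 (q1 sT) (q2 sT) (q3 sT) eta01) _.
  pose qq t := simple_comb c (fun i => \1_(A i) t).
  have qV t : inV (qq t) by exact: inV_simple_comb.
  (* Passing from u s to u tau through qq s and qq tau gives the weights 2, 4, 4 of [rate]. *)
  have t1 := sqn1_triangle sV (qV s) tV.
  have t2 := sqn1_triangle (qV s) (qV tau) tV.
  have t3 : sqn1 (qq s \- qq tau) <= jump A kap s tau.
    have -> : qq s \- qq tau = simple_comb c (fun i => \1_(A i) s - \1_(A i) tau).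
      apply/funext => x; rewrite /qq /simple_comb /= -sumrB; apply: eq_bigr => i _.
      by rewrite mulrBl.
    (* A difference of indicators is -1, 0 or 1, so its square is its absolute value. *)
    apply: le_trans (sqn1_simple_comb _ cV) _; apply: ler_sum => i _.
    rewrite /kap mulrCA [leRHS]mulrC ler_wpM2r//; first exact: kap0.
    rewrite !indicE; case: (s \in A i); case: (tau \in A i);
      by rewrite ?subrr ?subr0 ?sub0r ?normrN ?normr0 ?normr1 ?expr0n ?sqrrN ?expr1n.
  have t4 := q5 sT; have t5 := tqe; rewrite (sqn1BC tV (qV tau)) in t5.
  have t6 := chained_sqn1_bound t1 t2 t4 t3 t5.
  rewrite /b /rate -/c1 -/C2 -/C3 addrAC.
  apply: lerD; first by rewrite lerD2l// ler_wpM2l// mulr_ge0// ltW.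
  by rewrite ler_wpM2l// divr_ge0// ltW.
have key s : 0 <= s -> s < tau -> w tau - w s <= \int[mu]_(t in `]s, tau[) b t.
  by move=> s0' st; apply: (weak_derivative_le wd cw g1w ib b0 hb).
have wtau : w tau = ip (u tau) (phi \o u tau) by exact: wv pH cw wE.
split.
  have := energy_difference tH u0H; rewrite energy_initial subr0 -w0 -wtau => q1.
  exact: le_trans q1 (key 0 (lexx 0) tau0).
apply: (ae_imp2 hV wE) => s q1 q2 /andP[s0' st].
have sT : 0 < s < T by rewrite s0' (lt_trans st).
have [sH _] := q1 sT.
have := energy_difference tH sH; rewrite q2// -wtau => q3.
rewrite -lerBlDl; exact: le_trans q3 (key s (ltW s0') st).
Qed.

End main_inequality.
End time_inequality.

(** * Averaging in time *)

Section primitives.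
Context {R : realType}.
Local Notation mu := (@lebesgue_measure R).
Implicit Types (F S : R -> R) (a b p q s t h tau : R).

(** Starting from -oo, so that translates such as prim F (t - 2h) make sense for small t; it is
    applied to functions extended by 0. *)
Definition prim F t : R := \int[mu]_(s in `]-oo, t[) F s.

Lemma primB F a b : mu.-integrable [set: R] (EFin \o F) -> a <= b ->
  \int[mu]_(s in `]a, b[) F s = prim F b - prim F a.
Proof.
move=> iF; rewrite le_eqVlt => /predU1P[->|ab].
  by rewrite set_itvoo0 ?Rintegral_set0 ?subrr.
have iFb : mu.-integrable `]-oo, b[ (EFin \o F) by exact: (@integrableS _ _ _ mu [set: R]).
have iFa : mu.-integrable `]-oo, a[ (EFin \o F) by exact: (@integrableS _ _ _ mu [set: R]).
have iFab : mu.-integrable `]a, b[ (EFin \o F) by exact: (@integrableS _ _ _ mu [set: R]).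
have := @Rintegral_itvB R F -oo%O (BLeft b) a iFb.
rewrite !bnd_simp => /(_ isT ab) <-.
by rewrite /prim (Rintegral_itv_bndo_bndc iFa).
Qed.

Lemma prim_le F a b : mu.-integrable [set: R] (EFin \o F) -> (forall s, 0 <= F s) ->
  a <= b -> prim F a <= prim F b.
Proof.
move=> iF F0 ab; rewrite -subr_ge0 -(primB iF ab).
by apply: Rintegral_ge0 => s _.
Qed.

Lemma prim_ge0 F a : (forall s, 0 <= F s) -> 0 <= prim F a.
Proof. by move=> F0; apply: Rintegral_ge0 => s _. Qed.

Lemma prim_le_total F a : mu.-integrable [set: R] (EFin \o F) -> (forall s, 0 <= F s) ->
  prim F a <= \int[mu]_s F s.
Proof.
move=> iF F0; apply: fine_le; [|exact: integrable_fin_num _ iF|].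
  by apply: integrable_fin_num => //; exact: (@integrableS _ _ _ mu [set: R]).
apply: ge0_subset_integral => //; first by case/integrableP : iF.
by move=> s _; rewrite lee_fin.
Qed.

Lemma prim_continuous F : mu.-integrable [set: R] (EFin \o F) -> continuous (prim F).
Proof.
move=> iF t; apply/cvgrPdist_lt => e e0.
have [d [d0 hd]] := integral_normr_continuous iF e0.
have key a b : a <= b -> b - a < d -> `|prim F b - prim F a| < e.
  move=> ab bad; rewrite -(primB iF ab).
  have iFab : mu.-integrable `]a, b[ (EFin \o F) by exact: (@integrableS _ _ _ mu [set: R]).
  apply: le_lt_trans (le_normr_Rintegral _ iFab) _ => //.
  have hm : (mu `]a, b[ < d%:E)%E.
    by rewrite lebesgue_measure_itv/= lte_fin; case: ifP => _; rewrite -?EFinD lte_fin.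
  exact: hd _ hm.
exists d => //= s; rewrite /ball/= => ts.
have [st|ts'] := leP s t.
  by apply: key => //; apply: le_lt_trans ts; exact: ler_norm.
rewrite distrC; apply: key; first exact: ltW.
by apply: le_lt_trans ts; rewrite distrC; exact: ler_norm.
Qed.

Lemma Rintegral_itv_oo_cc F a b : mu.-integrable `[a, b] (EFin \o F) ->
  \int[mu]_(t in `]a, b[) F t = \int[mu]_(t in `[a, b]) F t.
Proof.
move=> i.
have i1 : mu.-integrable `]a, b[ (EFin \o F).
  by apply: (@integrableS _ _ _ mu `[a, b]) => //; exact: subset_itv_oo_cc.
have i2 : mu.-integrable `]a, b] (EFin \o F).
  by apply: (@integrableS _ _ _ mu `[a, b]) => //; exact: subset_itv_oc_cc.
by rewrite (Rintegral_itv_bndo_bndc i1) (Rintegral_itv_obnd_cbnd i2).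
Qed.

Lemma Rintegral_translate S a b p : continuous S -> a <= b ->
  \int[mu]_(t in `]a, b[) S (t - p) = \int[mu]_(t in `]a - p, b - p[) S t.
Proof.
move=> cS ab; pose H t := t - p.
have dH t : is_derive t 1 H 1.
  by rewrite -[X in is_derive _ _ _ X]subr0; apply: is_deriveB.
have H1 : derive1 H = cst 1 by apply/funext => t; rewrite derive1E; exact: derive_val.
have cH : continuous H.
  by move=> t; apply: cvgB; [exact: cvg_id|exact: cvg_cst].
have := @integration_by_substitution_increasing R H S a b ab.
have iS c d : mu.-integrable `[c, d] (EFin \o S).
  by apply: continuous_compact_integrable; [exact: segment_compact|exact: continuous_subspaceT].
have iSH c d : mu.-integrable `[c, d] (EFin \o (fun t => S (t - p))).
  apply: continuous_compact_integrable; first exact: segment_compact.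
  by apply: continuous_subspaceT => t; apply: continuous_comp; [exact: cH|exact: cS].
rewrite (Rintegral_itv_oo_cc (iS _ _)) (Rintegral_itv_oo_cc (iSH _ _)).
rewrite H1 => sub; rewrite /Rintegral sub//.
- by congr fine; apply: eq_integral => t _ /=; rewrite mulr1.
- by move=> x y _ _ xy; rewrite ltrD2r.
- by move=> x _; exact: cst_continuous.
- exact: is_cvg_cst.
- exact: is_cvg_cst.
- split; first by move=> x _; exact: ex_derive.
  + by apply: cvg_at_right_filter; exact: cH.
  + by apply: cvg_at_left_filter; exact: cH.
- exact: continuous_subspaceT.
Qed.

Lemma continuous_integrable_oo S a b : continuous S -> mu.-integrable `]a, b[ (EFin \o S).
Proof.
move=> cS; apply: (@integrableS _ _ _ mu `[a, b]) => //; first exact: subset_itv_oo_cc.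
by apply: continuous_compact_integrable; [exact: segment_compact|exact: continuous_subspaceT].
Qed.

Lemma translation_arith (x y z w v a1 a2 a3 a4 : R) : v = x + y -> v = z + w -> 0 <= x ->
  w <= a1 * (a2 - a3 - (a2 - a4)) -> y - z <= (a4 - a3) * a1.
Proof. by move=> ? ? ? ?; lra. Qed.

(** After translation the two integrals run over ]-p, t - p[ and ]-q, t - q[. The common part
    cancels: what remains is the integral over ]t - q, t - p[ minus a nonnegative one over ]-q,
    -p[. *)
Lemma translation_difference_le S p q t : continuous S -> {homo S : x y / x <= y} ->
  (forall s, 0 <= S s) -> p <= q -> 0 <= t ->
  \int[mu]_(s in `]0, t[) (S (s - p) - S (s - q)) <= (q - p) * S (t - p).
Proof.
move=> cS mS S0 pq t0.
have q1 : - q <= - p <= t - p by apply/andP; split; lra.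
have q2 : - q <= t - q <= t - p by apply/andP; split; lra.
have /andP[_ q3] := q2.
have cSp r : continuous (fun s => S (s - r)).
  by move=> s; apply: continuous_comp; [apply: cvgB; [exact: cvg_id|exact: cvg_cst]|exact: cS].
rewrite (RintegralB _ (continuous_integrable_oo _ _ (cSp p)) (continuous_integrable_oo _ _ (cSp q)))//.
rewrite !Rintegral_translate// !sub0r.
have e1 := @Rintegral_itv_split _ S (- q) (- p) (t - p).
have e2 := @Rintegral_itv_split _ S (- q) (t - q) (t - p).
have i := continuous_integrable_oo (- q) (t - p) cS.
have {}e1 := e1 _ i; have {}e2 := e2 _ i.
have h1 : 0 <= \int[mu]_(s in `]- q, - p[) S s by exact: Rintegral_ge0.
have h2 : \int[mu]_(s in `]t - q, t - p[) S s <= S (t - p) * (t - p - (t - q)).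
  rewrite -Rintegral_cst_oo//.
  apply: le_Rintegral => //; [exact: continuous_integrable_oo|exact: integrable_cst_oo|].
  by move=> s; rewrite /= in_itv/= => /andP[_ /ltW]; exact: mS.
have {}e1 := e1 q1; have {}e2 := e2 q2.
exact: translation_arith e1 e2 h1 h2.
Qed.

End primitives.

(** * Translation defect of a set of times *)

Section averaging.
Context {R : realType}.
Local Notation mu := (@lebesgue_measure R).
Implicit Types (e : R -> R) (A : set R) (s t h tau : R).

(** The jump of the indicator accumulated over the past window of length 2h, the one used for
    averaging; it is o(h) at Lebesgue points. *)
Definition translation_defect A h tau : R :=
  \int[mu]_(s in `]tau - 2 * h, tau[) `|\1_A s - \1_A tau|.

(** For fixed tau the jump is affine in [\1_A s], so the translation defect is expressed by the
    continuous primitive of the indicator and is measurable in tau. *)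
Lemma indic_diff A s tau :
  `|\1_A s - \1_A tau| = \1_A tau + (1 - 2 * \1_A tau) * \1_A s :> R.
Proof.
rewrite !indicE; case: (s \in A); case: (tau \in A) => /=;
  rewrite ?subrr ?subr0 ?sub0r ?normrN ?normr0 ?normr1; lra.
Qed.

Lemma integrable_indic_sub A (a b : R) : measurable A -> A `<=` `]a, b[ ->
  mu.-integrable [set: R] (EFin \o (\1_A : R -> R)).
Proof.
move=> mA Aab; apply: (le_integrable_R _ _ _ (integrable_indic_itv a b false true)) => //.
move=> s _; rewrite ger0_norm// !indicE.
have [sA|sA] := boolP (s \in A) => //.
by rewrite (mem_set (Aab _ (set_mem sA))).
Qed.

Lemma integrable_jump A tau (a b : R) : measurable A ->
  mu.-integrable `]a, b[ (EFin \o (fun s => `|\1_A s - \1_A tau| : R)).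
Proof.
move=> mA; apply: (le_integrable_R _ _ _ (integrable_cst_oo 1 a b)) => //.
  apply: measurableT_comp => //.
  by apply: measurable_funB => //; apply: measurable_funTS; exact: measurable_indic.
move=> s _; rewrite normr_id !indicE; case: (s \in A); case: (tau \in A) => /=;
  by rewrite ?subrr ?subr0 ?sub0r ?normrN ?normr0 ?normr1.
Qed.

Lemma translation_defectE A h tau : measurable A -> 0 <= h ->
  mu.-integrable [set: R] (EFin \o (\1_A : R -> R)) ->
  translation_defect A h tau =
  \1_A tau * (2 * h) + (1 - 2 * \1_A tau) * (prim \1_A tau - prim \1_A (tau - 2 * h)).
Proof.
move=> mA h0 iA; rewrite /translation_defect.
under eq_Rintegral => s _ do rewrite indic_diff.
have le : tau - 2 * h <= tau by lra.
rewrite -(primB iA le).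
have iA' : mu.-integrable `]tau - 2 * h, tau[ (EFin \o (\1_A : R -> R)).
  exact: (@integrableS _ _ _ mu [set: R]).
have i1 : mu.-integrable `]tau - 2 * h, tau[ (EFin \o (fun s => (1 - 2 * \1_A tau) * \1_A s : R)).
  exact: (integrableZl _ _ iA').
rewrite (RintegralD _ (integrable_cst_oo _ _ _) i1)// (RintegralZl _ _ iA')// Rintegral_cst_oo//.
by congr (_ * _ + _); lra.
Qed.

Lemma translation_defect_bound A h tau : measurable A -> 0 <= h ->
  0 <= translation_defect A h tau <= 2 * h.
Proof.
move=> mA h0; rewrite Rintegral_ge0//=.
have -> : 2 * h = 1 * (tau - (tau - 2 * h)) by lra.
rewrite -Rintegral_cst_oo; last by lra.
apply: le_Rintegral => //; [exact: integrable_jump|exact: integrable_cst_oo|].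
move=> s _; rewrite !indicE; case: (s \in A); case: (tau \in A) => /=;
  by rewrite ?subrr ?subr0 ?sub0r ?normrN ?normr0 ?normr1.
Qed.

Lemma measurable_translation_defect A h (D : set R) : measurable A -> 0 <= h ->
  mu.-integrable [set: R] (EFin \o (\1_A : R -> R)) ->
  measurable_fun D (translation_defect A h).
Proof.
move=> mA h0 iA; apply: measurable_funTS.
have -> : translation_defect A h = fun tau =>
  \1_A tau * (2 * h) + (1 - 2 * \1_A tau) * (prim \1_A tau - prim \1_A (tau - 2 * h)).
  by apply/funext => tau; rewrite translation_defectE.
have mI : measurable_fun [set: R] (\1_A : R -> R) by exact: measurable_indic.
have cP := prim_continuous iA.
apply: measurable_funD; first exact: measurable_funM.
apply: measurable_funM; first by apply: measurable_funB => //; exact: measurable_funM.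
have cPh : continuous (fun tau => prim \1_A (tau - 2 * h)).
  move=> s; apply: (@continuous_comp _ _ _ (fun tau => tau - 2 * h) (prim \1_A)); last exact: cP.
  by apply: cvgB; [exact: cvg_id|exact: cvg_cst].
by apply: measurable_funB; apply: continuous_measurable_fun.
Qed.

(** The window is the left half of the ball of radius 2h, which has length 4h; hence the tolerance
    eps / 4 on the mean oscillation. *)
Lemma translation_defect_small A tau : measurable A -> lebesgue_pt (\1_A : R -> R) tau ->
  forall eps, 0 < eps -> exists2 del, 0 < del &
    forall h, 0 < h -> h < del -> translation_defect A h tau < eps * h.
Proof.
move=> mA pt eps eps0.
have e40 : 0 < eps / 4 by lra.
have [del del0 hdel] := lebesgue_ptP pt e40.
exists (del / 2); first lra.
move=> h h0 hd; have h20 : 0 < 2 * h by lra.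
have h2d : 2 * h < del by lra.
have := hdel _ h20 h2d.
have mur : mu `]tau - 2 * h, tau + 2 * h[ = (4 * h)%:E.
  rewrite lebesgue_measure_itv /= lte_fin ifT; last by lra.
  by rewrite -EFinD; congr EFin; ring.
rewrite /davg /iavg ball_itv mur inver ifF; last by apply/negbTE; rewrite mulf_neq0// gt_eqF.
have ii := integrable_jump tau (tau - 2 * h) (tau + 2 * h) mA.
have fin := integrable_fin_num _ ii.
rewrite -[X in (_ * X)%E]fineK; last by apply: fin.
rewrite -EFinM lte_fin mulrC ltr_pdivrMr; last by lra.
have -> : eps / 4 * (4 * h) = eps * h by lra.
apply: le_lt_trans.
have sp : tau - 2 * h <= tau <= tau + 2 * h by apply/andP; split; lra.
suff : translation_defect A h tau <=
    \int[mu]_(y in `]tau - 2 * h, tau + 2 * h[) `|\1_A y - \1_A tau| by [].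
by rewrite (Rintegral_itv_split sp ii) lerDl; exact: Rintegral_ge0.
Qed.

End averaging.

(** * One step of the averaged inequality *)

Section averaged_gronwall.
Context {R : realType}.
Local Notation mu := (@lebesgue_measure R).
Implicit Types (s t h tau : R).

Lemma Rintegral_linear (D : set R) (x1 x2 : R) (f1 f2 : R -> R) : measurable D ->
  mu.-integrable D (EFin \o f1) -> mu.-integrable D (EFin \o f2) ->
  mu.-integrable D (EFin \o (fun s => x1 * f1 s + x2 * f2 s)) /\
  \int[mu]_(s in D) (x1 * f1 s + x2 * f2 s) =
    x1 * \int[mu]_(s in D) f1 s + x2 * \int[mu]_(s in D) f2 s.
Proof.
move=> mD i1 i2.
have j1 : mu.-integrable D (EFin \o (fun s => x1 * f1 s)) by exact: (integrableZl _ _ i1).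
have j2 : mu.-integrable D (EFin \o (fun s => x2 * f2 s)) by exact: (integrableZl _ _ i2).
split; first exact: (integrableD _ j1 j2).
by rewrite (RintegralD _ j1 j2)// (RintegralZl _ _ i1)// (RintegralZl _ _ i2).
Qed.

Lemma Rintegral_sum_seq I (r : seq I) (D : set R) (f : I -> R -> R) : measurable D ->
  (forall i, mu.-integrable D (EFin \o f i)) ->
  mu.-integrable D (EFin \o (fun s => \sum_(i <- r) f i s)) /\
  \int[mu]_(s in D) (\sum_(i <- r) f i s) = \sum_(i <- r) \int[mu]_(s in D) f i s.
Proof.
move=> mD fi; elim: r => [|i r [IH1 IH2]].
  have -> : (fun s => \sum_(i <- [::]) f i s) = cst 0.
    by apply/funext => s; rewrite big_nil.
  by rewrite big_nil /Rintegral integral0_eq//; split => //; exact: integrable0.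
have -> : (fun s => \sum_(j <- i :: r) f j s) = (fun s => f i s + \sum_(j <- r) f j s).
  by apply/funext => s; rewrite big_cons.
by rewrite big_cons -IH2 -(RintegralD _ (fi i) IH1)//; split => //; exact: (integrableD _ (fi i) IH1).
Qed.

Lemma Rintegral_suffix_le (b : R -> R) (p q r : R) : p <= q <= r ->
  mu.-integrable `]p, r[ (EFin \o b) -> (forall s, 0 <= b s) ->
  \int[mu]_(s in `]q, r[) b s <= \int[mu]_(s in `]p, r[) b s.
Proof.
by move=> pqr ib b0; rewrite (Rintegral_itv_split pqr ib) lerDr; exact: Rintegral_ge0.
Qed.

Lemma prim_eq0 (F : R -> R) t : (forall s, s <= 0 -> F s = 0) -> t <= 0 -> prim F t = 0.
Proof.
move=> F0 t0; rewrite /prim /Rintegral integral0_eq// => s; rewrite /= in_itv/= => st.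
by rewrite F0// ltW// (lt_le_trans st).
Qed.

Lemma prim_step_arith (h c1 C3 eta q SF Ig Ie J IF Ig' Ie' SFh ISF ISe IJ : R) :
  0 < h -> 0 <= c1 -> 0 <= C3 -> 0 < eta -> 0 <= q ->
  IF = SF -> Ig' <= Ig -> Ie' <= Ie -> ISF <= h * SFh -> ISe <= 2 * h * Ie -> IJ <= J ->
  h * IF <= 1 * ISF + h * (2 * h * (1 * (c1 * IF + C3 * eta * Ig') + 4 * q * Ie') +
    q * (2 * ISe + 4 * IJ)) ->
  SF - SFh <= h * (2 * c1 * SF + 2 * C3 * eta * Ig + 12 * q * Ie) + 4 * q * J.
Proof.
move=> h0 c10 C30 eta0 q0 -> b1 b2 b3 b4 b5 le.
rewrite -(ler_pM2l h0).
have p1 := ler_wpM2l (mulr_ge0 (mulr_ge0 (ltW h0) (ltW h0)) (mulr_ge0 C30 (ltW eta0))) b1.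
have p2 := ler_wpM2l (mulr_ge0 (mulr_ge0 (ltW h0) (ltW h0)) q0) b2.
have p3 := ler_wpM2l (mulr_ge0 (ltW h0) q0) b4.
have p4 := ler_wpM2l (mulr_ge0 (ltW h0) q0) b5.
lra.
Qed.

Section one_approximation.
Variables (T c1 C2 C3 eta : R) (F g e : R -> R) (n : nat) (A : 'I_n -> set R) (kap : 'I_n -> R).
Hypotheses (c10 : 0 <= c1) (C20 : 0 <= C2) (C30 : 0 <= C3) (eta0 : 0 < eta).
Hypotheses (iF : mu.-integrable [set: R] (EFin \o F)) (F0 : forall s, 0 <= F s).
Hypothesis Fneg : forall s, s <= 0 -> F s = 0.
Hypotheses (ig : mu.-integrable [set: R] (EFin \o g)) (g0 : forall s, 0 <= g s).
Hypotheses (ie : mu.-integrable [set: R] (EFin \o e)) (e0 : forall s, 0 <= e s).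
Hypotheses (mA : forall i, measurable (A i)) (AT : forall i, A i `<=` `]0, T[).
Hypothesis kap0 : forall i, 0 <= kap i.
Hypothesis main : {ae mu, forall tau, 0 < tau < T ->
  let b := rate c1 C2 C3 eta (F tau) (g tau) e A kap tau in
  F tau <= \int[mu]_(t in `]0, tau[) b t /\
  {ae mu, forall s, 0 < s < tau -> F tau <= F s + \int[mu]_(t in `]s, tau[) b t}}.

Let b tau := rate c1 C2 C3 eta (F tau) (g tau) e A kap tau.
Let J h tau := \sum_(i < n) kap i * translation_defect (A i) h tau.
Let q := C2 / eta.

Lemma q_ge0 : 0 <= q. Proof. by rewrite divr_ge0// ltW. Qed.

Lemma rate_ge0 tau s : 0 <= b tau s.
Proof.
rewrite /b /rate -/q; have q0 := q_ge0.
have j0 : 0 <= jump A kap s tau by apply: sumr_ge0 => i _; rewrite mulr_ge0.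
apply: addr_ge0; first by rewrite addr_ge0// !mulr_ge0// ltW.
by rewrite mulr_ge0// !addr_ge0// mulr_ge0.
Qed.

Lemma integral_rate h tau : 0 < h ->
  mu.-integrable `]tau - 2 * h, tau[ (EFin \o b tau) /\
  \int[mu]_(s in `]tau - 2 * h, tau[) b tau s =
    2 * h * (c1 * F tau + C3 * eta * g tau + q * (4 * e tau)) +
    q * (2 * (prim e tau - prim e (tau - 2 * h)) + 4 * J h tau).
Proof.
move=> h0; have le : tau - 2 * h <= tau by lra.
have ie' : mu.-integrable `]tau - 2 * h, tau[ (EFin \o e) by exact: (@integrableS _ _ _ mu [set: R]).
have ij i : mu.-integrable `]tau - 2 * h, tau[
    (EFin \o (fun s => kap i * `|\1_(A i) s - \1_(A i) tau|)).
  exact: (integrableZl _ _ (integrable_jump tau _ _ (mA i))).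
have [k1 k2] := Rintegral_sum_seq (index_enum _) (measurable_itv _) ij.
have [k3 k4] := Rintegral_linear 2 4 (measurable_itv _) ie' k1.
set K := c1 * F tau + C3 * eta * g tau + q * (4 * e tau).
have [k5 k6] := Rintegral_linear K q (measurable_itv _) (integrable_cst_oo 1 (tau - 2 * h) tau) k3.
have -> : b tau = fun s => K * 1 + q * (2 * e s + 4 * jump A kap s tau).
  by apply/funext => s; rewrite /b /rate /K /q; ring.
split; first exact: k5.
transitivity (K * (1 * (tau - (tau - 2 * h))) + q * (2 * (prim e tau - prim e (tau - 2 * h)) + 4 * J h tau)).
  rewrite [LHS]k6 k4 k2 Rintegral_cst_oo// -(primB ie le).
  congr (_ + q * (_ + 4 * _)); apply: eq_bigr => i _.
  by rewrite (RintegralZl _ _ (integrable_jump tau _ _ (mA i))).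
by congr (_ + _); ring.
Qed.

(** The inequality between s and tau is integrated over s in ]tau - 2h, tau -
    h[, after enlarging ]s, tau[ to ]tau - 2h, tau[ as the rate is nonnegative. Averaging up to tau
    instead would bring back the primitive at t itself after integration in tau, and the difference
    to be estimated would cancel. *)
Lemma averaged_inequality h : 0 < h -> {ae mu, forall tau, 0 < tau < T ->
  h * F tau <= prim F (tau - h) - prim F (tau - 2 * h) +
    h * \int[mu]_(s in `]tau - 2 * h, tau[) b tau s}.
Proof.
move=> h0; apply: (ae_imp main) => tau H tT.
have [H1 H2] := H tT; have /andP[tau0 _] := tT.
have [ib _] := integral_rate tau h0.
set B := \int[mu]_(s in _) _.
have le : tau - 2 * h <= tau - h by lra.
have iF' : mu.-integrable `]tau - 2 * h, tau - h[ (EFin \o F) by exact: (@integrableS _ _ _ mu [set: R]).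
have cst1 (c : R) : \int[mu]_(s in `]tau - 2 * h, tau - h[) c = h * c.
  by rewrite Rintegral_cst_oo//; ring.
rewrite -(primB iF le) -!cst1 -(RintegralD _ iF' (integrable_cst_oo _ _ _))//.
apply: ae_le_Rintegral => //; [exact: integrable_cst_oo|exact: (integrableD _ iF' (integrable_cst_oo _ _ _))|].
apply: (ae_imp H2) => s hs; rewrite /= in_itv/= => /andP[s1 s2].
(* For s <= 0 the extended energy is 0 and the inequality starting from the initial time takes
   over. *)
have [s0|s0] := leP s 0.
  rewrite (Fneg s0) add0r; apply: le_trans H1 _; apply: Rintegral_suffix_le => //.
    by apply/andP; split; lra.
  exact: rate_ge0.
apply: le_trans (hs _) _; first by apply/andP; split; lra.
rewrite lerD2l; apply: Rintegral_suffix_le => //; first by apply/andP; split; lra.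
exact: rate_ge0.
Qed.

Let iA i : mu.-integrable [set: R] (EFin \o (\1_(A i) : R -> R)).
Proof. exact: integrable_indic_sub (mA i) (@AT i). Qed.

Lemma integrable_defect i h (x y : R) : 0 <= h ->
  mu.-integrable `]x, y[ (EFin \o translation_defect (A i) h).
Proof.
move=> h0; apply: (le_integrable_R _ _ _ (integrable_cst_oo (2 * h) x y)) => //.
  exact: measurable_translation_defect.
move=> s _; have /andP[d1 d2] := translation_defect_bound s (mA i) h0.
by rewrite ger0_norm.
Qed.

Lemma integral_defects h (x y : R) : 0 <= h ->
  mu.-integrable `]x, y[ (EFin \o J h) /\
  \int[mu]_(s in `]x, y[) J h s =
    \sum_(i < n) kap i * \int[mu]_(s in `]x, y[) translation_defect (A i) h s.
Proof.
move=> h0.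
have ij i : mu.-integrable `]x, y[ (EFin \o (fun s => kap i * translation_defect (A i) h s)).
  exact: (integrableZl _ _ (integrable_defect i x y h0)).
have [k1 k2] := Rintegral_sum_seq (index_enum _) (measurable_itv _) ij.
split; first exact: k1.
rewrite [LHS]k2; apply: eq_bigr => i _.
by rewrite (RintegralZl _ _ (integrable_defect i x y h0)).
Qed.

Lemma J_ge0 h s : 0 <= h -> 0 <= J h s.
Proof.
move=> h0; apply: sumr_ge0 => i _; rewrite mulr_ge0//.
by have /andP[] := translation_defect_bound s (mA i) h0.
Qed.

(** Integrating the averaged inequality over tau in ]0, t[ gives h prim F t on the left and, by
    [translation_difference_le] with shifts h and 2h, at most h prim F (t - h) on the right. The
    coefficient 12 is 8 from e(tau) plus 4 from e(s). *)
Lemma prim_step h t : 0 < h -> 0 <= t <= T ->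
  prim F t - prim F (t - h) <=
  h * (2 * c1 * prim F t + 2 * C3 * eta * (\int[mu]_s g s) + 12 * q * \int[mu]_s e s) +
  4 * q * \int[mu]_(s in `]0, T[) J h s.
Proof.
move=> h0 /andP[t0 tT]; have q0 := q_ge0.
have [h2 h20] : h <= 2 * h /\ 0 <= 2 * h by split; lra.
have iF' : mu.-integrable `]0, t[ (EFin \o F) by exact: (@integrableS _ _ _ mu [set: R]).
have ig' : mu.-integrable `]0, t[ (EFin \o g) by exact: (@integrableS _ _ _ mu [set: R]).
have ie' : mu.-integrable `]0, t[ (EFin \o e) by exact: (@integrableS _ _ _ mu [set: R]).
have cSF := prim_continuous iF; have cSe := prim_continuous ie.
have mSF : {homo prim F : x y / x <= y} by move=> x y; exact: prim_le.
have mSe : {homo prim e : x y / x <= y} by move=> x y; exact: prim_le.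
have cshift (S : R -> R) r r' : continuous S -> continuous (fun s => S (s - r) - S (s - r')).
  move=> cS s; apply: cvgB.
    apply: (@continuous_comp _ _ _ (fun tau => tau - r) S); last exact: cS.
    by apply: cvgB; [exact: cvg_id|exact: cvg_cst].
  apply: (@continuous_comp _ _ _ (fun tau => tau - r') S); last exact: cS.
  by apply: cvgB; [exact: cvg_id|exact: cvg_cst].
have iSF := continuous_integrable_oo 0 t (cshift _ h (2 * h) cSF).
have iSe := continuous_integrable_oo 0 t (cshift _ 0 (2 * h) cSe).
have [iJ _] := integral_defects 0 t (ltW h0).
have [iJT _] := integral_defects 0 T (ltW h0).
have [l1 v1] := Rintegral_linear c1 (C3 * eta) (measurable_itv _) iF' ig'.
have [l2 v2] := Rintegral_linear 1 (4 * q) (measurable_itv _) l1 ie'.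
have [l3 v3] := Rintegral_linear 2 4 (measurable_itv _) iSe iJ.
have [l4 v4] := Rintegral_linear (2 * h) q (measurable_itv _) l2 l3.
have [l5 v5] := Rintegral_linear 1 h (measurable_itv _) iSF l4.
have ihF : mu.-integrable `]0, t[ (EFin \o (fun s => h * F s)) by exact: (integrableZl _ _ iF').
have : \int[mu]_(s in `]0, t[) (h * F s) <= \int[mu]_(s in `]0, t[)
   (1 * (prim F (s - h) - prim F (s - 2 * h)) + h * (2 * h * (1 * (c1 * F s + C3 * eta * g s)
    + 4 * q * e s) + q * (2 * (prim e (s - 0) - prim e (s - 2 * h)) + 4 * J h s))).
  apply: (ae_le_Rintegral _ ihF l5) => //.
  apply: (ae_imp (averaged_inequality h0)) => s hs; rewrite /= in_itv/= => /andP[s0 st].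
  apply: le_trans (hs _) _; first by rewrite s0 (lt_le_trans st).
  have [_ ->] := integral_rate s h0; rewrite subr0 le_eqVlt; apply/orP; left; apply/eqP.
  move: (J h s) (prim _ _) (prim _ _) (prim _ _) (prim _ _) => x y z y' z'; ring.
rewrite v5 v4 v3 v2 v1 (RintegralZl _ _ iF')//.
have bF : \int[mu]_(s in `]0, t[) F s = prim F t.
  by rewrite (primB iF t0) (prim_eq0 Fneg (lexx 0)) subr0.
have sub (f : R -> R) : mu.-integrable [set: R] (EFin \o f) -> (forall s, 0 <= f s) ->
    \int[mu]_(s in `]0, t[) f s <= \int[mu]_s f s.
  move=> jf f0; rewrite (primB jf t0); apply: le_trans (prim_le_total t jf f0).
  by rewrite lerBlDr lerDl prim_ge0.
have bg := sub _ ig g0; have be := sub _ ie e0.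
have bSF : \int[mu]_(s in `]0, t[) (prim F (s - h) - prim F (s - 2 * h)) <= h * prim F (t - h).
  have -> : h * prim F (t - h) = (2 * h - h) * prim F (t - h) by ring.
  by apply: translation_difference_le => // s; exact: prim_ge0.
have bSe : \int[mu]_(s in `]0, t[) (prim e (s - 0) - prim e (s - 2 * h)) <= 2 * h * \int[mu]_s e s.
  apply: (@le_trans _ _ ((2 * h - 0) * prim e (t - 0))).
    by apply: translation_difference_le => // s; exact: prim_ge0.
  by rewrite !subr0 ler_wpM2l// prim_le_total.
have bJ : \int[mu]_(s in `]0, t[) J h s <= \int[mu]_(s in `]0, T[) J h s.
  have sp : 0 <= t <= T by rewrite t0.
  rewrite (Rintegral_itv_split sp iJT) lerDl; apply: Rintegral_ge0 => s _.
  exact: J_ge0 (ltW h0).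
exact: (prim_step_arith h0 c10 C30 eta0 q0 bF bg be bSF bSe bJ).
Qed.

End one_approximation.
End averaged_gronwall.

(** * Vanishing time step and Gronwall's conclusion *)

Section gronwall_conclusion.
Context {R : realType}.
Local Notation mu := (@lebesgue_measure R).
Implicit Types (s t h tau : R).

(** The quotients by [h_ n] are bounded by 2 and tend to 0 at the Lebesgue points of the indicator,
    so domination applies. This is where translations become continuous in the mean. *)
Lemma defect_integral_small (T : R) (A : set R) (h_ : nat -> R) : measurable A ->
  A `<=` `]0, T[ -> (forall n, 0 < h_ n) -> h_ n @[n --> \oo] --> 0 ->
  (h_ n)^-1 * \int[mu]_(s in `]0, T[) translation_defect A (h_ n) s @[n --> \oo] --> 0.
Proof.
move=> mA AT h0 hcv.
have iA := integrable_indic_sub mA AT.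
have hge n := ltW (h0 n).
have md n : measurable_fun (`]0, T[%classic : set R) (translation_defect A (h_ n)).
  exact: measurable_translation_defect.
have id n : mu.-integrable `]0, T[ (EFin \o translation_defect A (h_ n)).
  apply: (le_integrable_R _ (md n) _ (integrable_cst_oo (2 * h_ n) 0 T)) => // s _.
  by have /andP[d1 d2] := translation_defect_bound s mA (hge n); rewrite ger0_norm.
have bd n s : 0 <= (h_ n)^-1 * translation_defect A (h_ n) s <= 2.
  have /andP[d1 d2] := translation_defect_bound s mA (hge n).
  by rewrite mulr_ge0 ?invr_ge0//= mulrC ler_pdivrMr.
have -> : (fun n => (h_ n)^-1 * \int[mu]_(s in `]0, T[) translation_defect A (h_ n) s) =
    (fun n => \int[mu]_(s in `]0, T[) ((h_ n)^-1 * translation_defect A (h_ n) s)).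
  by apply/funext => n; rewrite (RintegralZl _ _ (id n)).
have z0 : \int[mu]_(t in `]0, T[) (cst 0 t : R) = 0 by rewrite /Rintegral integral0_eq.
rewrite -[X in _ --> X]z0.
apply: (@Rdominated_convergence R _ (fun n s => (h_ n)^-1 * translation_defect A (h_ n) s) (cst 0) (cst 2)) => //.
- by move=> n; apply: measurable_funM.
- have lA : locally_integrable `]0, T[ (\1_A : R -> R).
    apply: open_integrable_locally; first exact: interval_open.
    exact: (@integrableS _ _ _ mu [set: R]).
  apply: (ae_imp (ae_lebesgue_pt lA)) => s pt; rewrite /= in_itv/= => sT.
  have {}pt := pt sT; apply/cvgrPdist_lt => eps eps0.
  have [del del0 hdel] := translation_defect_small mA pt eps0.
  have : \forall n \near \oo, h_ n < del by exact: (@cvgr_lt _ _ _ _ _ 0 hcv).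
  apply: filterS => n hn; rewrite sub0r normrN.
  have /andP[b1 _] := bd n s; rewrite ger0_norm// mulrC ltr_pdivrMr//.
  exact: hdel.
- exact: integrable_cst_oo.
- apply: aeW => s _ n; have /andP[b1 b2] := bd n s; by rewrite ger0_norm.
Qed.

Lemma telescope_le (S : R -> R) (t1 t c d : R) (N : nat) : t1 <= t ->
  (forall s, t1 <= s <= t -> S s - S (s - (t - t1) / N.+1%:R) <= (t - t1) / N.+1%:R * c + d) ->
  S t - S t1 <= (t - t1) * c + N.+1%:R * d.
Proof.
move=> t1t; set h := (t - t1) / N.+1%:R => H.
have N0 : 0 < N.+1%:R :> R by rewrite ltr0n.
have hN : h * N.+1%:R = t - t1 by rewrite /h divfK// gt_eqF.
have h0 : 0 <= h by rewrite divr_ge0 ?subr_ge0// ltW.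
have ind j : (j <= N.+1)%N -> S (t1 + j%:R * h) - S t1 <= j%:R * (h * c + d).
  elim: j => [|j IH] jN; first by rewrite !mul0r addr0 subrr.
  have {}IH := IH (ltnW jN).
  have jN' : j.+1%:R <= N.+1%:R :> R by rewrite ler_nat.
  have jh : j.+1%:R * h <= t - t1 by rewrite -hN [leRHS]mulrC ler_wpM2r.
  have j0 : 0 <= j.+1%:R * h by rewrite mulr_ge0.
  have /H : t1 <= t1 + j.+1%:R * h <= t by apply/andP; split; lra.
  have -> : t1 + j.+1%:R * h - h = t1 + j%:R * h by rewrite -natr1; ring.
  move: IH; rewrite -natr1; move: (S _) (S _) (S _) => x y z; lra.
have := ind _ (leqnn _); rewrite mulrC hN [t1 + _]addrC subrK mulrDr mulrA [_ * h]mulrC hN.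
by [].
Qed.

(** Advance by steps of length [d] with d c <= 1/2: if S vanishes at the start of a step, then S t
    <= S t / 2 at its end. *)
Lemma gronwall_null (S : R -> R) (T c : R) : 0 <= T -> 0 <= c -> S 0 = 0 ->
  (forall t, 0 <= S t) ->
  (forall t1 t, 0 <= t1 -> t1 <= t -> t <= T -> S t - S t1 <= (t - t1) * (c * S t)) ->
  S T = 0.
Proof.
move=> T0 c0 S0 Spos H.
pose d := (2 * (c + 1))^-1.
have c1 : 0 < 2 * (c + 1) by lra.
have d0 : 0 < d by rewrite invr_gt0.
have dc : d * c <= 1 / 2 by rewrite mulrC ler_pdivrMr//; lra.
have ind j : S (Num.min (j%:R * d) T) = 0.
  elim: j => [|j IH]; first by rewrite mul0r min_l.
  set t1 := Num.min (j%:R * d) T in IH *; set t := Num.min _ _.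
  have t10 : 0 <= t1 by rewrite le_min T0 mulr_ge0// ltW.
  have jd : j%:R * d <= j.+1%:R * d by rewrite ler_wpM2r ?ler_nat// ltW.
  have t1t : t1 <= t by rewrite le_min !ge_min jd lexx orbT.
  have tT : t <= T by rewrite ge_min lexx orbT.
  have td : t - t1 <= d.
    rewrite /t /t1 -natr1 mulrDl mul1r; move: (j%:R * d) => x.
    by rewrite /Num.min; case: ifPn => h1; case: ifPn => h2; move: h1 h2; rewrite -?leNgt; lra.
  have := H _ _ t10 t1t tT; rewrite IH subr0 => h1.
  have h2 : (t - t1) * (c * S t) <= d * (c * S t) by rewrite ler_wpM2r// mulr_ge0.
  have h3 : d * (c * S t) <= 1 / 2 * S t by rewrite mulrA ler_wpM2r.
  by apply/eqP; rewrite eq_le Spos andbT; lra.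
have [j _ /(_ j (leqnn j)) /= hj] : \forall j \near \oo, T / d <= j%:R.
  exact: nbhs_infty_ger.
have := ind j; rewrite min_r//.
by rewrite -ler_pdivrMr.
Qed.

Lemma final_step_arith (h c1 C3 eta G q Ie C2e Y Ss St Ssh : R) :
  h * c1 * Ss <= h * c1 * St -> h * (q * Ie) <= h * C2e ->
  Ss - Ssh <= h * (2 * c1 * Ss + 2 * C3 * eta * G + 12 * q * Ie) + 4 * q * Y ->
  Ss - Ssh <= h * (2 * c1 * St + 2 * C3 * eta * G + 12 * C2e) + 4 * q * Y.
Proof. by move=> p1 p2 p3; lra. Qed.

(* The hypothesis compares F at almost all pairs of times only. Averaging it over s
   in ]tau - 2h, tau - h[ and integrating over tau leaves nothing but translates of
   primitives, and the jump terms are o(h) at Lebesgue points of the sets A i. *)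
Lemma averaged_gronwall (T c1 C2 C3 : R) (F g : R -> R) : 0 < T ->
  0 <= c1 -> 0 <= C2 -> 0 <= C3 ->
  mu.-integrable [set: R] (EFin \o F) -> (forall s, 0 <= F s) ->
  (forall s, s <= 0 -> F s = 0) ->
  mu.-integrable [set: R] (EFin \o g) -> (forall s, 0 <= g s) ->
  (forall eta eps, 0 < eta <= 1 -> 0 < eps ->
    exists (e : R -> R) n (A : 'I_n -> set R) (kap : 'I_n -> R),
    [/\ mu.-integrable [set: R] (EFin \o e), forall s, 0 <= e s & \int[mu]_s e s < eps] /\
    [/\ forall i, measurable (A i), forall i, A i `<=` `]0, T[, forall i, 0 <= kap i &
      {ae mu, forall tau, 0 < tau < T ->
        let b := rate c1 C2 C3 eta (F tau) (g tau) e A kap tau in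
        F tau <= \int[mu]_(t in `]0, tau[) b t /\
        {ae mu, forall s, 0 < s < tau -> F tau <= F s + \int[mu]_(t in `]s, tau[) b t}}]) ->
  prim F T = 0.
Proof.
move=> T0 c10 C20 C30 iF F0 Fneg ig g0 H.
have S0 : prim F 0 = 0 by exact: prim_eq0.
apply: (@gronwall_null (prim F) T (2 * c1)) => //; [exact: ltW|lra|by move=> t; exact: prim_ge0|].
move=> t1 t t10; rewrite le_eqVlt => /predU1P[->|t1t] tT; first by rewrite !subrr mul0r.
pose G := \int[mu]_s g s.
have G0 : 0 <= G by exact: Rintegral_ge0.
suff key eta : 0 < eta <= 1 -> prim F t - prim F t1 <=
    (t - t1) * (2 * c1 * prim F t) + eta * ((t - t1) * (2 * C3 * G + 12 * C2)).
  apply/ler_addgt0Pr => eps eps0.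
  set K := (t - t1) * (2 * C3 * G + 12 * C2) in key.
  have K0 : 0 <= K.
    by apply: mulr_ge0; [lra|apply: addr_ge0; rewrite ?mulr_ge0].
  (* The remainder is proportional to [eta], so it can be made smaller than any [eps]. *)
  pose eta := Num.min 1 (eps / (K + 1)).
  have K1 : 0 < K + 1 by lra.
  have eta0 : 0 < eta by rewrite lt_min ltr01 divr_gt0.
  have eta1 : eta <= 1 by rewrite ge_min lexx.
  have etaK : eta * K <= eps.
    apply: (@le_trans _ _ (eps / (K + 1) * K)); first by rewrite ler_wpM2r// ge_min lexx orbT.
    by rewrite mulrAC ler_pdivrMr// ler_wpM2l// ?(ltW eps0)//; lra.
  have /key : 0 < eta <= 1 by rewrite eta0.
  move: (prim F t) (prim F t1) => x y; lra.
move=> eta01; have /andP[eta0 eta1] := eta01.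
have e20 : 0 < eta ^+ 2 by rewrite exprn_gt0.
(* The approximation error enters with a factor C2 / eta; asking for a total below eta^2 leaves C2
   eta. *)
have [e [n [A [kap [[ie e0 eeps] [mA AT kap0 main]]]]]] := H eta _ eta01 e20.
have iA i := integrable_indic_sub (mA i) (AT i).
pose h_ N : R := (t - t1) / N.+1%:R.
have h0 N : 0 < h_ N by rewrite divr_gt0 ?subr_gt0.
have hcv : h_ N @[N --> \oo] --> 0.
  rewrite -(mulr0 (t - t1)); apply: cvgM; [exact: cvg_cst|exact: cvg_harmonic].
pose Y N := \sum_(i < n) kap i * \int[mu]_(s in `]0, T[) translation_defect (A i) (h_ N) s.
have Ycv : (h_ N)^-1 * Y N @[N --> \oo] --> 0.
  have -> : (fun N => (h_ N)^-1 * Y N) = (fun N => \sum_(i < n)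
      kap i * ((h_ N)^-1 * \int[mu]_(s in `]0, T[) translation_defect (A i) (h_ N) s)).
    by apply/funext => N; rewrite /Y mulr_sumr; apply: eq_bigr => i _; rewrite mulrCA.
  rewrite -[X in _ --> X](_ : \sum_(i < n) kap i * (0 : R) = 0); last first.
    by rewrite big1// => i _; rewrite mulr0.
  apply: cvg_big => [|i _]; first exact: add_continuous.
  apply: cvgM; first exact: cvg_cst.
  exact: defect_integral_small.
set q := C2 / eta.
have q0 : 0 <= q by rewrite divr_ge0// ltW.
have qe : q * eta ^+ 2 = C2 * eta by rewrite /q expr2 mulrA divfK// gt_eqF.
(* Each of the N + 1 steps costs 4 q Y, which sums to (t - t1) 4 q Y / h: this is why the defects
   have to be o(h). *)
have step N : prim F t - prim F t1 <=
    (t - t1) * (2 * c1 * prim F t + 2 * C3 * eta * G + 12 * (C2 * eta) + 4 * q * ((h_ N)^-1 * Y N)).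
  have hN : N.+1%:R * h_ N = t - t1 by rewrite /h_ mulrC divfK// pnatr_eq0.
  have -> : (t - t1) * (2 * c1 * prim F t + 2 * C3 * eta * G + 12 * (C2 * eta) + 4 * q * ((h_ N)^-1 * Y N)) =
    (t - t1) * (2 * c1 * prim F t + 2 * C3 * eta * G + 12 * (C2 * eta)) + N.+1%:R * (4 * q * Y N).
    rewrite [LHS]mulrDr; congr (_ + _); rewrite -hN -mulrA; congr (_ * _).
    by rewrite mulrCA mulVKf// gt_eqF.
  apply: telescope_le; first exact: ltW.
  move=> s /andP[s1 s2]; rewrite -/(h_ N).
  have sT : 0 <= s <= T by rewrite (le_trans t10 s1) (le_trans s2 tT).
  have := prim_step c10 C20 C30 eta0 iF F0 Fneg ig g0 ie e0 mA AT kap0 main (h0 N) sT.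
  have [_ ->] := integral_defects kap mA AT 0 T (ltW (h0 N)).
  rewrite -/(Y N) -/q -/G.
  have Sst : prim F s <= prim F t by exact: prim_le.
  have p1 := ler_wpM2l (mulr_ge0 (ltW (h0 N)) c10) Sst.
  have p2 : h_ N * (q * \int[mu]_s e s) <= h_ N * (C2 * eta).
    by rewrite -qe; apply: ler_wpM2l; [exact: ltW|apply: ler_wpM2l => //; exact: ltW].
  move: p1 p2; exact: final_step_arith.
have cv : (t - t1) * (2 * c1 * prim F t + 2 * C3 * eta * G + 12 * (C2 * eta) +
    4 * q * ((h_ N)^-1 * Y N)) @[N --> \oo] -->
    (t - t1) * (2 * c1 * prim F t + 2 * C3 * eta * G + 12 * (C2 * eta) + 4 * q * 0).
  apply: cvgM; first exact: cvg_cst.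
  by apply: cvgD; [exact: cvg_cst|apply: cvgM => //; exact: cvg_cst].
have : prim F t - prim F t1 <=
    (t - t1) * (2 * c1 * prim F t + 2 * C3 * eta * G + 12 * (C2 * eta) + 4 * q * 0).
  by apply: (cvgr_to_ge cv); exact: nearW.
by rewrite mulr0 addr0; move: (prim F t) (prim F t1) => x y; lra.
Qed.

End gronwall_conclusion.

(** * Bounds on the coefficients *)

Section essential_bounds.
Context {R : realType}.
Local Notation mu := (@lebesgue_measure R).
Implicit Types (s t a b : R) (g h : R -> R).

Lemma Lnorm_on_ge0 (D : set R) g : (0 <= Lnorm_on mu +oo%E D g)%E.
Proof. exact: Lnorm_ge0. Qed.

Lemma lebesgue_measureT_gt0 : (0 < mu [set: R])%E.
Proof.
apply: (@lt_le_trans _ _ (mu `]0, 1[)); last by apply: le_measure => //; rewrite inE.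
by rewrite lebesgue_measure_itv/= lte_fin ltr01 -EFinD lte_fin subr0.
Qed.

Lemma Lnorm_on_ae (D : set R) g : (Lnorm_on mu +oo D g < +oo)%E ->
  {ae mu, forall x, D x -> `|g x| <= fine (Lnorm_on mu +oo D g)}.
Proof.
move=> fin; have ge0 := Lnorm_on_ge0 D g.
have Nfin : Lnorm_on mu +oo D g \is a fin_num by rewrite ge0_fin_numE.
move: (fineK Nfin); set c := fine _ => cE.
have := @ess_sup_ge _ _ R mu (abse \o ((EFin \o g) \_ D)).
have -> : ess_sup mu (abse \o ((EFin \o g) \_ D)) = c%:E.
  by rewrite cE /Lnorm_on unlock lebesgue_measureT_gt0.
move=> h; apply: (ae_imp h) => x /= hx Dx.
by move: hx; rewrite patchE mem_set//= lee_fin.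
Qed.

(** The slope bound is known at almost all pairs only. In terms of the continuous primitive of [h]
    it extends to all pairs, by choosing good times s' and t' close to s and t; [lebesgue_pt_le]
    then bounds [h]. *)
Lemma ae_weak_derivative_le a b g h (L : R) (P : R -> Prop) : weak_derivative a b g h ->
  {ae mu, forall t, P t} ->
  (forall s t, P s -> P t -> a < s -> s < t -> t < b -> g t - g s <= L * (t - s)) ->
  {ae mu, forall t, a < t < b -> h t <= L}.
Proof.
move=> wd aeP H; have [lg lh _] := wd.
have aeQ : {ae mu, forall t, a < t < b -> P t /\ lebesgue_pt g t}.
  by apply: (ae_imp2 aeP (ae_lebesgue_pt lg)) => t p1 p2 /p2.
have key s t : a < s -> s < t -> t < b -> \int[mu]_(y in `]s, t[) h y <= L * (t - s).
  move=> as_ st tb.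
  have ih : mu.-integrable `[s, t] (EFin \o h) by exact: (locally_integrable_itv lh).
  pose F := h \_ `[s, t].
  have iF : mu.-integrable [set: R] (EFin \o F).
    by rewrite /F -restrict_EFin; apply/integrable_restrict => //=; rewrite setTI.
  have FE x y : s <= x -> x <= y -> y <= t ->
      \int[mu]_(r in `]x, y[) h r = prim F y - prim F x.
    move=> sx xy yt; rewrite -(primB iF xy); apply: eq_Rintegral => r.
    rewrite inE/= in_itv/= => /andP[r1 r2]; rewrite /F patchE mem_set//= in_itv/=.
    by apply/andP; split; lra.
  rewrite FE ?lexx ?(ltW st)//; rewrite leNgt; apply/negP => Hlt.
  pose G x := prim F x - L * x.
  have cG : continuous G.
    move=> x; apply: cvgB; first exact: prim_continuous.
    by apply: cvgM; [exact: cvg_cst|exact: cvg_id].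
  pose e := (G t - G s) / 3.
  have e0 : 0 < e by rewrite /e /G; lra.
  have /cvgrPdist_lt/(_ _ e0)/nbhs_ballP[d1 /= d10 hd1] := cG s.
  have /cvgrPdist_lt/(_ _ e0)/nbhs_ballP[d2 /= d20 hd2] := cG t.
  have m1 : 0 < Num.min d1 ((t - s) / 2) by rewrite lt_min d10 divr_gt0// subr_gt0.
  have m2 : 0 < Num.min d2 ((t - s) / 2) by rewrite lt_min d20 divr_gt0// subr_gt0.
  have m1s : s < s + Num.min d1 ((t - s) / 2) by rewrite ltrDl.
  have m2s : t - Num.min d2 ((t - s) / 2) < t by rewrite gtrBl.
  have [s' /andP[s1 s2] Qs] := ae_itv_exists m1s aeQ.
  have [t' /andP[t1 t2] Qt] := ae_itv_exists m2s aeQ.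
  have m1a : Num.min d1 ((t - s) / 2) <= d1 by rewrite ge_min lexx.
  have m1b : Num.min d1 ((t - s) / 2) <= (t - s) / 2 by rewrite ge_min lexx orbT.
  have m2a : Num.min d2 ((t - s) / 2) <= d2 by rewrite ge_min lexx.
  have m2b : Num.min d2 ((t - s) / 2) <= (t - s) / 2 by rewrite ge_min lexx orbT.
  have s'ab : a < s' < b by apply/andP; split; lra.
  have t'ab : a < t' < b by apply/andP; split; lra.
  have s't' : s' < t' by lra.
  have [Ps ls] := Qs s'ab; have [Pt lt'] := Qt t'ab.
  have as' : a < s' by lra.
  have t'b : t' < b by lra.
  have := H s' t' Ps Pt as' s't' t'b.
  rewrite (weak_derivative_FTC wd as' s't' t'b ls lt') FE; [|lra|exact: ltW|lra].
  have hs : `|G s - G s'| < e by apply: hd1; rewrite /ball/= distrC gtr0_norm; lra.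
  have ht : `|G t - G t'| < e by apply: hd2; rewrite /ball/= gtr0_norm; lra.
  move: hs ht Hlt; rewrite !ltr_norml /e /G => /andP[hs _] /andP[_ ht].
  move: (prim F s) (prim F t) (prim F s') (prim F t') hs ht => x y z w hs ht Hlt; lra.
apply: (ae_imp (ae_lebesgue_pt lh)) => t pt tab.
by apply: (lebesgue_pt_le lh tab) (pt tab) => s r; exact: key.
Qed.

Lemma ae_weak_derivative_lipschitz a b g h (L : R) (P : R -> Prop) : a < b -> weak_derivative a b g h ->
  {ae mu, forall t, P t} ->
  (forall s t, P s -> P t -> a < s -> s < t -> t < b -> `|g t - g s| <= L * (t - s)) ->
  {ae mu, forall t, a < t < b -> `|h t| <= L}.
Proof.
move=> ab wd aeP H.
have h1 := ae_weak_derivative_le wd aeP (fun s t p q x y z => le_trans (ler_norm _) (H s t p q x y z)).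
have h2 : {ae mu, forall t, a < t < b -> -1 * h t <= L}.
  apply: (ae_weak_derivative_le (weak_derivativeZ (-1) ab wd) aeP) => s t p q x y z.
  by apply: le_trans (H s t p q x y z); rewrite -mulrBr mulN1r -normrN; exact: ler_norm.
apply: (ae_imp2 h1 h2) => t q1 q2 tab; rewrite ler_norml q1//.
by have := q2 tab; rewrite mulN1r lerNl => ->.
Qed.

(** [P] selects the times at which [g] coincides with its version [g'] and [g'] has a Lebesgue
    point, where [weak_derivative_FTC] applies. *)
Lemma lipschitz_of_weak_derivative_ae a b g h C : weak_derivative_ae a b g h ->
  {ae mu, forall t, a < t < b -> `|h t| <= C} ->
  exists2 P : R -> Prop, {ae mu, forall t, P t} &
    forall s t, P s -> P t -> a < s -> s < t -> t < b -> `|g t - g s| <= C * (t - s).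
Proof.
move=> [g' [h' [gg' hh' wd]]] hC; have [lg lh _] := wd.
exists (fun t => a < t < b -> g t = g' t /\ lebesgue_pt g' t).
  by apply: (ae_imp2 gg' (ae_lebesgue_pt lg)) => t q1 q2 q3; split; [exact: q1|exact: q2].
move=> s t Ps Pt as_ st tb.
have [gs ls] : g s = g' s /\ lebesgue_pt g' s by apply: Ps; rewrite as_ (lt_trans st).
have [gt lt'] : g t = g' t /\ lebesgue_pt g' t by apply: Pt; rewrite tb (lt_trans as_).
rewrite gs gt (weak_derivative_FTC wd as_ st tb ls lt').
have ih : mu.-integrable `]s, t[ (EFin \o h').
  apply: (@integrableS _ _ _ mu `[s, t]) => //; first exact: subset_itv_oo_cc.
  exact: (locally_integrable_itv lh).
apply: le_trans (le_normr_Rintegral _ ih) _ => //.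
rewrite -Rintegral_cst_oo ?(ltW st)//; apply: ae_le_Rintegral => //.
- exact: (integrable_norm ih).
- exact: integrable_cst_oo.
- apply: (ae_imp2 hC hh') => r q1 q2; rewrite /= in_itv/= => /andP[r1 r2].
  have rab : a < r < b by rewrite (lt_trans as_)//= (lt_trans r2).
  by rewrite -q2// q1.
Qed.

(** The assumptions bear on a = 1 / R^2. Its Lipschitz bound passes to R by factoring a(t) - a(s) =
    (R(s) - R(t)) (R(s) + R(t)) / (R(s)^2 R(t)^2), with R bounded since a >= a0; this bounds R', and
    a <= A0 bounds 1 / R. *)
Lemma radius_quotient_bound (T : R) (rad rad' : R -> R) (a0 A0 : R) :
  0 < T -> (forall t, 0 <= t <= T -> 0 < rad t) -> weak_derivative_ae 0 T rad rad' ->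
  in_W1oo 0 T (coef_a rad) -> 0 < a0 ->
  {ae mu, forall t, 0 < t < T -> a0 <= coef_a rad t <= A0} ->
  exists2 r0, 0 <= r0 & {ae mu, forall t, 0 < t < T -> `|rad' t / rad t| <= r0}.
Proof.
move=> T0 radp [g [h [gE hE wd]]] [ha [wa _ hafin]] a00 aA.
have hb0 := Lnorm_on_ae hafin; set C := fine _ in hb0.
have hb : {ae mu, forall t, 0 < t < T -> `|ha t| <= C}.
  by apply: (ae_imp hb0) => t q tT; apply: q; rewrite /= in_itv.
have C0 : 0 <= C by rewrite fine_ge0// Lnorm_on_ge0.
have [P aeP LP] := lipschitz_of_weak_derivative_ae wa hb.
(* x^2 y^2 / (x + y) <= a0^-1 y for radii x and y whose squares are at most a0^-1, and y <= 1 +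
   y^2. *)
pose L := C * (a0^-1 * (1 + a0^-1)).
have L0 : 0 <= L by rewrite !mulr_ge0 ?addr_ge0 ?invr_ge0 ?(ltW a00).
have radsq t : 0 < t < T -> a0 <= coef_a rad t -> rad t ^+ 2 <= a0^-1.
  move=> /andP[t0 tT] q; have rp : 0 < rad t by apply: radp; rewrite !ltW.
  by rewrite -[rad t ^+ 2]invrK lef_pV2 ?posrE ?invr_gt0 ?exprn_gt0.
have aeQ : {ae mu, forall t, P t /\ (0 < t < T -> g t = rad t /\ a0 <= coef_a rad t)}.
  apply: (ae_imp2 aeP (ae_imp2 gE aA (fun t q1 q2 => fun tT : 0 < t < T => conj (q1 tT) (q2 tT)))).
  by move=> t p q; split => // tT; have [-> /andP[]] := q tT.
have hL : {ae mu, forall t, 0 < t < T -> `|h t| <= L}.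
  apply: (ae_weak_derivative_lipschitz T0 wd aeQ) => s t [Ps Qs] [Pt Qt] s0 st tT.
  have sI : 0 < s < T by rewrite s0 (lt_trans st).
  have tI : 0 < t < T by rewrite tT (lt_trans s0).
  have [-> as0] := Qs sI; have [-> at0] := Qt tI.
  have s1 := radsq s sI as0; have t1 := radsq t tI at0.
  have sp : 0 < rad s by apply: radp; rewrite !ltW//; case/andP: sI.
  have tp : 0 < rad t by apply: radp; rewrite !ltW//; case/andP: tI.
  have := LP s t Ps Pt s0 st tT; rewrite /coef_a.
  move: (rad s) (rad t) sp tp s1 t1 => x y x0 y0 xa ya.
  have K0 : 0 < a0^-1 by rewrite invr_gt0.
  have y1 : y <= 1 + a0^-1 by have := sqr_ge0 (y - 1); nra.
  have -> : (y ^+ 2)^-1 - (x ^+ 2)^-1 = (x - y) * ((x + y) / (x ^+ 2 * y ^+ 2)).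
    by field; rewrite !gt_eqF.
  have p0 : 0 < (x + y) / (x ^+ 2 * y ^+ 2) by rewrite divr_gt0 ?addr_gt0 ?mulr_gt0 ?exprn_gt0.
  rewrite normrM (gtr0_norm p0) -ler_pdivlMr// distrC => le.
  apply: le_trans le _.
  have -> : L * (t - s) = C * (t - s) * (a0^-1 * (1 + a0^-1)) by rewrite /L; ring.
  have ts0 : 0 <= t - s by rewrite subr_ge0 ltW.
  rewrite ler_wpM2l ?mulr_ge0// invf_div ler_pdivrMr ?addr_gt0//.
  apply: (@le_trans _ _ (a0^-1 * y ^+ 2)); first by rewrite ler_wpM2r ?sqr_ge0.
  rewrite -mulrA ler_wpM2l ?(ltW K0)// expr2; apply: ler_pM; rewrite ?(ltW y0)//.
  by rewrite lerDr ltW.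
(* 1 / R <= 1 + 1 / R^2 <= 1 + A0 avoids a square root. *)
exists (L * (1 + `|A0|)); first by rewrite mulr_ge0.
apply: (ae_imp2 (ae_imp2 hL hE (fun t q1 q2 => fun tT : 0 < t < T => conj (q1 tT) (q2 tT))) aA).
move=> t q1 q2 tT; have [h1 ->] := q1 tT; have /andP[_ q3] := q2 tT.
have rp : 0 < rad t by apply: radp; case/andP: tT => ? ?; rewrite !ltW.
rewrite normrM; apply: ler_pM => //; rewrite gtr0_norm ?invr_gt0//.
move: q3; rewrite /coef_a -exprVn; move: (rad t)^-1 => x q3.
have := sqr_ge0 (x - 1); have := ler_norm A0; nra.
Qed.

End essential_bounds.

(** * Boundedness *)

Section space_time.
Context {R : realType}.
Local Notation mu := (@lebesgue_measure R).
Local Notation mu2 := (mu \x mu)%E.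
Variables (T : R) (u : R -> R -> R) (Phi : R -> R).
Hypothesis mu_QT : measurable_fun (QT T) (fun z => u z.1 z.2).
Hypotheses (cPhi : continuous Phi) (Phi0 : forall x, 0 <= Phi x).

Definition density : R * R -> R := (fun z => z.2 ^+ 2 * Phi (u z.1 z.2)) \_ (QT T).

Lemma measurable_QT : measurable (QT T).
Proof. by apply: measurableX; exact: measurable_itv. Qed.

Lemma density_ge0 z : 0 <= density z.
Proof. by rewrite /density patchE; case: ifP => // _; rewrite mulr_ge0// sqr_ge0. Qed.

Lemma measurable_density : measurable_fun [set: R * R] density.
Proof.
apply/(measurable_restrictT _ measurable_QT); apply: measurable_funM.
  by apply: measurable_funX; apply: measurable_funTS; exact: measurable_snd.
by apply: measurableT_comp mu_QT; exact: continuous_measurable_fun.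
Qed.

Lemma density_slice t : 0 < t < T ->
  (\int[mu]_y (density (t, y))%:E = \int[mu]_(y in `]0%R, 1%R[) (y ^+ 2 * Phi (u t y))%:E)%E.
Proof.
move=> tT; rewrite [RHS]integral_mkcond; apply: eq_integral => y _.
rewrite /density !patchE /QT.
have -> : ((t, y) \in `]0, T[ `*` `]0, 1[) = (y \in (`]0, 1[%classic : set R)).
  apply/idP/idP => [/set_mem[_ /= ?]|/set_mem ?]; apply/mem_set => //.
by case: (y \in (`]0, 1[%classic : set R)).
Qed.

Definition energy t : R := fine (\int[mu]_y (density (t, y))%:E)%E.

Lemma energyE t : 0 < t < T -> energy t = truncation_energy Phi (u t).
Proof. by move=> tT; rewrite /energy density_slice. Qed.

Lemma energy_ge0 t : 0 <= energy t.
Proof. by apply: fine_ge0; apply: integral_ge0 => y _; rewrite lee_fin density_ge0. Qed.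

Lemma measurable_slice_integral :
  measurable_fun [set: R] (fun t => \int[mu]_y (density (t, y))%:E)%E.
Proof.
have mD : measurable_fun [set: R * R] (EFin \o density).
  by apply/measurable_EFinP; exact: measurable_density.
have D0 z : (0 <= (EFin \o density) z)%E by rewrite lee_fin density_ge0.
have := @measurable_fun_fubini_tonelli_F _ _ _ _ R mu (EFin \o density); move=> /(_ mD D0).
exact.
Qed.

Lemma measurable_energy : measurable_fun [set: R] energy.
Proof. by apply: measurableT_comp measurable_slice_integral; exact: fine_measurable. Qed.

(** Tonelli's theorem: the nonnegative density has zero double integral, so it vanishes almost
    everywhere, and the weight y^2 is positive on [QT T]. *)
Lemma energy_null :
  {ae mu, forall t, 0 < t < T ->
    mu.-integrable `]0, 1[ (EFin \o (fun y => y ^+ 2 * Phi (u t y))) /\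
    truncation_energy Phi (u t) = 0} ->
  {ae mu2, forall z, QT T z -> Phi (u z.1 z.2) = 0}.
Proof.
move=> H.
have mD : measurable_fun [set: R * R] (EFin \o density).
  by apply/measurable_EFinP; exact: measurable_density.
have D0 z : (0 <= (EFin \o density) z)%E by rewrite lee_fin density_ge0.
have I0 : (\int[mu2]_z (EFin \o density) z = 0)%E.
  rewrite fubini_tonelli1//.
  rewrite (@ge0_ae_eq_integral _ _ _ mu setT _ (cst 0%E))//.
  - by rewrite integral0.
  - exact: measurable_slice_integral.
  - by move=> t _; apply: integral_ge0.
  - apply: (ae_imp H) => t h _ /=; rewrite /fubini_F.
    have [tT|tT] := boolP (0 < t < T).
      have [i z] := h tT; rewrite density_slice//.
      (* [fine] sends an infinite integral to 0 as well; integrability of the slice rules this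
         out. *)
      have fin := integrable_fin_num _ i.
      by rewrite -[LHS]fineK ?fin//; move: z; rewrite /truncation_energy /Rintegral => ->.
    apply: integral0_eq => y _; rewrite /comp /density patchE ifF//.
    apply/negbTE/negP => /set_mem[/=]; rewrite in_itv/= => h1 _.
    by rewrite h1 in tT.
have : (\int[mu2]_z `|(EFin \o density) z| = 0)%E.
  rewrite -I0; apply: eq_integral => z _; rewrite gee0_abs//.
move=> /(ae_eq_integral_abs mu2 measurableT mD).
move=> [N [mN N0 HN]]; exists N; split => // z /= nz; apply: HN => /= h; apply: nz => zQ.
have [] := h I; rewrite /density patchE mem_set// => /eqP.
case: z zQ {h} => t y [_ /=]; rewrite in_itv/= => /andP[y0 _].
by rewrite mulf_eq0 expf_eq0/= gt_eqF//= => /eqP.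
Qed.

End space_time.

Section energy_vanishes.
Context {R : realType}.
Local Notation mu := (@lebesgue_measure R).

Lemma truncation_energy_le (f phi phi' Phi : R -> R) m Cs Kf (V : R -> R) :
  truncation_data f phi phi' Phi m Cs Kf -> inV V ->
  0 <= truncation_energy Phi V <= 6 * sqn1 V.
Proof.
move=> td VV; have [hV _] := VV; apply/andP; split.
  apply: Rintegral_ge0 => x _; apply: mulr_ge0; first exact: sqr_ge0.
  exact: td_Phi_ge0 td _.
have ii := inH_ip_integrable hV hV.
apply: (@le_trans _ _ (6 * ip V V)); last first.
  by rewrite ler_wpM2l// /sqn1 lerDl ip_ge0.
have i1 := Phi_integrable td hV.
have i6 : mu.-integrable `]0, 1[ (EFin \o (fun x => 6 * (x ^+ 2 * V x * V x))).
  exact: (integrableZl _ _ ii).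
rewrite -(RintegralZl _ _ ii)//; apply: (ae_le_Rintegral _ i1 i6) => //.
apply: aeW => x _; have h := ler_wpM2l (sqr_ge0 x) (td_Phi_le td (V x)).
apply: le_trans h _; rewrite le_eqVlt; apply/orP; left; apply/eqP; ring.
Qed.

Lemma integrable_indicM (T : R) (h : R -> R) : mu.-integrable `]0, T[ (EFin \o h) ->
  mu.-integrable [set: R] (EFin \o (fun t => h t * \1_(`]0, T[%classic) t)) /\
  \int[mu]_t (h t * \1_(`]0, T[%classic) t) = \int[mu]_(t in `]0, T[) h t.
Proof.
move=> ih.
have -> : (fun t => h t * \1_(`]0, T[%classic) t) = h \_ `]0, T[.
  apply/funext => t; rewrite patchE indicE; case: (t \in _); rewrite ?mulr1 ?mulr0//.
split.
  by rewrite -restrict_EFin; apply/integrable_restrict => //=; rewrite setTI.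
by rewrite [RHS]Rintegral_mkcond.
Qed.

Lemma energy_vanishes (T : R) (rad rad' a k u0 f : R -> R) (u : R -> R -> R)
    (phi phi' Phi : R -> R) (m Cs Kf a0 A0 K0 r0 : R) :
  0 < T -> truncation_data f phi phi' Phi m Cs Kf ->
  0 < a0 -> 0 <= A0 -> 0 <= K0 -> 0 <= r0 ->
  {ae mu, forall t, 0 < t < T -> a0 <= a t <= A0} ->
  {ae mu, forall t, 0 < t < T -> 0 <= k t <= K0} ->
  {ae mu, forall t, 0 < t < T -> `|rad' t / rad t| <= r0} ->
  inH u0 -> {ae mu, forall x, 0 < x < 1 -> `|u0 x| <= m} ->
  variational_solution T a k rad rad' f u0 u ->
  in_Bochner T (@inV R) norm1 2%:E u ->
  measurable_fun (QT T) (fun z => u z.1 z.2) ->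
  {ae mu, forall t, 0 < t < T -> truncation_energy Phi (u t) = 0}.
Proof.
move=> T0 td a00 A00 K00 r00 haA hkK hr u0H u0m sol hB mQ.
have [hV sm _] := hB.
have [g [mg g0 ig gu happ]] := bochner_L2_approx hB.
pose D : set R := `]0, T[%classic.
have inD t : 0 < t < T -> \1_D t = 1 :> R.
  by move=> tT; rewrite indicE mem_set//= /D /= in_itv.
have mD : measurable_fun [set: R] (\1_D : R -> R) by apply: measurable_indic; exact: measurable_itv.
have D0 t : 0 <= \1_D t :> R by [].
pose g' t := g t * \1_D t.
have [ig' _] := integrable_indicM ig.
have g'0 t : 0 <= g' t by rewrite mulr_ge0.
have menergy := measurable_energy mQ (td_cPhi td) (td_Phi_ge0 td).
have en0 t := energy_ge0 T u (td_Phi_ge0 td) t.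
(* A version of the energy that is measurable, integrable on the line and 0 outside ]0, T[. The
   minimum changes it on a null set of times only, since Phi(x) <= 6 x^2 and sqn1 (u t) <= g t
   almost everywhere. *)
pose F t := Num.min (energy T u Phi t) (6 * g t) * \1_D t.
have m0 t : 0 <= Num.min (energy T u Phi t) (6 * g t) by rewrite le_min en0 mulr_ge0.
have F0 t : 0 <= F t by rewrite mulr_ge0.
have FE : {ae mu, forall t, 0 < t < T -> F t = truncation_energy Phi (u t)}.
  apply: (ae_imp2 hV gu) => t h1 h2 tT; rewrite /F inD// mulr1 energyE//.
  have /andP[_ le] := truncation_energy_le td (h1 tT).
  rewrite min_l//; apply: le_trans le _; rewrite ler_wpM2l//; exact: h2.
have mF : measurable_fun [set: R] F.
  apply: measurable_funM => //; apply: measurable_minr => //; exact: measurable_funM.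
have i6 : mu.-integrable [set: R] (EFin \o (fun t => 6 * g' t)) by exact: (integrableZl _ _ ig').
have iF : mu.-integrable [set: R] (EFin \o F).
  apply: (le_integrable_R _ mF _ i6) => // t _; rewrite ger0_norm// /F /g' mulrA.
  by rewrite ler_wpM2r// ge_min lexx orbT.
have Fneg t : t <= 0 -> F t = 0.
  move=> t0; rewrite /F indicE memNset ?mulr0//= /D /= in_itv/= => /andP[h _].
  by rewrite ltNge t0 in h.
have Cs0 := td_Cs td; have Kf0 := td_Kf td.
have AK : 0 <= 48 * A0 * K0 by rewrite !mulr_ge0.
pose c1 := r0 ^+ 2 * Cs / a0.
pose C2 := 3 * A0 + 3 * r0 + Kf + 48 * A0 * K0.
pose C3 := 3 * A0 + 3 * r0 + 48 * A0 * K0.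
have c10 : 0 <= c1 by rewrite /c1 divr_ge0 ?(ltW a00)// mulr_ge0// sqr_ge0.
have C20 : 0 <= C2 by rewrite /C2; lra.
have C30 : 0 <= C3 by rewrite /C3; lra.
have PF : prim F T = 0.
  apply: (averaged_gronwall T0 c10 C20 C30 iF F0 Fneg ig' g'0) => eta eps eta01 eps0.
  have [q [e [[sq me e0 ie eeps] qe]]] := happ _ eps0.
  have [n [A [c [mA cV qE]]]] := X_simpleP sq.
  have [ie' ieE] := integrable_indicM ie.
  pose e' t := e t * \1_D t.
  have me' : measurable_fun [set: R] e' by exact: measurable_funM.
  have e'0 t : 0 <= e' t by rewrite mulr_ge0.
  (* Inside ]0, T[ the indicators are unchanged, and the sets now have integrable indicators. *)
  pose A' i := A i `&` D.
  have mA' i : measurable (A' i) by apply: measurableI => //; exact: measurable_itv.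
  have qe' : {ae mu, forall t, 0 < t < T ->
      sqn1 (u t \- simple_comb c (fun i => \1_(A' i) t)) <= e' t}.
    apply: (ae_imp qe) => t h tT; rewrite /e' inD// mulr1.
    have -> : (fun i => \1_(A' i) t : R) = (fun i => \1_(A i) t).
      apply/funext => i; rewrite !indicE /A' in_setI (mem_set (_ : D t)) ?andbT//.
    by rewrite -qE; exact: h.
  have ieD : mu.-integrable `]0, T[ (EFin \o e') by exact: (@integrableS _ _ _ mu [set: R]).
  exists e', n, A', (fun i => 2 ^+ n * sqn1 (c i)); split; first by split => //; rewrite ieE.
  split => //.
  - by move=> i t [].
  - by move=> i; rewrite mulr_ge0 ?exprn_ge0// sqn1_ge0.
  - have main := main_inequality td a00 K00 r00 haA hkK hr u0H u0m sol hV sm eta01 mA' cV me' e'0 ieD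
      g0 A00 gu qe'.
    apply: (ae_imp2 main FE) => tau h FEt tT.
    have gE : g tau * \1_D tau = g tau by rewrite inD// mulr1.
    have [h1 h2] := h tT; rewrite FEt// gE; split; first exact: h1.
    apply: (ae_imp2 h2 FE) => s h3 FEs sT.
    rewrite FEs; first exact: h3.
    by case/andP: sT => s0 st; rewrite s0 (lt_trans st)//; case/andP: tT.
have iFT : mu.-integrable `]-oo, T[ (EFin \o F) by exact: (@integrableS _ _ _ mu [set: R]).
have Z : (\int[mu]_(t in `]-oo, T[) `|(EFin \o F) t| = 0)%E.
  transitivity (\int[mu]_(t in `]-oo, T[) (EFin \o F) t)%E.
    by apply: eq_integral => t _; rewrite gee0_abs//= lee_fin.
  rewrite -[LHS]fineK; last exact: integrable_fin_num _ iFT.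
  by move: PF; rewrite /prim /Rintegral => ->.
have [mFT _] := integrableP _ _ _ iFT.
have := (ae_eq_integral_abs mu (measurable_itv _) mFT).1 Z.
move=> H; apply: (ae_imp2 H FE) => t h1 h2 tT; rewrite -h2//.
have /h1 [] // : (`]-oo, T[%classic : set R) t.
by rewrite /= in_itv/=; case/andP: tT.
Qed.

End energy_vanishes.

Section bounded_data.
Context {R : realType}.
Local Notation mu := (@lebesgue_measure R).

Lemma bounded_inH (v : R -> R) (m : R) : 0 <= m -> measurable_fun (`]0%R, 1%R[ : set R) v ->
  {ae mu, forall x, 0 < x < 1 -> `|v x| <= m} -> inH v.
Proof.
move=> m0 mv vm.
(* Clamping turns the almost everywhere bound into one valid everywhere, without changing the
   class. *)
pose w x := Num.max (- m) (Num.min m (v x)).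
have mw : measurable_fun (`]0%R, 1%R[ : set R) w.
  by apply: measurable_maxr => //; exact: measurable_minr.
have hw : inH w.
  apply: (inH_le mw (inH_cst m)) => x _ /=.
  have h : - m <= w x <= m.
    by rewrite /w le_max lexx ge_max ge_min lexx andbT/=; lra.
  by rewrite -ler_sqrt ?sqr_ge0// !sqrtr_sqr (ger0_norm m0) ler_norml.
apply: (inH_ae_eq mv hw); apply: (ae_imp vm) => x h x01.
have := h x01; rewrite ler_norml => /andP[h1 h2].
by rewrite /w min_r// max_r.
Qed.

Lemma measurable_QT_unweight (T p : R) (u : R -> R -> R) :
  measurable_fun (QT T) (fun z => z.2 `^ (2 / p) * u z.1 z.2) ->
  measurable_fun (QT T) (fun z => u z.1 z.2).
Proof.
move=> mw.
have mpow : measurable_fun (QT T) (fun z : R * R => z.2 `^ (- (2 / p))).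
  apply: measurable_funTS; apply: (measurableT_comp (measurable_powR _)).
  exact: measurable_snd.
apply: (eq_measurable_fun (fun z => z.2 `^ (- (2 / p)) * (z.2 `^ (2 / p) * u z.1 z.2))).
  move=> [t x] /set_mem[_ /=]; rewrite in_itv/= => /andP[x0 _].
  by rewrite powRN mulKf// gt_eqF// powR_gt0.
exact: measurable_funM.
Qed.

End bounded_data.

Theorem theorem2 (R : realType) (T : R) (hT : 0 < T)
    (rad rad' : R -> R) (K1 K2 K3 : R) (rhoG : R -> R -> R)
    (hrad : forall t : R, 0 <= t <= T -> 0 < rad t)
    (hrad' : weak_derivative_ae 0 T rad rad')
    (a : R -> R) (ha : a = coef_a rad)
    (k : R -> R) (hk : k = coef_k rad rad' K1 K2 K3 rhoG)
    (u0 f : R -> R) (M a0 k0 C1 C1' C2 p delta : R)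
    (* (1) *)
    (hu0 : in_Lebesgue (@lebesgue_measure R) +oo%E `]0, 1[ u0)
    (hM : {ae @lebesgue_measure R, forall x : R, 0 < x < 1 -> `|u0 x| <= M})
    (* (2) *)
    (haW : in_W1oo 0 T a) (hkW : in_W1oo 0 T k)
    (ha0 : 0 < a0) (hk0 : 0 < k0)
    (haa0 : {ae @lebesgue_measure R, forall t : R, 0 < t < T -> a0 <= a t})
    (hkk0 : {ae @lebesgue_measure R, forall t : R, 0 < t < T -> k0 <= k t})
    (* (3) *)
    (hf : continuous f)
    (* (4) *)
    (hC1 : 0 < C1) (hC1' : 0 < C1') (hC2 : 0 < C2) (hp : 1 < p < 3)
    (hf_coercive : forall s : R, C1 * `|s| `^ p - C1' <= s * f s)
    (hf_growth : forall s : R, `|f s| <= C2 * (1 + `|s| `^ (p - 1)))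
    (* (5) *)
    (hf_mono : forall s r : R, - delta * `|s - r| ^+ 2 <= (f s - f r) * (s - r))
    (* (6) *)
    (hf_sign : forall s : R,
       (Lnorm_on (@lebesgue_measure R) +oo `]0%R, 1%R[ u0 <= `|s|%:E)%E ->
       0 <= s * f s)
    (u : R -> R -> R)
    (hu_class : solution_class T p u)
    (hu_sol : variational_solution T a k rad rad' f u0 u) :
  in_Lebesgue (@lebesgue_measure R \x @lebesgue_measure R)%E +oo%E (QT T)
    (fun z => u z.1 z.2).
Proof.
subst a k.
have [mu0 fu0] := hu0.
pose Nu0 := Lnorm_on (@lebesgue_measure R) +oo%E `]0%R, 1%R[ u0.
have Nu0_ge0 : (0 <= Nu0)%E by exact: Lnorm_on_ge0.
(* The truncation level is the essential norm of [u0] itself, the threshold from which [hf_sign]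
   gives the sign of [f]. *)
pose m := fine Nu0.
have mE : Nu0 = m%:E by rewrite /m fineK// ge0_fin_numE.
have m0 : 0 <= m by exact: fine_ge0.
have u0m : {ae @lebesgue_measure R, forall x : R, 0 < x < 1 -> `|u0 x| <= m}.
  by apply: (ae_imp (Lnorm_on_ae fu0)) => x h xI; apply: h; rewrite /= in_itv.
have u0H := bounded_inH m0 mu0 u0m.
have sign s : m <= `|s| -> 0 <= s * f s by move=> ms; apply: hf_sign; rewrite -/Nu0 mE lee_fin.
have [phi [phi' [Phi [Cs [Kf td]]]]] := truncation_data_exists m0 hf (ltW hC2) hp hf_growth sign.
have [_ [_ fa _]] := haW; have [_ [_ fk _]] := hkW.
pose A0 := fine (Lnorm_on (@lebesgue_measure R) +oo `]0%R, T[ (coef_a rad)).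
pose K0 := fine (Lnorm_on (@lebesgue_measure R) +oo `]0%R, T[ (coef_k rad rad' K1 K2 K3 rhoG)).
have A00 : 0 <= A0 by rewrite fine_ge0// Lnorm_on_ge0.
have K00 : 0 <= K0 by rewrite fine_ge0// Lnorm_on_ge0.
have haA : {ae @lebesgue_measure R, forall t : R, 0 < t < T -> a0 <= coef_a rad t <= A0}.
  apply: (ae_imp2 haa0 (Lnorm_on_ae fa)) => t h1 h2 tT; rewrite h1//=.
  by apply: le_trans (ler_norm _) _; apply: h2; rewrite /= in_itv.
have hkK : {ae @lebesgue_measure R, forall t : R, 0 < t < T ->
    0 <= coef_k rad rad' K1 K2 K3 rhoG t <= K0}.
  apply: (ae_imp2 hkk0 (Lnorm_on_ae fk)) => t h1 h2 tT.
  rewrite (le_trans (ltW hk0) (h1 tT))/=.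
  by apply: le_trans (ler_norm _) _; apply: h2; rewrite /= in_itv.
have [r0 r00 hr] := radius_quotient_bound hT hrad hrad' haW ha0 haA.
have [[hB _] [mw _] _ _] := hu_class; have [hV _ _] := hB.
have muQ := measurable_QT_unweight mw.
have E0 := energy_vanishes hT td ha0 A00 K00 r00 haA hkK hr u0H u0m hu_sol hB muQ.
have aePhi := energy_null muQ (td_cPhi td) (td_Phi_ge0 td)
  (ae_imp2 hV E0 (fun t h1 h2 tT => conj (Phi_integrable td (h1 tT).1) (h2 tT))).
split=> //; apply: (@le_lt_trans _ _ m%:E); last exact: ltry.
(* The norm for the exponent +oo is the essential supremum if the whole space has positive measure,
   and 0 otherwise. *)
rewrite /Lnorm_on unlock; case: ifP => _; last by rewrite lee_fin.
apply/ess_supP; case: aePhi => N [mN N0 HN]; exists N; split => // z /= nz; apply: HN => /= h.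
apply: nz; rewrite patchE; case: ifP => [/set_mem zQ|_]; last by rewrite abse0 lee_fin.
by rewrite /= lee_fin -(td_Phi_eq0 td) h.
Qed.
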